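(* Let $R$ be a commutative ring, $A$ a commutative $R$-algebra and $G$ a flat and affine group scheme over $R$. If $\mathrm B_RG$ has the resolution property, then the functors $$\mathrm{Mod}^GA\to\mathrm{QAdd}^GA,\qquad \mathrm{QRings}^GA\to\mathrm{QPMon}^GA,\qquad \mathrm{QAlg}^GA\to\mathrm{QMon}^GA$$ which map $M$ to the functor $(-\otimes_RM)^G\colon\mathrm{Vect}^GR\to\mathrm{Mod}\,A$ are well defined, fully faithful and have as essential image the subcategory of functors which are left exact on short exact sequences in $\mathrm{Vect}^GR$. In particular they are equivalences if $G$ is a linearly reductive group.
   Context: $R[G]=\mathrm H^0(G,\mathcal O_G)$. $\mathrm{Mod}^GA$ is the category of $G$-comodules over $A$, i.e. $A$-modules $M$ with an $A$-linear $G$-comodule structure $M\to M\otimes_RR[G]$; $(-)^G$ denotes invariants. $\mathrm B_RG$ is the stack of $G$-torsors for the fpqc topology; $\mathrm{QCoh}(\mathrm B_RG)\simeq\mathrm{Mod}^GR$. $\mathrm{Vect}^GA$ is the full subcategory of $\mathrm{Mod}^GA$ of comodules which are finitely generated projective as $A$-modules. $\mathrm B_RG$ has the resolution property if every object of $\mathrm{Mod}^GR$ is a quotient (in $\mathrm{Mod}^GR$) of a possibly infinite direct sum of objects of $\mathrm{Vect}^GR$. $\mathrm{QAdd}^GA$ (resp. $\mathrm{QPMon}^GA$, $\mathrm{QMon}^GA$) is the category of covariant $R$-linear (resp. $R$-linear pseudo-monoidal, $R$-linear monoidal) functors $\mathrm{Vect}^GR\to\mathrm{Mod}\,A$. Here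 a pseudo-monoidal functor is an $R$-linear functor $\Gamma$ with a natural transformation $\iota_{V,W}\colon\Gamma_V\otimes_A\Gamma_W\to\Gamma_{V\otimes_R W}$; a monoidal functor is a pseudo-monoidal functor which is symmetric and associative (compatible in the evident way with the symmetry and associativity isomorphisms) and has a unity, i.e. a map $1\colon A\to\Gamma_R$ such that $\Gamma_V\otimes_A A\to\Gamma_V\otimes_A\Gamma_R\to\Gamma_{V\otimes R}\to\Gamma_V$ and its left analogue are the natural isomorphisms. Arrows are natural transformations commuting with $\iota$ (and preserving the unities in the monoidal case). $\mathrm{QRings}^GA$ is the category of $M\in\mathrm{Mod}^GA$ with a $G$-equivariant ($A$-linear) map $M\otimes_AM\to M$ (no further axioms), with arrows compatible with it; $\mathrm{QAlg}^GA$ is its (not full) subcategory of those $M$ whose multiplication is commutative, associative and has a unity ($G$-invariant), with arrows preserving unities. The pseudo-monoidal structure on $(-\otimes_RM)^G$ is induced by the multiplication of $M$. A functor $\Gamma\colon\mathrm{Vect}^GR\to\mathrm{Mod}\,A$ is left exact on short exact sequences if every exact sequence $0\to V'\to V\to V''\to0$ in $\mathrm{Mod}^GR$ with terms in $\mathrm{Vect}^GR$ is sent to an exact sequence $0\to\Gamma_{V'}\to\Gamma_V\to\Gamma_{V''}$. $G$ is linearly reductive if $(-)^G\colon\mathrm{Mod}^GR\to\mathrm{Mod}\,R$ is exact. *)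

(* Defs.v *)
From HB Require Import structures.
From mathcomp Require Import all_boot all_order all_algebra.
From mathcomp Require Import boolp.

Set Implicit Arguments.
Unset Strict Implicit.
Unset Printing Implicit Defensive.

Import GRing.Theory.
Local Open Scope ring_scope.
Local Open Scope quotient_scope.

Section Linear.
Variables (R : pzRingType) (U V : lmodType R).

Definition mklin (f : U -> V) (hf : linear f) : {linear U -> V} :=
  HB.pack f (GRing.isLinear.Build R U V *:%R f hf).

Lemma linear_ext (f g : {linear U -> V}) : f =1 g -> f = g.
Proof.
move=> /funext; case: f g => [f [[mf] [sf]]] [g [[mg] [sg]]] /= efg.
subst g; congr (GRing.Linear.Pack (GRing.Linear.Class _ _)).
- by congr GRing.isNmodMorphism.Axioms_; exact: Prop_irrelevance.
- by congr GRing.isScalable.Axioms_; exact: Prop_irrelevance.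
Qed.

End Linear.

(* [pres adm] is the R-module generated by X that is universal for the maps
   X -> P satisfying [adm]: formal R-linear combinations of elements of X, two of
   them being identified when every admissible map gives them the same value.
   It yields tensor products (admissible = bilinear) and direct sums
   (admissible = linear on each summand); in both cases the generators
   themselves form an admissible family, so [plift] is the universal property. *)
Section PresentedModule.
Variables (R : pzRingType) (X : choiceType).
Variable adm : forall P : lmodType R, (X -> P) -> Prop.

Definition fsum (P : lmodType R) (f : X -> P) (s : seq (R * X)) : P :=
  \sum_(c <- s) c.1 *: f c.2.

Definition pres_rel (s t : seq (R * X)) : bool :=
  `[< forall (P : lmodType R) (f : X -> P), adm f -> fsum f s = fsum f t >].

Lemma pres_rel_refl : reflexive pres_rel.
Proof. by move=> s; apply/asboolP. Qed.

Lemma pres_rel_sym : symmetric pres_rel.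
Proof.
by move=> s t; apply/asboolP/asboolP => h P f hf; rewrite h.
Qed.

Lemma pres_rel_trans : transitive pres_rel.
Proof.
move=> t s u /asboolP h /asboolP k; apply/asboolP => P f hf.
by rewrite h // k.
Qed.

Canonical pres_equiv :=
  EquivRel pres_rel pres_rel_refl pres_rel_sym pres_rel_trans.

Definition pres : Type := {eq_quot pres_rel}.
HB.instance Definition _ := Choice.on pres.
HB.instance Definition _ := Quotient.on pres.

Definition peval (P : lmodType R) (f : X -> P) (x : pres) : P :=
  fsum f (repr x).

Lemma peval_pi (P : lmodType R) (f : X -> P) s :
  adm f -> peval f (\pi_pres s) = fsum f s.
Proof.
move=> hf; rewrite /peval; case: piP => t /eqmodP /asboolP h.
by rewrite -h.
Qed.

Lemma pres_ext (x y : pres) :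
  (forall (P : lmodType R) (f : X -> P), adm f -> peval f x = peval f y) ->
  x = y.
Proof.
move=> h; rewrite -[x]reprK -[y]reprK; apply/eqmodP/asboolP => P f hf.
exact: h.
Qed.

Definition pzero : pres := \pi_pres [::].
Definition padd (x y : pres) : pres := \pi_pres (repr x ++ repr y).
Definition pscale (a : R) (x : pres) : pres :=
  \pi_pres [seq (a * c.1, c.2) | c <- repr x].
Definition popp (x : pres) : pres := pscale (-1) x.

Section Eval.
Variables (P : lmodType R) (f : X -> P) (hf : adm f).

Lemma peval0 : peval f pzero = 0.
Proof. by rewrite peval_pi // /fsum big_nil. Qed.

Lemma pevalD x y : peval f (padd x y) = peval f x + peval f y.
Proof. by rewrite peval_pi // /fsum big_cat. Qed.

Lemma pevalZ a x : peval f (pscale a x) = a *: peval f x.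
Proof.
rewrite peval_pi // /peval /fsum big_map scaler_sumr.
by apply: eq_bigr => c _; rewrite scalerA.
Qed.

End Eval.

Fact paddA : associative padd.
Proof. by move=> x y z; apply: pres_ext => P f hf; rewrite !pevalD // addrA. Qed.
Fact paddC : commutative padd.
Proof. by move=> x y; apply: pres_ext => P f hf; rewrite !pevalD // addrC. Qed.
Fact padd0 : left_id pzero padd.
Proof. by move=> x; apply: pres_ext => P f hf; rewrite pevalD // peval0 // add0r. Qed.
Fact paddN : left_inverse pzero popp padd.
Proof.
move=> x; apply: pres_ext => P f hf.
by rewrite pevalD // peval0 // pevalZ // scaleN1r addNr.
Qed.

HB.instance Definition _ := GRing.isZmodule.Build pres paddA paddC padd0 paddN.

Fact pscaleA a b x : pscale a (pscale b x) = pscale (a * b) x.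
Proof. by apply: pres_ext => P f hf; rewrite !pevalZ // scalerA. Qed.
Fact pscale1 : left_id 1 pscale.
Proof. by move=> x; apply: pres_ext => P f hf; rewrite pevalZ // scale1r. Qed.
Fact pscaleDr : right_distributive pscale +%R.
Proof.
by move=> a x y; apply: pres_ext => P f hf; rewrite !(pevalZ, pevalD) // scalerDr.
Qed.
Fact pscaleDl x : {morph pscale^~ x : a b / a + b}.
Proof.
by move=> a b; apply: pres_ext => P f hf; rewrite !(pevalZ, pevalD) // scalerDl.
Qed.

HB.instance Definition _ :=
  GRing.Zmodule_isLmodule.Build R pres pscaleA pscale1 pscaleDr pscaleDl.

Definition pgen (x : X) : pres := \pi_pres [:: (1, x)].

Lemma peval_gen (P : lmodType R) (f : X -> P) x : adm f -> peval f (pgen x) = f x.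
Proof. by move=> hf; rewrite peval_pi // /fsum big_seq1 scale1r. Qed.

Lemma peval_linear (P : lmodType R) (f : X -> P) : adm f -> linear (peval f).
Proof. by move=> hf a x y; rewrite pevalD // pevalZ. Qed.

(* Opaque on purpose: [pliftE] determines the map by [pres_ind], and simplification
   should not look inside. *)
Lemma plift_subproof (P : lmodType R) (f : X -> P) (hf : adm f) :
  {g : {linear pres -> P} | forall x, g (pgen x) = f x}.
Proof.
by exists (mklin (peval_linear hf)) => x; exact: peval_gen.
Qed.

Definition plift (P : lmodType R) (f : X -> P) (hf : adm f) : {linear pres -> P} :=
  sval (plift_subproof hf).

Lemma pliftE (P : lmodType R) (f : X -> P) (hf : adm f) x : plift hf (pgen x) = f x.
Proof. by rewrite /plift; case: (plift_subproof hf). Qed.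

Lemma pres_ind (Q : pres -> Prop) :
  Q 0 -> (forall a x, Q (a *: pgen x)) ->
  (forall x y, Q x -> Q y -> Q (x + y)) -> forall x, Q x.
Proof.
move=> Q0 Qg QD x; rewrite -[x]reprK; elim: (repr x) => [//|[a y] s IHs].
suff -> : \pi_pres ((a, y) :: s) = a *: pgen y + \pi_pres s by apply: QD.
apply: pres_ext => P f hf.
rewrite pevalD // pevalZ // peval_gen // !peval_pi //.
by rewrite /fsum big_cons.
Qed.

End PresentedModule.

Section Tensor.
Variable R : comPzRingType.

Definition bilin (M N P : lmodType R) (b : M -> N -> P) : Prop :=
  (forall n, linear (b^~ n)) /\ (forall m, linear (b m)).

Definition tensor_adm (M N P : lmodType R) (f : M * N -> P) : Prop :=
  bilin (fun m n => f (m, n)).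

Definition tensor (M N : lmodType R) : lmodType R :=
  pres (@tensor_adm M N).

Definition tens (M N : lmodType R) (m : M) (n : N) : tensor M N :=
  pgen (@tensor_adm M N) (m, n).

Local Notation "m *t n" := (tens m n) (at level 40, left associativity).

Section Lift.
Variables M N : lmodType R.

Lemma tens_linl (n : N) : linear (fun m : M => m *t n).
Proof.
move=> a m m'; apply: pres_ext => P f hf.
by rewrite pevalD // pevalZ // !peval_gen // (hf.1 n).
Qed.

Lemma tens_linr (m : M) : linear (fun n : N => m *t n).
Proof.
move=> a n n'; apply: pres_ext => P f hf.
by rewrite pevalD // pevalZ // !peval_gen // (hf.2 m).
Qed.

Definition tensl (n : N) : {linear M -> tensor M N} := mklin (tens_linl n).
Definition tensr (m : M) : {linear N -> tensor M N} := mklin (tens_linr m).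

Lemma tensDl m m' (n : N) : (m + m') *t n = m *t n + m' *t n :> tensor M N.
Proof. exact: (linearD (tensl n)). Qed.
Lemma tensDr (m : M) n n' : m *t (n + n') = m *t n + m *t n' :> tensor M N.
Proof. exact: (linearD (tensr m)). Qed.
Lemma tensZl a m (n : N) : (a *: m) *t n = a *: (m *t n) :> tensor M N.
Proof. exact: (linearZ_LR (tensl n)). Qed.
Lemma tensZr a (m : M) n : m *t (a *: n) = a *: (m *t n) :> tensor M N.
Proof. exact: (linearZ_LR (tensr m)). Qed.

Section Lift1.
Variables (P : lmodType R) (b : M -> N -> P) (hb : bilin b).

Lemma tlift_adm : tensor_adm (fun p => b p.1 p.2).
Proof. exact: hb. Qed.

Definition tlift : {linear tensor M N -> P} := plift tlift_adm.

Lemma tliftE m n : tlift (m *t n) = b m n.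
Proof. exact: (pliftE tlift_adm (m, n)). Qed.

End Lift1.

Lemma tens_ind (Q : tensor M N -> Prop) :
  (forall m n, Q (m *t n)) -> (forall x y, Q x -> Q y -> Q (x + y)) ->
  forall x, Q x.
Proof.
move=> Qg QD; apply: pres_ind => //.
- rewrite -(linear0 (tensl 0)); exact: Qg.
- move=> a [m n]; rewrite -[pgen _ _]/(m *t n) -tensZl; exact: Qg.
Qed.

End Lift.

Section Map.
Variables M N M' N' : lmodType R.
Variables (f : {linear M -> M'}) (g : {linear N -> N'}).

Lemma tmap_bilin : bilin (fun m n => f m *t g n).
Proof.
split=> [n|m] a x y; first by rewrite linearP tensDl tensZl.
by rewrite linearP tensDr tensZr.
Qed.

Definition tmap : {linear tensor M N -> tensor M' N'} := tlift tmap_bilin.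

Lemma tmapE m n : tmap (m *t n) = f m *t g n.
Proof. exact: tliftE. Qed.

End Map.

Section Assoc.
Variables M N P : lmodType R.

Lemma tassoc_bilin :
  bilin (fun (x : tensor M N) (p : P) => tmap idfun (tensl N p) x
     : tensor M (tensor N P)).
Proof.
split=> [p|x] a y z; first by rewrite linearP.
elim/tens_ind: x => [m n|x x' ihx ihx'].
  by rewrite !tmapE /= tensDr tensZr tensDr tensZr.
by rewrite !linearD ihx ihx' addrACA.
Qed.

Definition tassoc : {linear tensor (tensor M N) P -> tensor M (tensor N P)} :=
  tlift tassoc_bilin.

Lemma tassocE m n p : tassoc (m *t n *t p) = m *t (n *t p).
Proof. by rewrite tliftE tmapE. Qed.

Lemma tassocI_bilin :
  bilin (fun (m : M) (x : tensor N P) => tmap (tensr N m) idfun x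
     : tensor (tensor M N) P).
Proof.
split=> [x|m] a y z; last by rewrite linearP.
elim/tens_ind: x => [n p|x x' ihx ihx'].
  by rewrite !tmapE /= tensDl tensZl tensDl tensZl.
by rewrite !linearD ihx ihx' addrACA.
Qed.

Definition tassocI : {linear tensor M (tensor N P) -> tensor (tensor M N) P} :=
  tlift tassocI_bilin.

Lemma tassocIE m n p : tassocI (m *t (n *t p)) = m *t n *t p.
Proof. by rewrite tliftE tmapE. Qed.

End Assoc.

Section Swap.
Variables M N : lmodType R.

Lemma tswap_bilin : bilin (fun (m : M) (n : N) => n *t m).
Proof. by split=> [n|m] a x y; rewrite (tensDl, tensDr) (tensZl, tensZr). Qed.

Definition tswap : {linear tensor M N -> tensor N M} := tlift tswap_bilin.

Lemma tswapE m n : tswap (m *t n) = n *t m. Proof. exact: tliftE. Qed.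

Lemma trid_bilin : bilin (fun (m : M) (a : R^o) => (a : R) *: m).
Proof.
split=> [n|m] a x y; rewrite ?scalerDr ?scalerDl !scalerA //.
by rewrite mulrC.
Qed.

Definition trid : {linear tensor M R^o -> M} := tlift trid_bilin.

Lemma tridE (m : M) (a : R^o) : trid (m *t a) = (a : R) *: m.
Proof. exact: tliftE. Qed.

Lemma tlid_bilin : bilin (fun (a : R^o) (m : M) => (a : R) *: m).
Proof.
by split=> [n|m] a x y; rewrite ?scalerDr ?scalerDl !scalerA // mulrC.
Qed.

Definition tlid : {linear tensor R^o M -> M} := tlift tlid_bilin.

Lemma tlidE (a : R^o) (m : M) : tlid (a *t m) = (a : R) *: m.
Proof. exact: tliftE. Qed.

End Swap.

Lemma tmid_subproof (M N P Q : lmodType R) :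
  {f : {linear tensor (tensor M N) (tensor P Q) ->
               tensor (tensor M P) (tensor N Q)} |
   forall m n p q, f ((m *t n) *t (p *t q)) = (m *t p) *t (n *t q)}.
Proof.
pose f : {linear tensor (tensor M N) (tensor P Q) -> tensor (tensor M P) (tensor N Q)} :=
  tassocI M P (tensor N Q)
  \o tmap idfun (tassoc P N Q \o tmap (tswap N P) idfun \o tassocI N P Q)
  \o tassoc M N (tensor P Q).
exists f => m n p q.
by rewrite /f /= tassocE tmapE /= tassocIE tmapE tswapE /= tassocE tassocIE.
Qed.

Definition tmid (M N P Q : lmodType R) :
    {linear tensor (tensor M N) (tensor P Q) -> tensor (tensor M P) (tensor N Q)} :=
  sval (tmid_subproof M N P Q).

Lemma tmidE (M N P Q : lmodType R) (m : M) (n : N) (p : P) (q : Q) :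
  tmid M N P Q ((m *t n) *t (p *t q)) = (m *t p) *t (n *t q).
Proof. by rewrite /tmid; case: (tmid_subproof M N P Q). Qed.

End Tensor.

Notation "m *t n" := (tens m n) (at level 40, left associativity) : ring_scope.

Section TmapTheory.
Variable R : comPzRingType.

Lemma tmap_id (M N : lmodType R) (f : {linear M -> M}) (g : {linear N -> N}) :
  f =1 id -> g =1 id -> tmap f g =1 id.
Proof.
move=> ef eg x; elim/tens_ind: x => [m n|x y hx hy].
  by rewrite tmapE ef eg.
by rewrite linearD hx hy.
Qed.

Lemma tmap_comp (M N M' N' M2 N2 : lmodType R)
    (f : {linear M -> M'}) (g : {linear N -> N'})
    (f' : {linear M' -> M2}) (g' : {linear N' -> N2})
    (h : {linear M -> M2}) (k : {linear N -> N2}) :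
  (forall m, f' (f m) = h m) -> (forall n, g' (g n) = k n) ->
  forall x, tmap f' g' (tmap f g x) = tmap h k x.
Proof.
move=> eh ek x; elim/tens_ind: x => [m n|x y hx hy].
  by rewrite !tmapE eh ek.
by rewrite !linearD hx hy.
Qed.

Lemma eq_tmap (M N M' N' : lmodType R)
    (f f' : {linear M -> M'}) (g g' : {linear N -> N'}) :
  f =1 f' -> g =1 g' -> tmap f g =1 tmap f' g'.
Proof.
move=> ef eg x; elim/tens_ind: x => [m n|x y hx hy].
  by rewrite !tmapE ef eg.
by rewrite !linearD hx hy.
Qed.

End TmapTheory.

(* Restriction of scalars along phi. *)
Definition restr (R A : comPzRingType) (phi : {rmorphism R -> A}) (M : lmodType A) :
  Type := M.

Section Restriction.
Variables (R A : comPzRingType) (phi : {rmorphism R -> A}).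
Local Notation restr := (restr phi).

Section RestrInstance.
Variable M : lmodType A.
HB.instance Definition _ := GRing.Zmodule.on (restr M).

Definition restr_scale (r : R) (m : restr M) : restr M := phi r *: (m : M).

Fact restr_scaleA a b m : restr_scale a (restr_scale b m) = restr_scale (a * b) m.
Proof. by rewrite /restr_scale scalerA rmorphM. Qed.
Fact restr_scale1 : left_id 1 restr_scale.
Proof. by move=> m; rewrite /restr_scale rmorph1 scale1r. Qed.
Fact restr_scaleDr : right_distributive restr_scale +%R.
Proof. by move=> a m n; rewrite /restr_scale scalerDr. Qed.
Fact restr_scaleDl m : {morph restr_scale^~ m : a b / a + b}.
Proof. by move=> a b; rewrite /restr_scale rmorphD scalerDl. Qed.

HB.instance Definition _ := GRing.Zmodule_isLmodule.Build R (restr M)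
  restr_scaleA restr_scale1 restr_scaleDr restr_scaleDl.

Lemma restrZ (r : R) (m : restr M) : r *: m = phi r *: (m : M).
Proof. by []. Qed.

Lemma restr_act_linear (a : A) : linear (fun m : restr M => (a *: (m : M) : restr M)).
Proof.
by move=> r x y /=; rewrite scalerDr !restrZ !scalerA mulrC.
Qed.

Definition restr_act (a : A) : {linear restr M -> restr M} :=
  mklin (restr_act_linear a).

End RestrInstance.

Section RestrMap.
Variables (M N : lmodType A) (f : {linear M -> N}).

Lemma restr_map_linear : linear (f : restr M -> restr N).
Proof. by move=> r x y; rewrite !restrZ linearP. Qed.

Definition restr_map : {linear restr M -> restr N} := mklin restr_map_linear.
End RestrMap.

(* The R-algebra A (with structure map phi) as an R-module. *)
Definition algmod : lmodType R := restr A^o.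

Lemma algmul_bilin : bilin (fun x y : algmod => ((x : A) * (y : A) : algmod)).
Proof.
have scE (r : R) (z : algmod) : r *: z = phi r * (z : A) :> A by [].
split=> [n|m] a x y; rewrite !scE; first by rewrite mulrDl mulrA.
by rewrite mulrDr mulrCA.
Qed.

Definition algmul : {linear tensor algmod algmod -> algmod} := tlift algmul_bilin.

Lemma algmulE (x y : algmod) : algmul (x *t y) = (x : A) * (y : A).
Proof. exact: tliftE. Qed.

Definition tensor_mul :
    {linear tensor (tensor algmod algmod) (tensor algmod algmod) ->
            tensor algmod algmod} :=
  tmap algmul algmul \o tmid algmod algmod algmod algmod.

End Restriction.
Arguments restr {R A} phi M.
Arguments restr_act {R A} phi M a.
Arguments restr_map {R A} phi {M N} f.

Definition alg1 (R A : comPzRingType) (phi : {rmorphism R -> A}) : algmod phi :=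
  (1 : A).

(* An affine group scheme is given by its ring of functions, a commutative Hopf
   algebra: [gstr] is the R-algebra structure of R[G] and [comul], [counit] and
   [antipode] are the R-algebra morphisms dual to product, unit and inverse. *)
Record affgrp (R : comPzRingType) := Affgrp {
  gring : comPzRingType;
  gstr : {rmorphism R -> gring};
  comul : {linear algmod gstr -> tensor (algmod gstr) (algmod gstr)};
  counit : {linear algmod gstr -> R^o};
  antipode : {linear algmod gstr -> algmod gstr};
  comul1 : comul (alg1 gstr) = alg1 gstr *t alg1 gstr;
  comulM : forall x y : gring,
    comul (x * y : gring) = tensor_mul gstr (comul x *t comul y);
  counit1 : counit (alg1 gstr) = (1 : R);
  counitM : forall x y : gring,
    counit (x * y : gring) = (counit x : R) * (counit y : R);
  antipode1 : antipode (alg1 gstr) = alg1 gstr;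
  antipodeM : forall x y : gring,
    antipode (x * y : gring) = (antipode x : gring) * (antipode y : gring);
  comulA : forall x,
    tassoc _ _ _ (tmap comul idfun (comul x)) = tmap idfun comul (comul x);
  counitl : forall x, tlid _ (tmap counit idfun (comul x)) = x;
  counitr : forall x, trid _ (tmap idfun counit (comul x)) = x;
  antipodel : forall x,
    algmul gstr (tmap antipode idfun (comul x)) = gstr (counit x);
  antipoder : forall x,
    algmul gstr (tmap idfun antipode (comul x)) = gstr (counit x)
}.

Definition gfun (R : comPzRingType) (G : affgrp R) : lmodType R := algmod (gstr G).

Definition surj (S T : Type) (f : S -> T) : Prop := forall y, exists x, f x = y.

Definition flat (R : comPzRingType) (N : lmodType R) : Prop :=
  forall (M M' : lmodType R) (f : {linear M -> M'}),
    injective f -> injective (tmap f (idfun : {linear N -> N})).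

Section Comodules.
Variables (R : comPzRingType) (G : affgrp R).
Local Notation H := (gfun G).

Definition is_coaction (V : lmodType R) (d : {linear V -> tensor V H}) : Prop :=
  (forall v, trid V (tmap idfun (counit G) (d v)) = v) /\
  (forall v, tassoc V H H (tmap d idfun (d v)) = tmap idfun (comul G) (d v)).

(* Objects of Mod^G R. *)
Record comod := Comod {
  cmod :> lmodType R;
  coact : {linear cmod -> tensor cmod H};
  coactP : is_coaction coact
}.

Record chom (V W : comod) := Chom {
  chom_lin :> {linear V -> W};
  chomP : forall v, coact W (chom_lin v) = tmap chom_lin idfun (coact V v)
}.

Lemma chom_ext (V W : comod) (f g : chom V W) : f =1 g -> f = g.
Proof.
case: f g => f hf [g hg] /= e; have e' := linear_ext e; subst g.
by congr Chom; exact: Prop_irrelevance.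
Qed.

Lemma cid_subproof (V : comod) v :
  coact V (idfun v) = tmap idfun idfun (coact V v).
Proof. by rewrite tmap_id. Qed.
Definition cid (V : comod) : chom V V := Chom (@cid_subproof V).

Lemma ccomp_subproof (U V W : comod) (g : chom V W) (f : chom U V) u :
  coact W ((g \o f) u) = tmap (g \o f) idfun (coact U u).
Proof. by rewrite /= !chomP (tmap_comp (h := g \o f) (k := idfun)). Qed.
Definition ccomp (U V W : comod) (g : chom V W) (f : chom U V) : chom U W :=
  Chom (ccomp_subproof g f).

Section LinComb.
Variables (V W : comod) (r : R) (f g : chom V W).

Lemma clin_linear : linear (fun v => r *: f v + g v).
Proof.
move=> a x y; rewrite (linearP f) (linearP g) !scalerDr !scalerA (mulrC r a).
by rewrite addrACA.
Qed.

Lemma clin_subproof v :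
  coact W (mklin clin_linear v) = tmap (mklin clin_linear) idfun (coact V v).
Proof.
rewrite /= linearP /= !chomP.
elim/tens_ind: (coact V v) => [m n|x y hx hy].
  by rewrite !tmapE /= tensDl tensZl.
by rewrite !linearD -hx -hy addrACA.
Qed.

(* r f + g *)
Definition clin : chom V W := Chom clin_subproof.
End LinComb.

Section TensorComod.
Variables V W : comod.

(* (m (x) h) (x) (n (x) k) |-> (m (x) n) (x) hk; the diagonal coaction of V (x) W is
   [mix] applied to the coactions of V and W. *)
Definition mix (M N : lmodType R) :
    {linear tensor (tensor M H) (tensor N H) -> tensor (tensor M N) H} :=
  tmap idfun (algmul (gstr G)) \o tmid M H N H.

Lemma mixE (M N : lmodType R) (m : M) (h : H) (n : N) (k : H) :
  mix M N ((m *t h) *t (n *t k)) =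
  (m *t n) *t ((h : gring G) * (k : gring G) : H).
Proof. by rewrite /mix /= tmidE tmapE /= algmulE. Qed.

Definition ctens_coact : {linear tensor V W -> tensor (tensor V W) H} :=
  mix V W \o tmap (coact V) (coact W).

Lemma ctens_coactE v w : ctens_coact (v *t w) = mix V W (coact V v *t coact W w).
Proof. by rewrite /ctens_coact /= tmapE. Qed.

Lemma mix_counit (M N : lmodType R) (x : tensor M H) (y : tensor N H) :
  trid _ (tmap idfun (counit G) (mix M N (x *t y))) =
  trid _ (tmap idfun (counit G) x) *t trid _ (tmap idfun (counit G) y).
Proof.
elim/tens_ind: x => [m h|x x' ihx ihx']; last by rewrite !(linearD, tensDl) ihx ihx'.
elim/tens_ind: y => [n k|y y' ihy ihy']; last by rewrite !(linearD, tensDr) ihy ihy'.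
rewrite mixE !tmapE !tridE /= counitM.
by rewrite tensZl tensZr scalerA.
Qed.

Lemma mix_comul (M N : lmodType R) (x : tensor M H) (y : tensor N H) :
  tmap idfun (comul G) (mix M N (x *t y)) =
  tmap idfun (tensor_mul (gstr G))
    (tmid _ _ _ _ (tmap idfun (comul G) x *t tmap idfun (comul G) y)).
Proof.
elim/tens_ind: x => [m h|x x' ihx ihx']; last by rewrite !(linearD, tensDl) ihx ihx'.
elim/tens_ind: y => [n k|y y' ihy ihy']; last by rewrite !(linearD, tensDr) ihy ihy'.
by rewrite mixE !tmapE tmidE tmapE /= comulM.
Qed.

Definition mix2 (M N : lmodType R) :
    {linear tensor (tensor (tensor M H) H) (tensor (tensor N H) H) ->
            tensor (tensor (tensor M N) H) H} :=
  tmap (mix M N) (algmul (gstr G)) \o tmid _ _ _ _.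

Lemma mix2_assoc (M N : lmodType R) (x : tensor (tensor M H) H) (y : tensor (tensor N H) H) :
  tassoc _ _ _ (mix2 M N (x *t y)) =
  tmap idfun (tensor_mul (gstr G)) (tmid _ _ _ _ (tassoc _ _ _ x *t tassoc _ _ _ y)).
Proof.
elim/tens_ind: x => [x h|x x' ihx ihx']; last by rewrite !(linearD, tensDl) ihx ihx'.
elim/tens_ind: y => [y k|y y' ihy ihy']; last by rewrite !(linearD, tensDr) ihy ihy'.
elim/tens_ind: x => [m h'|x x' ihx ihx']; last by rewrite !(linearD, tensDl) ihx ihx'.
elim/tens_ind: y => [n k'|y y' ihy ihy'].
  rewrite /mix2 /= tmidE tmapE mixE !tassocE tmidE !tmapE /=.
  by rewrite tmidE tmapE !algmulE.
by rewrite !(linearD, tensDr, tensDl) ihy ihy'.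
Qed.

Lemma mix_coact (x : tensor V H) (y : tensor W H) :
  tmap ctens_coact idfun (mix V W (x *t y)) =
  mix2 V W (tmap (coact V) idfun x *t tmap (coact W) idfun y).
Proof.
elim/tens_ind: x => [m h|x x' ihx ihx']; last by rewrite !(linearD, tensDl) ihx ihx'.
elim/tens_ind: y => [n k|y y' ihy ihy']; last by rewrite !(linearD, tensDr) ihy ihy'.
by rewrite mixE !tmapE ctens_coactE /mix2 /= tmidE tmapE algmulE.
Qed.

Lemma ctens_coactP : is_coaction ctens_coact.
Proof.
split=> v; elim/tens_ind: v => [v w|x y hx hy]; try by rewrite !linearD hx hy.
  by rewrite ctens_coactE mix_counit (coactP V).1 (coactP W).1.
rewrite ctens_coactE mix_coact mix2_assoc mix_comul.
by rewrite (coactP V).2 (coactP W).2.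
Qed.

Definition ctens : comod := Comod ctens_coactP.
End TensorComod.

Lemma cunit_coact_linear : linear (fun a : R^o => a *t (alg1 (gstr G) : H)).
Proof. by move=> a x y; rewrite tensDl tensZl. Qed.

Lemma cunit_coactP : is_coaction (mklin cunit_coact_linear).
Proof.
split=> v /=.
  by rewrite tmapE /= tridE counit1 scale1r.
by rewrite !tmapE /= tassocE comul1.
Qed.

Definition cunit : comod := Comod cunit_coactP.

End Comodules.

Section ComodTensorMaps.
Variables (R : comPzRingType) (G : affgrp R).
Local Notation H := (gfun G).
Local Notation comod := (comod G).

Lemma mix_tmap (M N M' N' : lmodType R) (f : {linear M -> M'}) (g : {linear N -> N'})
    (x : tensor M H) (y : tensor N H) :
  mix G M' N' (tmap f idfun x *t tmap g idfun y) =
  tmap (tmap f g) idfun (mix G M N (x *t y)).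
Proof.
elim/tens_ind: x => [m h|x x' ihx ihx']; last by rewrite !(linearD, tensDl) ihx ihx'.
elim/tens_ind: y => [n k|y y' ihy ihy']; last by rewrite !(linearD, tensDr) ihy ihy'.
by rewrite !tmapE !mixE !tmapE.
Qed.

Lemma ctmap_subproof (V W V' W' : comod) (f : chom V V') (g : chom W W') x :
  coact (ctens V' W') (tmap f g x) = tmap (tmap f g) idfun (coact (ctens V W) x).
Proof.
elim/tens_ind: x => [v w|x y hx hy]; last by rewrite !linearD hx hy.
rewrite tmapE [LHS]ctens_coactE [in RHS]ctens_coactE !chomP.
exact: mix_tmap.
Qed.

Definition ctmap V W V' W' (f : chom V V') (g : chom W W') :
    chom (ctens V W) (ctens V' W') :=
  @Chom R G (ctens V W) (ctens V' W') (tmap f g) (ctmap_subproof f g).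

Lemma cswap_subproof (V W : comod) x :
  coact (ctens W V) (tswap V W x) = tmap (tswap V W) idfun (coact (ctens V W) x).
Proof.
elim/tens_ind: x => [v w|x y hx hy]; last by rewrite !linearD hx hy.
rewrite tswapE [LHS]ctens_coactE [in RHS]ctens_coactE.
elim/tens_ind: (coact V v) => [m h|x x' ihx ihx'].
  elim/tens_ind: (coact W w) => [n k|y y' ihy ihy'].
    by rewrite !mixE tmapE tswapE mulrC.
  by rewrite !(linearD, tensDl, tensDr) ihy ihy'.
by rewrite !(linearD, tensDl, tensDr) ihx ihx'.
Qed.

Definition cswap V W : chom (ctens V W) (ctens W V) :=
  @Chom R G (ctens V W) (ctens W V) (tswap V W) (@cswap_subproof V W).

Lemma mix_assoc (M N P : lmodType R) (x : tensor M H) (y : tensor N H) (z : tensor P H) :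
  tmap (tassoc M N P) idfun (mix G _ P (mix G M N (x *t y) *t z)) =
  mix G M _ (x *t mix G N P (y *t z)).
Proof.
elim/tens_ind: x => [m h|x x' ihx ihx'];
  last by rewrite !(linearD, tensDl) ihx ihx'.
elim/tens_ind: y => [n k|y y' ihy ihy'];
  last by rewrite !(linearD, tensDl, tensDr) ihy ihy'.
elim/tens_ind: z => [p l|z z' ihz ihz'];
  last by rewrite !(linearD, tensDr) ihz ihz'.
by rewrite !mixE tmapE tassocE mulrA.
Qed.

Lemma tassocK (M N P : lmodType R) : cancel (tassoc M N P) (tassocI M N P).
Proof.
move=> x; elim/tens_ind: x => [x p|x y hx hy]; last by rewrite !linearD hx hy.
elim/tens_ind: x => [m n|x y hx hy]; last by rewrite !(linearD, tensDl) hx hy.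
by rewrite tassocE tassocIE.
Qed.

Lemma tassocIK (M N P : lmodType R) : cancel (tassocI M N P) (tassoc M N P).
Proof.
move=> x; elim/tens_ind: x => [m x|x y hx hy]; last by rewrite !linearD hx hy.
elim/tens_ind: x => [n p|x y hx hy]; last by rewrite !(linearD, tensDr) hx hy.
by rewrite tassocIE tassocE.
Qed.

Lemma cassoc_subproof (U V W : comod) x :
  coact (ctens U (ctens V W)) (tassoc U V W x) =
  tmap (tassoc U V W) idfun (coact (ctens (ctens U V) W) x).
Proof.
elim/tens_ind: x => [x w|x y hx hy]; last by rewrite !linearD hx hy.
elim/tens_ind: x => [u v|x y hx hy]; last by rewrite !(linearD, tensDl) hx hy.
by rewrite tassocE !ctens_coactE mix_assoc.
Qed.

Definition cassoc U V W : chom (ctens (ctens U V) W) (ctens U (ctens V W)) :=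
  @Chom R G (ctens (ctens U V) W) (ctens U (ctens V W)) (tassoc U V W)
    (@cassoc_subproof U V W).

Lemma cassocI_subproof (U V W : comod) x :
  coact (ctens (ctens U V) W) (tassocI U V W x) =
  tmap (tassocI U V W) idfun (coact (ctens U (ctens V W)) x).
Proof.
rewrite -{2}(tassocIK x) cassoc_subproof.
rewrite (tmap_comp (h := idfun) (k := idfun)) ?tmap_id // => y /=.
exact: tassocK.
Qed.

Definition cassocI U V W : chom (ctens U (ctens V W)) (ctens (ctens U V) W) :=
  @Chom R G (ctens U (ctens V W)) (ctens (ctens U V) W) (tassocI U V W)
    (@cassocI_subproof U V W).

Lemma cunit_coactE a : coact (cunit G) a = a *t alg1 (gstr G).
Proof. by []. Qed.

Lemma crid_subproof (V : comod) x :
  coact V (trid V x) = tmap (trid V) idfun (coact (ctens V (cunit G)) x).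
Proof.
elim/tens_ind: x => [v a|x y hx hy]; last by rewrite !linearD hx hy.
rewrite tridE linearZ_LR [in RHS]ctens_coactE cunit_coactE.
elim/tens_ind: (coact V v) => [m h|x y hx hy].
  by rewrite mixE tmapE tridE mulr1 tensZl.
by rewrite !(linearD, tensDl) /= hx hy.
Qed.

Definition crid V : chom (ctens V (cunit G)) V :=
  @Chom R G (ctens V (cunit G)) V (trid V) (@crid_subproof V).

Lemma clid_subproof (V : comod) x :
  coact V (tlid V x) = tmap (tlid V) idfun (coact (ctens (cunit G) V) x).
Proof.
elim/tens_ind: x => [a v|x y hx hy]; last by rewrite !linearD hx hy.
rewrite tlidE linearZ_LR [in RHS]ctens_coactE cunit_coactE.
elim/tens_ind: (coact V v) => [m h|x y hx hy].
  by rewrite mixE tmapE tlidE mul1r tensZl.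
by rewrite !(linearD, tensDr) /= hx hy.
Qed.

Definition clid V : chom (ctens (cunit G) V) V :=
  @Chom R G (ctens (cunit G) V) V (tlid V) (@clid_subproof V).

Lemma tmid_as_assoc (M N P Q : lmodType R) x :
  tmid M N P Q x =
  tassocI M P (tensor N Q)
   (tmap idfun (tassoc P N Q)
     (tmap idfun (tmap (tswap N P) idfun)
       (tmap idfun (tassocI N P Q) (tassoc M N (tensor P Q) x)))).
Proof.
elim/tens_ind: x => [x y|x y hx hy]; last by rewrite !linearD hx hy.
elim/tens_ind: x => [m n|x x' hx hy]; last by rewrite !(linearD, tensDl) hx hy.
elim/tens_ind: y => [p q|x x' hx hy]; last by rewrite !(linearD, tensDr) hx hy.
by rewrite tmidE tassocE !tmapE /= tassocIE tmapE tswapE /= tassocE tassocIE.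
Qed.

Lemma cmid_subproof (M N P Q : comod) x :
  coact (ctens (ctens M P) (ctens N Q)) (tmid M N P Q x) =
  tmap (tmid M N P Q) idfun (coact (ctens (ctens M N) (ctens P Q)) x).
Proof.
pose f : chom (ctens (ctens M N) (ctens P Q)) (ctens (ctens M P) (ctens N Q)) :=
  ccomp (cassocI M P (ctens N Q))
   (ccomp (ctmap (cid M) (cassoc P N Q))
     (ccomp (ctmap (cid M) (ctmap (cswap N P) (cid Q)))
       (ccomp (ctmap (cid M) (cassocI N P Q)) (cassoc M N (ctens P Q))))).
have e : tmid M N P Q =1 f by exact: tmid_as_assoc.
by rewrite (eq_tmap (f' := f) (g' := idfun)) // -chomP -e.
Qed.

Definition cmid M N P Q :
    chom (ctens (ctens M N) (ctens P Q)) (ctens (ctens M P) (ctens N Q)) :=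
  @Chom R G (ctens (ctens M N) (ctens P Q)) (ctens (ctens M P) (ctens N Q))
    (tmid M N P Q) (@cmid_subproof M N P Q).

End ComodTensorMaps.

Section Invariants.
Variables (R : comPzRingType) (G : affgrp R).
Local Notation comod := (comod G).

Section InvType.
Variable V : comod.

Definition invariant (v : V) : Prop := coact V v = v *t alg1 (gstr G).

Definition inv_pred : {pred V} := fun v => `[< invariant v >].

Lemma inv_submod_closed : submod_closed inv_pred.
Proof.
split=> [|a x y /asboolP hx /asboolP hy]; apply/asboolP; rewrite /invariant.
  by rewrite linear0 -(linear0 (tensl V (alg1 (gstr G)))).
by rewrite linearP hx hy tensDl tensZl.
Qed.

HB.instance Definition _ := GRing.isSubmodClosed.Build R V inv_pred inv_submod_closed.

Record inv : Type := Inv { inv_val : V; inv_valP : inv_val \in inv_pred }.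

HB.instance Definition _ := [isSub for inv_val].
HB.instance Definition _ := [Choice of inv by <:].
HB.instance Definition _ := [SubChoice_isSubLmodule of inv by <:].

Lemma invE (x : inv) : invariant (val x).
Proof. exact/asboolP/inv_valP. Qed.

Definition mkinv (v : V) (hv : invariant v) : inv := Inv (asboolT hv).

End InvType.

Section InvMap.
Variables (V W : comod) (f : chom V W).

Lemma inv_map_subproof (x : inv V) : invariant (f (val x)).
Proof. by rewrite /invariant chomP invE tmapE. Qed.

Definition inv_fun (x : inv V) : inv W := mkinv (inv_map_subproof x).

Lemma inv_map_linear : linear inv_fun.
Proof. by move=> a x y; apply: val_inj; rewrite /= linearP. Qed.

Definition inv_map : {linear inv V -> inv W} := mklin inv_map_linear.

End InvMap.

Lemma invariant_tens (V W : comod) (v : V) (w : W) :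
  invariant v -> invariant w -> invariant (v *t w : ctens V W).
Proof.
move=> hv hw; rewrite /invariant ctens_coactE hv hw mixE.
by rewrite mulr1.
Qed.

End Invariants.

Section FgProj.
Variable R : comPzRingType.

Definition fin_gen (V : lmodType R) : Prop :=
  exists n (p : {linear 'rV[R]_n -> V}), surj p.

Definition projective (V : lmodType R) : Prop :=
  forall (M N : lmodType R) (g : {linear M -> N}) (f : {linear V -> N}),
    surj g -> exists h : {linear V -> M}, forall v, g (h v) = f v.

Definition fgproj (V : lmodType R) : Prop := fin_gen V /\ projective V.

Lemma fgprojP (V : lmodType R) :
  fgproj V <->
  exists (I : finType) (v : I -> V) (c : I -> {linear V -> R^o}),
    forall x, x = \sum_i (c i x : R) *: v i.
Proof.
split=> [[[n [p hp]] hV]|[I [v [c e]]]].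
  have [h hh] := hV _ _ p idfun hp.
  have lc i : linear (fun x : V => h x 0 i : R^o).
    by move=> a x y; rewrite linearP !mxE.
  exists 'I_n, (fun i => p (delta_mx 0 i)), (fun i => mklin (lc i)) => x /=.
  rewrite -[LHS](hh x) {1}(row_sum_delta (h x)) linear_sum.
  by apply: eq_bigr => i _; rewrite linearZ.
split.
  have lp : linear (fun x : 'rV[R]_#|I| => \sum_i x 0 (enum_rank i) *: v i).
    move=> a x y; rewrite scaler_sumr -big_split; apply: eq_bigr => i _ /=.
    by rewrite !mxE scalerDl scalerA.
  exists #|I|, (mklin lp) => x.
  exists (\row_i (c (enum_val i) x : R)); rewrite /= [RHS]e.
  by apply: eq_bigr => i _; rewrite mxE enum_rankK.
move=> M N g f hg.
have [s hs] : exists s : I -> M, forall i, g (s i) = f (v i).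
  by have [s hs] := choice (fun i => hg (f (v i))); exists s.
have lh : linear (fun x : V => \sum_i (c i x : R) *: s i).
  move=> a x y; rewrite scaler_sumr -big_split; apply: eq_bigr => i _ /=.
  by rewrite linearP scalerDl scalerA.
exists (mklin lh) => x /=; rewrite linear_sum [in RHS](e x) linear_sum.
by apply: eq_bigr => i _; rewrite !linearZ hs.
Qed.

Lemma fgproj_unit : fgproj R^o.
Proof.
apply/fgprojP; exists unit, (fun _ => (1 : R^o)), (fun _ => idfun) => x /=.
by rewrite big_const card_unit /= addr0 /GRing.scale /= mulr1.
Qed.

Lemma fgproj_tensor (V W : lmodType R) :
  fgproj V -> fgproj W -> fgproj (tensor V W).
Proof.
move=> /fgprojP[I [v [c ev]]] /fgprojP[J [w [d ew]]]; apply/fgprojP.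
exists (I * J)%type, (fun p => v p.1 *t w p.2),
  (fun p => (trid R^o \o tmap (c p.1) (d p.2))) => x.
elim/tens_ind: x => [x y|x y hx hy]; last first.
  rewrite {1}hx {1}hy -big_split; apply: eq_bigr => p _ /=.
  by rewrite !linearD scalerDl.
transitivity (\sum_i \sum_j ((c i x : R) * (d j y : R)) *: (v i *t w j)).
  rewrite {1}(ev x) -[LHS]/(tensl _ _ _) linear_sum; apply: eq_bigr => i _ /=.
  rewrite tensZl {1}(ew y) -[_ *t _]/(tensr _ _ _) linear_sum scaler_sumr.
  by apply: eq_bigr => j _ /=; rewrite tensZr scalerA.
rewrite pair_bigA; apply: eq_bigr => p _ /=.
by rewrite tmapE tridE mulrC.
Qed.
End FgProj.

Section Vect.
Variables (R : comPzRingType) (G : affgrp R).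

Record vect := Vect { vcomod :> comod G; vectP : fgproj vcomod }.

Definition vtens (V W : vect) : vect :=
  @Vect (ctens V W) (fgproj_tensor (vectP V) (vectP W)).

Definition vunit : vect := @Vect (cunit G) (fgproj_unit R).

End Vect.

Section DirectSum.
Variables (R : comPzRingType) (I : choiceType).

Definition dgen (V : I -> lmodType R) (i : I) (v : V i) : {i & V i} :=
  existT (fun i : I => V i : Type) i v.

Definition dsum_adm (V : I -> lmodType R) (P : lmodType R) (f : {i & V i} -> P) : Prop :=
  forall i : I, linear (fun v : V i => f (dgen v)).

Definition dsum (V : I -> lmodType R) : lmodType R := pres (@dsum_adm V).

Section Injections.
Variable V : I -> lmodType R.

Lemma dinj_linear (i : I) : linear (fun v : V i => pgen (@dsum_adm V) (dgen v) : dsum V).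
Proof.
move=> a x y; apply: pres_ext => P f hf.
by rewrite pevalD // pevalZ // !peval_gen // (hf i).
Qed.

Definition dinj i : {linear V i -> dsum V} := mklin (@dinj_linear i).

Lemma dsum_ind (Q : dsum V -> Prop) :
  Q 0 -> (forall i v, Q (dinj i v)) -> (forall x y, Q x -> Q y -> Q (x + y)) ->
  forall x, Q x.
Proof.
move=> Q0 Qg QD; apply: pres_ind => // a [i v].
rewrite -[pgen _ _]/(dinj i v) -linearZ; exact: Qg.
Qed.

Section Lift.
Variables (P : lmodType R) (f : forall i, {linear V i -> P}).

Lemma dlift_adm : dsum_adm (fun p : {i & V i} => f (tag p) (tagged p)).
Proof. by move=> i a x y; rewrite /= linearP. Qed.

Definition dlift : {linear dsum V -> P} := plift dlift_adm.

Lemma dliftE i v : dlift (dinj i v) = f i v.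
Proof. exact: (pliftE dlift_adm (dgen v)). Qed.
End Lift.
End Injections.
End DirectSum.

Section CDirectSum.
Variables (R : comPzRingType) (G : affgrp R) (I : choiceType) (V : I -> comod G).
Local Notation H := (gfun G).

Definition cdsum_coact : {linear dsum V -> tensor (dsum V) H} :=
  dlift (fun i => tmap (dinj V i) idfun \o coact (V i)).

Lemma cdsum_coactE i v :
  cdsum_coact (dinj V i v) = tmap (dinj V i) idfun (coact (V i) v).
Proof. exact: dliftE. Qed.

Lemma cdsum_coactP : is_coaction cdsum_coact.
Proof.
split=> x; elim/dsum_ind: x => [|i v|x y hx hy]; rewrite ?linear0 //;
  try by rewrite !linearD hx hy.
- rewrite cdsum_coactE -[in RHS]((coactP (V i)).1 v).
  elim/tens_ind: (coact (V i) v) => [m h|x y hx hy]; last by rewrite !linearD hx hy.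
  by rewrite !tmapE !tridE linearZ.
- rewrite cdsum_coactE.
  rewrite (tmap_comp (h := tmap (dinj V i) idfun \o coact (V i)) (k := idfun)) //=;
    last by move=> m; rewrite cdsum_coactE.
  transitivity (tmap (dinj V i) idfun (tmap idfun (comul G) (coact (V i) v))).
    rewrite -(coactP (V i)).2.
    elim/tens_ind: (coact (V i) v) => [m h|x y hx hy]; last by rewrite !linearD hx hy.
    rewrite !tmapE /=.
    elim/tens_ind: (coact (V i) m) => [m' h'|x y hx hy].
      by rewrite tmapE !tassocE tmapE.
    by rewrite !(linearD, tensDl) hx hy.
  rewrite (@tmap_comp _ _ _ _ _ _ _ idfun (comul G) (dinj V i) idfun (dinj V i) (comul G)) //.
  by rewrite (@tmap_comp _ _ _ _ _ _ _ (dinj V i) idfun idfun (comul G) (dinj V i) (comul G)).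
Qed.

Definition cdsum : comod G := Comod cdsum_coactP.
End CDirectSum.

(* 0 -> M' -> M -> M'' -> 0 is exact. Exactness of sequences of comodules is exactness
   of the underlying sequences of R-modules (R[G] being flat). *)
Definition short_exact (R : pzRingType) (M' M M'' : lmodType R)
    (i : {linear M' -> M}) (p : {linear M -> M''}) : Prop :=
  [/\ injective i, forall y, p y = 0 <-> exists x, i x = y & surj p].

Definition resolution_property (R : comPzRingType) (G : affgrp R) : Prop :=
  forall M : comod G, exists (I : choiceType) (V : I -> vect G)
    (f : chom (cdsum (fun i => vcomod (V i))) M), surj f.

Definition linearly_reductive (R : comPzRingType) (G : affgrp R) : Prop :=
  forall (M' M M'' : comod G) (i : chom M' M) (p : chom M M''),
    short_exact i p -> short_exact (inv_map i) (inv_map p).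

(* P (x)_R N as an A-module, for an A-module P. *)
Section LeftAction.
Variables (R A : comPzRingType) (phi : {rmorphism R -> A}).
Variables (P : lmodType A) (N : lmodType R).

Definition ltens : Type := tensor (restr phi P) N.
HB.instance Definition _ := GRing.Zmodule.on ltens.

Definition ltens_scale (a : A) (x : ltens) : ltens := tmap (restr_act phi P a) idfun x.

Fact ltens_scaleA a b x : ltens_scale a (ltens_scale b x) = ltens_scale (a * b) x.
Proof.
rewrite /ltens_scale.
elim/tens_ind: (x : tensor (restr phi P) N) => [m n|y z hy hz].
  by rewrite !tmapE /= scalerA.
by rewrite !linearD hy hz.
Qed.
Fact ltens_scale1 : left_id 1 ltens_scale.
Proof. by move=> x; apply: tmap_id => // m /=; rewrite scale1r. Qed.
Fact ltens_scaleDr : right_distributive ltens_scale +%R.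
Proof. by move=> a x y; exact: linearD. Qed.
Fact ltens_scaleDl x : {morph ltens_scale^~ x : a b / a + b}.
Proof.
move=> a b; rewrite /ltens_scale.
elim/tens_ind: (x : tensor (restr phi P) N) => [m n|y z hy hz].
  by rewrite !tmapE /= -tensDl scalerDl.
by rewrite !linearD hy hz addrACA.
Qed.

HB.instance Definition _ := GRing.Zmodule_isLmodule.Build A ltens
  ltens_scaleA ltens_scale1 ltens_scaleDr ltens_scaleDl.

End LeftAction.

Section AComodules.
Variables (R A : comPzRingType) (phi : {rmorphism R -> A}) (G : affgrp R).
Local Notation H := (gfun G).

(* Objects of Mod^G A. In M (x)_R R[G] the ring A acts on the first factor, which is
   what [acoactZ] says. *)
Record acomod := Acomod {
  amod :> lmodType A;
  acoact : {linear restr phi amod -> tensor (restr phi amod) H};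
  acoactP : is_coaction acoact;
  acoactZ : forall (a : A) (m : amod),
    acoact (a *: m) = tmap (restr_act phi amod a) idfun (acoact m)
}.

Definition ares (M : acomod) : comod G := Comod (acoactP M).

Record ahom (M N : acomod) := Ahom {
  ahom_lin :> {linear M -> N};
  ahomP : forall m : M,
    acoact N (ahom_lin m) = tmap (restr_map phi ahom_lin) idfun (acoact M m)
}.

Lemma ahom_ext (M N : acomod) (f g : ahom M N) : f =1 g -> f = g.
Proof.
case: f g => f hf [g hg] /= e; have e' := linear_ext e; subst g.
by congr Ahom; exact: Prop_irrelevance.
Qed.

Definition ahom_res (M N : acomod) (f : ahom M N) : chom (ares M) (ares N) :=
  @Chom R G (ares M) (ares N) (restr_map phi f) (ahomP f).

Lemma aid_subproof (M : acomod) (m : M) :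
  acoact M (idfun m) = tmap (restr_map phi (idfun : {linear M -> M})) idfun (acoact M m).
Proof. by rewrite tmap_id. Qed.
Definition aid (M : acomod) : ahom M M := Ahom (@aid_subproof M).

Lemma acomp_subproof (L M N : acomod) (g : ahom M N) (f : ahom L M) (m : L) :
  acoact N ((g \o f) m) = tmap (restr_map phi (g \o f)) idfun (acoact L m).
Proof.
by rewrite /= !ahomP (tmap_comp (h := restr_map phi (g \o f)) (k := idfun)).
Qed.
Definition acomp (L M N : acomod) (g : ahom M N) (f : ahom L M) : ahom L N :=
  Ahom (acomp_subproof g f).

Section ActionMap.
Variables (M : acomod) (a : A).
Definition act_hom : chom (ares M) (ares M) :=
  @Chom R G (ares M) (ares M) (restr_act phi M a) (acoactZ a).
End ActionMap.

Section TensorAComod.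
Variables M N : acomod.

Lemma tproj_bilin :
  bilin (fun (m : restr phi M) (n : restr phi N) =>
    ((m : M) *t (n : N) : restr phi (tensor M N))).
Proof.
split=> [n|m] a x y; first by rewrite !restrZ tensDl tensZl.
by rewrite !restrZ tensDr tensZr.
Qed.

Definition tproj :
    {linear tensor (restr phi M) (restr phi N) -> restr phi (tensor M N)} :=
  tlift tproj_bilin.

Lemma tprojE (m : M) (n : N) : tproj ((m : restr phi M) *t (n : restr phi N)) = m *t n.
Proof. exact: tliftE. Qed.

(* The diagonal coaction of M (x)_R N descends to M (x)_A N. *)
Definition atens_fun (m : M) (n : N) : ltens phi (tensor M N) H :=
  tmap tproj idfun
    (coact (ctens (ares M) (ares N)) ((m : restr phi M) *t (n : restr phi N))).

Lemma mix_actl a (x : tensor (restr phi M) H) (y : tensor (restr phi N) H) :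
  tmap tproj idfun (mix G _ _ (tmap (restr_act phi M a) idfun x *t y)) =
  tmap (restr_act phi (tensor M N) a) idfun (tmap tproj idfun (mix G _ _ (x *t y))).
Proof.
elim/tens_ind: x => [m h|x x' ihx ihx']; last by rewrite !(linearD, tensDl) ihx ihx'.
elim/tens_ind: y => [n k|y y' ihy ihy']; last by rewrite !(linearD, tensDr) ihy ihy'.
by rewrite !tmapE !mixE !tmapE /= !tprojE tensZl.
Qed.

Lemma mix_actr a (x : tensor (restr phi M) H) (y : tensor (restr phi N) H) :
  tmap tproj idfun (mix G _ _ (x *t tmap (restr_act phi N a) idfun y)) =
  tmap (restr_act phi (tensor M N) a) idfun (tmap tproj idfun (mix G _ _ (x *t y))).
Proof.
elim/tens_ind: x => [m h|x x' ihx ihx']; last by rewrite !(linearD, tensDl) ihx ihx'.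
elim/tens_ind: y => [n k|y y' ihy ihy']; last by rewrite !(linearD, tensDr) ihy ihy'.
by rewrite !tmapE !mixE !tmapE /= !tprojE tensZr.
Qed.

Lemma atens_bilin : bilin atens_fun.
Proof.
split=> [n|m] a x y; rewrite /atens_fun !ctens_coactE.
  rewrite [coact _ (_ + _)](linearD (acoact M)) acoactZ tensDl !linearD.
  by congr (_ + _); exact: mix_actl.
rewrite [coact _ (_ + _)](linearD (acoact N)) acoactZ tensDr !linearD.
by congr (_ + _); exact: mix_actr.
Qed.

Definition atens_lift : {linear tensor M N -> ltens phi (tensor M N) H} :=
  tlift atens_bilin.

Lemma atens_linear :
  linear (atens_lift : restr phi (tensor M N) -> tensor (restr phi (tensor M N)) H).
Proof.
move=> r x y; rewrite restrZ [LHS](linearP atens_lift).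
congr (_ + _); rewrite -[LHS]/(tmap _ _ _).
elim/tens_ind: (atens_lift x : tensor (restr phi (tensor M N)) H) => [p h|u v hu hv].
  by rewrite tmapE /= -tensZl restrZ.
by rewrite !linearD hu hv.
Qed.

Definition atens_coact :
    {linear restr phi (tensor M N) -> tensor (restr phi (tensor M N)) H} :=
  mklin atens_linear.

Lemma atens_coact_proj x :
  atens_coact (tproj x) = tmap tproj idfun (coact (ctens (ares M) (ares N)) x).
Proof.
elim/tens_ind: x => [m n|x y hx hy]; last by rewrite !linearD hx hy.
by rewrite tprojE [LHS](tliftE atens_bilin).
Qed.

Lemma tproj_surj : surj tproj.
Proof.
move=> y; elim/(@tens_ind A): (y : tensor M N) => [m n|x z [x' <-] [z' <-]].
  by exists ((m : restr phi M) *t (n : restr phi N)); rewrite tprojE.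
by exists (x' + z'); rewrite linearD.
Qed.

Lemma atens_coactP : is_coaction atens_coact.
Proof.
have [h1 h2] := coactP (ctens (ares M) (ares N)).
split=> y; have [x <-] := tproj_surj y; rewrite atens_coact_proj.
- rewrite -{2}(h1 x).
  elim/tens_ind: (coact (ctens (ares M) (ares N)) x) => [m h|u v hu hv]; last by rewrite !linearD hu hv.
  by rewrite !tmapE !tridE linearZ.
- rewrite (tmap_comp (h := tmap tproj idfun \o coact (ctens (ares M) (ares N)))
    (k := idfun)) //; last exact: atens_coact_proj.
  transitivity (tmap tproj idfun
    (tmap idfun (comul G) (coact (ctens (ares M) (ares N)) x))).
    rewrite -h2.
    elim/tens_ind: (coact (ctens (ares M) (ares N)) x) => [m h|u v hu hv]; last by rewrite !linearD hu hv.
    rewrite !tmapE -[X in X *t _]/(tmap tproj idfun (coact (ctens (ares M) (ares N)) m)).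
    elim/tens_ind: (coact (ctens (ares M) (ares N)) m) => [m' h'|u v hu hv].
      by rewrite tmapE !tassocE tmapE.
    by rewrite !(linearD, tensDl) hu hv.
  rewrite (@tmap_comp _ _ _ _ _ _ _ idfun (comul G) tproj idfun tproj (comul G)) //.
  by rewrite (@tmap_comp _ _ _ _ _ _ _ tproj idfun idfun (comul G) tproj (comul G)).
Qed.

Lemma atens_coactZ (a : A) (x : tensor M N) :
  atens_coact (a *: x) = tmap (restr_act phi (tensor M N) a) idfun (atens_coact x).
Proof. exact: (linearZ_LR atens_lift). Qed.

Definition atens : acomod := Acomod atens_coactP atens_coactZ.

Definition tproj_hom : chom (ctens (ares M) (ares N)) (ares atens) :=
  @Chom R G (ctens (ares M) (ares N)) (ares atens) tproj atens_coact_proj.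

End TensorAComod.

End AComodules.

Section Gamma.
Variables (R A : comPzRingType) (phi : {rmorphism R -> A}) (G : affgrp R).
Local Notation acomod := (acomod phi G).

(* (V (x)_R M)^G, with A acting through M. *)
Definition ginv (V : comod G) (M : acomod) : Type := inv (ctens V (ares M)).

Section GinvModule.
Variables (V : comod G) (M : acomod).
HB.instance Definition _ := GRing.Zmodule.on (ginv V M).

Definition ginv_scale (a : A) (x : ginv V M) : ginv V M :=
  inv_map (ctmap (cid V) (act_hom M a)) x.

Lemma ginv_scale_val a x :
  val (ginv_scale a x) = tmap idfun (restr_act phi M a) (val x).
Proof. by []. Qed.

Fact ginv_scaleA a b x : ginv_scale a (ginv_scale b x) = ginv_scale (a * b) x.
Proof.
apply: val_inj; rewrite !ginv_scale_val (tmap_comp (h := idfun)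
  (k := restr_act phi M (a * b))) // => m /=; by rewrite scalerA.
Qed.
Fact ginv_scale1 : left_id 1 ginv_scale.
Proof.
move=> x; apply: val_inj; rewrite ginv_scale_val tmap_id // => m /=.
by rewrite scale1r.
Qed.
Fact ginv_scaleDr : right_distributive ginv_scale +%R.
Proof. by move=> a x y; apply: linearD. Qed.
Fact ginv_scaleDl x : {morph ginv_scale^~ x : a b / a + b}.
Proof.
move=> a b; apply: val_inj; rewrite [RHS]/(_ + _) /= .
elim/tens_ind: (val x) => [v m|y z hy hz]; first by rewrite !tmapE /= scalerDl tensDr.
by rewrite !linearD hy hz addrACA.
Qed.

HB.instance Definition _ := GRing.Zmodule_isLmodule.Build A (ginv V M)
  ginv_scaleA ginv_scale1 ginv_scaleDr ginv_scaleDl.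

Definition gval (x : ginv V M) : tensor V (restr phi M) := val (x : inv _).

Lemma gval_inj : injective gval. Proof. exact: val_inj. Qed.

Lemma gvalD x y : gval (x + y) = gval x + gval y. Proof. by []. Qed.

Lemma gvalZ a x : gval (a *: x) = tmap idfun (restr_act phi M a) (gval x).
Proof. by []. Qed.

Lemma gvalP x : invariant (gval x : ctens V (ares M)). Proof. exact: invE. Qed.

Definition mkginv (x : ctens V (ares M)) (hx : invariant x) : ginv V M := mkinv hx.

Lemma gval_mk (x : ctens V (ares M)) (hx : invariant x) : gval (mkginv hx) = x.
Proof. by []. Qed.

End GinvModule.

Section GinvMap.
Variables (V W : comod G) (M N : acomod) (f : chom V W) (u : ahom M N).

Definition ginv_fun (x : ginv V M) : ginv W N := inv_map (ctmap f (ahom_res u)) x.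

Lemma ginv_fun_val x : gval (ginv_fun x) = tmap f (restr_map phi u) (gval x).
Proof. by []. Qed.

Lemma ginv_map_linear : linear ginv_fun.
Proof.
move=> a x y; apply: gval_inj.
rewrite ginv_fun_val !gvalD linearD !gvalZ !ginv_fun_val; congr (_ + _).
elim/tens_ind: (gval x) => [v m|z t hz ht]; last by rewrite !linearD hz ht.
by rewrite !tmapE /= linearZ.
Qed.

Definition ginv_map : {linear ginv V M -> ginv W N} := mklin ginv_map_linear.

Lemma ginv_mapE x : gval (ginv_map x) = tmap f (restr_map phi u) (gval x).
Proof. by []. Qed.
End GinvMap.

End Gamma.

Arguments gval {R A phi G V M} x.

Record category := Category {
  ob :> Type;
  arr : ob -> ob -> Type;
  idm : forall X, arr X X;
  compm : forall X Y Z, arr Y Z -> arr X Y -> arr X Z;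
  comp1m : forall X Y (f : arr X Y), compm (idm Y) f = f;
  compm1 : forall X Y (f : arr X Y), compm f (idm X) = f;
  compmA : forall X Y Z T (h : arr Z T) (g : arr Y Z) (f : arr X Y),
    compm h (compm g f) = compm (compm h g) f
}.
Arguments arr {c} _ _.
Arguments idm {c} X.
Arguments compm {c X Y Z} _ _.

Record functor (C D : category) := Functor {
  fob :> C -> D;
  fmap : forall X Y, arr X Y -> arr (fob X) (fob Y);
  fmap_id : forall X, fmap (idm X) = idm (fob X);
  fmap_comp : forall X Y Z (g : arr Y Z) (f : arr X Y),
    fmap (compm g f) = compm (fmap g) (fmap f)
}.
Arguments fmap {C D} _ {X Y} _.

Record nattrans (C D : category) (F K : functor C D) := Nattrans {
  ntc :> forall X, arr (F X) (K X);
  ntcP : forall X Y (f : arr X Y), compm (ntc Y) (fmap F f) = compm (fmap K f) (ntc X)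
}.

Section CategoryTheory.
Variables C D : category.

Lemma nattrans_ext (F K : functor C D) (s t : nattrans F K) :
  (forall X, s X = t X) -> s = t.
Proof.
case: s t => s hs [t ht] /= e.
have e' : s = t by apply: functional_extensionality_dep.
by subst t; congr Nattrans; exact: Prop_irrelevance.
Qed.

Lemma ntid_subproof (F : functor C D) X Y (f : arr X Y) :
  compm (idm (F Y)) (fmap F f) = compm (fmap F f) (idm (F X)).
Proof. by rewrite comp1m compm1. Qed.
Definition ntid (F : functor C D) : nattrans F F := Nattrans (@ntid_subproof F).

Lemma ntcomp_subproof (F K L : functor C D) (t : nattrans K L) (s : nattrans F K)
    X Y (f : arr X Y) :
  compm (compm (t Y) (s Y)) (fmap F f) = compm (fmap L f) (compm (t X) (s X)).
Proof. by rewrite -compmA ntcP compmA ntcP compmA. Qed.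
Definition ntcomp (F K L : functor C D) (t : nattrans K L) (s : nattrans F K) :
  nattrans F L := Nattrans (ntcomp_subproof t s).

Definition is_iso (X Y : C) (f : arr X Y) : Prop :=
  exists g : arr Y X, compm g f = idm X /\ compm f g = idm Y.

Definition isomorphic (X Y : C) : Prop := exists f : arr X Y, is_iso f.

End CategoryTheory.

Section CategoryTheory2.
Variables C D : category.

Definition naturally_isomorphic (F K : functor C D) : Prop :=
  exists t : nattrans F K, forall X, is_iso (t X).

Definition fully_faithful (F : functor C D) : Prop :=
  forall X Y, bijective (fun f : arr X Y => fmap F f).

Definition ess_image (F : functor C D) (Y : D) : Prop :=
  exists X, isomorphic (F X) Y.
End CategoryTheory2.

Definition idfunctor (C : category) : functor C C :=
  @Functor C C (fun X => X) (fun X Y f => f) (fun X => erefl) (fun X Y Z g f => erefl).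

Section CompFunctor.
Variables (C D E : category) (K : functor D E) (F : functor C D).
Lemma compfunctor_id X : fmap K (fmap F (idm X)) = idm (K (F X)).
Proof. by rewrite !fmap_id. Qed.
Lemma compfunctor_comp X Y Z (g : arr Y Z) (f : arr X Y) :
  fmap K (fmap F (compm g f)) = compm (fmap K (fmap F g)) (fmap K (fmap F f)).
Proof. by rewrite !fmap_comp. Qed.
Definition compfunctor : functor C E :=
  @Functor C E (fun X => K (F X)) (fun X Y f => fmap K (fmap F f))
    compfunctor_id compfunctor_comp.
End CompFunctor.

Definition is_equivalence (C D : category) (F : functor C D) : Prop :=
  exists K : functor D C,
    naturally_isomorphic (compfunctor K F) (idfunctor C) /\
    naturally_isomorphic (compfunctor F K) (idfunctor D).

Section ModCategory.
Variable A : comPzRingType.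

Lemma mod_comp1m (M N : lmodType A) (f : {linear M -> N}) : idfun \o f = f :> {linear _ -> _}.
Proof. exact: linear_ext. Qed.
Lemma mod_compm1 (M N : lmodType A) (f : {linear M -> N}) : f \o idfun = f :> {linear _ -> _}.
Proof. exact: linear_ext. Qed.
Lemma mod_compA (M N P Q : lmodType A) (h : {linear P -> Q}) (g : {linear N -> P})
    (f : {linear M -> N}) : h \o (g \o f) = (h \o g) \o f :> {linear _ -> _}.
Proof. exact: linear_ext. Qed.

Definition Mod : category :=
  @Category (lmodType A) (fun M N => {linear M -> N}) (fun M => idfun)
    (fun M N P g f => g \o f) mod_comp1m mod_compm1 mod_compA.

End ModCategory.

Section VectCategory.
Variables (R : comPzRingType) (G : affgrp R).

Lemma vect_comp1m (V W : vect G) (f : chom V W) : ccomp (cid W) f = f.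
Proof. exact: chom_ext. Qed.
Lemma vect_compm1 (V W : vect G) (f : chom V W) : ccomp f (cid V) = f.
Proof. exact: chom_ext. Qed.
Lemma vect_compA (U V W X : vect G) (h : chom W X) (g : chom V W) (f : chom U V) :
  ccomp h (ccomp g f) = ccomp (ccomp h g) f.
Proof. exact: chom_ext. Qed.

Definition VectCat : category :=
  @Category (vect G) (fun V W => chom V W) (fun V => cid V)
    (fun U V W g f => ccomp g f) vect_comp1m vect_compm1 vect_compA.

End VectCategory.

Section ModGCategory.
Variables (R A : comPzRingType) (phi : {rmorphism R -> A}) (G : affgrp R).

Lemma modG_comp1m (M N : acomod phi G) (f : ahom M N) : acomp (aid N) f = f.
Proof. exact: ahom_ext. Qed.
Lemma modG_compm1 (M N : acomod phi G) (f : ahom M N) : acomp f (aid M) = f.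
Proof. exact: ahom_ext. Qed.
Lemma modG_compA (L M N P : acomod phi G) (h : ahom N P) (g : ahom M N) (f : ahom L M) :
  acomp h (acomp g f) = acomp (acomp h g) f.
Proof. exact: ahom_ext. Qed.

Definition ModG : category :=
  @Category (acomod phi G) (@ahom _ _ phi G) (@aid _ _ phi G)
    (@acomp _ _ phi G) modG_comp1m modG_compm1 modG_compA.

(* [atens M M] is M (x)_A M with its G-action, so that the multiplication is
   G-equivariant and A-linear. *)
Record qring := Qring {
  qr_mod :> acomod phi G;
  qr_mul : ahom (atens qr_mod qr_mod) qr_mod
}.

Record qring_hom (M N : qring) := QringHom {
  qrh :> ahom M N;
  qrhP : forall x : tensor M M, qrh (qr_mul M x) = qr_mul N (tmap qrh qrh x)
}.

Lemma qring_hom_ext (M N : qring) (f g : qring_hom M N) : f =1 g -> f = g.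
Proof.
case: f g => f hf [g hg] /= e; have e' := ahom_ext e; subst g.
by congr QringHom; exact: Prop_irrelevance.
Qed.

Lemma qring_id_subproof (M : qring) (x : tensor M M) :
  aid M (qr_mul M x) = qr_mul M (tmap (aid M) (aid M) x).
Proof. by rewrite tmap_id. Qed.
Definition qring_id (M : qring) : qring_hom M M := QringHom (@qring_id_subproof M).

Lemma qring_comp_subproof (L M N : qring) (g : qring_hom M N) (f : qring_hom L M)
    (x : tensor L L) :
  acomp g f (qr_mul L x) = qr_mul N (tmap (acomp g f) (acomp g f) x).
Proof. by rewrite /= !qrhP (tmap_comp (h := acomp g f) (k := acomp g f)). Qed.
Definition qring_comp (L M N : qring) (g : qring_hom M N) (f : qring_hom L M) :
  qring_hom L N := QringHom (qring_comp_subproof g f).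

Lemma qring_comp1m (M N : qring) (f : qring_hom M N) : qring_comp (qring_id N) f = f.
Proof. exact: qring_hom_ext. Qed.
Lemma qring_compm1 (M N : qring) (f : qring_hom M N) : qring_comp f (qring_id M) = f.
Proof. exact: qring_hom_ext. Qed.
Lemma qring_compA (L M N P : qring) (h : qring_hom N P) (g : qring_hom M N)
    (f : qring_hom L M) :
  qring_comp h (qring_comp g f) = qring_comp (qring_comp h g) f.
Proof. exact: qring_hom_ext. Qed.

Definition QRings : category :=
  @Category qring qring_hom qring_id qring_comp qring_comp1m qring_compm1 qring_compA.

Record qalg := Qalg {
  qg_ring :> qring;
  qg_comm : forall x, qr_mul qg_ring (tswap _ _ x) = qr_mul qg_ring x;
  qg_assoc : forall x : tensor (tensor qg_ring qg_ring) qg_ring,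
    qr_mul qg_ring (tmap (qr_mul qg_ring) idfun x) =
    qr_mul qg_ring (tmap idfun (qr_mul qg_ring) (tassoc _ _ _ x));
  qg_one : qg_ring;
  qg_one_inv : invariant (qg_one : ares qg_ring);
  qg_mul1m : forall m : qg_ring, qr_mul qg_ring (qg_one *t m) = m;
  qg_mulm1 : forall m : qg_ring, qr_mul qg_ring (m *t qg_one) = m
}.

Record qalg_hom (M N : qalg) := QalgHom {
  qgh :> qring_hom M N;
  qghP : qgh (qg_one M) = qg_one N
}.

Lemma qalg_hom_ext (M N : qalg) (f g : qalg_hom M N) : f =1 g -> f = g.
Proof.
case: f g => f hf [g hg] /= e; have e' := qring_hom_ext e; subst g.
by congr QalgHom; exact: Prop_irrelevance.
Qed.

Lemma qalg_id_subproof (M : qalg) : qring_id M (qg_one M) = qg_one M.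
Proof. by []. Qed.
Definition qalg_id (M : qalg) : qalg_hom M M := QalgHom (qalg_id_subproof M).

Lemma qalg_comp_subproof (L M N : qalg) (g : qalg_hom M N) (f : qalg_hom L M) :
  qring_comp g f (qg_one L) = qg_one N.
Proof. by rewrite /= !qghP. Qed.
Definition qalg_comp (L M N : qalg) (g : qalg_hom M N) (f : qalg_hom L M) :
  qalg_hom L N := QalgHom (qalg_comp_subproof g f).

Lemma qalg_comp1m (M N : qalg) (f : qalg_hom M N) : qalg_comp (qalg_id N) f = f.
Proof. exact: qalg_hom_ext. Qed.
Lemma qalg_compm1 (M N : qalg) (f : qalg_hom M N) : qalg_comp f (qalg_id M) = f.
Proof. exact: qalg_hom_ext. Qed.
Lemma qalg_compA (L M N P : qalg) (h : qalg_hom N P) (g : qalg_hom M N)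
    (f : qalg_hom L M) :
  qalg_comp h (qalg_comp g f) = qalg_comp (qalg_comp h g) f.
Proof. exact: qalg_hom_ext. Qed.

Definition QAlg : category :=
  @Category qalg qalg_hom qalg_id qalg_comp qalg_comp1m qalg_compm1 qalg_compA.

End ModGCategory.

Section FunctorCategories.
Variables (R A : comPzRingType) (phi : {rmorphism R -> A}) (G : affgrp R).

Definition fmod (F : functor (VectCat G) (Mod A)) (V : vect G) : lmodType A := F V.

Definition fmor (F : functor (VectCat G) (Mod A)) (V W : vect G) (f : chom V W) :
  {linear fmod F V -> fmod F W} := @fmap _ _ F V W f.

Definition ncomp (F K : functor (VectCat G) (Mod A)) (t : nattrans F K) (V : vect G) :
  {linear fmod F V -> fmod K V} := t V.

Lemma nattrans_eq (F K : functor (VectCat G) (Mod A)) (s t : nattrans F K) :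
  (forall V, ncomp s V =1 ncomp t V) -> s = t.
Proof. by move=> e; apply: nattrans_ext => V; apply: linear_ext; exact: e. Qed.

Record qadd := Qadd {
  qa_fun :> functor (VectCat G) (Mod A);
  qa_lin : forall (V W : vect G) (r : R) (f g : chom V W) (x : fmod qa_fun V),
    fmor qa_fun (clin r f g) x = phi r *: fmor qa_fun f x + fmor qa_fun g x
}.

Lemma qadd_comp1m (F K : qadd) (t : nattrans F K) : ntcomp (ntid K) t = t.
Proof. exact: nattrans_eq. Qed.
Lemma qadd_compm1 (F K : qadd) (t : nattrans F K) : ntcomp t (ntid F) = t.
Proof. exact: nattrans_eq. Qed.
Lemma qadd_compA (F K L N : qadd) (u : nattrans L N) (t : nattrans K L)
    (s : nattrans F K) :
  ntcomp u (ntcomp t s) = ntcomp (ntcomp u t) s.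
Proof. exact: nattrans_eq. Qed.

Definition QAdd : category :=
  @Category qadd (fun F K => nattrans F K) (fun F => ntid F)
    (fun F K L t s => ntcomp t s) qadd_comp1m qadd_compm1 qadd_compA.

Record qpmon := Qpmon {
  qp_add :> qadd;
  qp_mul : forall V W : vect G,
    {linear tensor (fmod qp_add V) (fmod qp_add W) -> fmod qp_add (vtens V W)};
  qp_nat : forall (V V' W W' : vect G) (f : chom V V') (g : chom W W')
      (x : tensor (fmod qp_add V) (fmod qp_add W)),
    fmor qp_add (ctmap f g : chom (vtens V W) (vtens V' W')) (qp_mul V W x) =
    qp_mul V' W' (tmap (fmor qp_add f) (fmor qp_add g) x)
}.

Record qpmon_hom (F K : qpmon) := QpmonHom {
  qph :> nattrans F K;
  qphP : forall (V W : vect G) (x : tensor (fmod F V) (fmod F W)),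
    ncomp qph (vtens V W) (qp_mul F V W x) =
    qp_mul K V W (tmap (ncomp qph V) (ncomp qph W) x)
}.

Lemma qpmon_hom_ext (F K : qpmon) (s t : qpmon_hom F K) :
  (forall V, ncomp s V =1 ncomp t V) -> s = t.
Proof.
case: s t => s hs [t ht] /= e; have e' := nattrans_eq e; subst t.
by congr QpmonHom; exact: Prop_irrelevance.
Qed.

Lemma qpmon_id_subproof (F : qpmon) (V W : vect G) (x : tensor (fmod F V) (fmod F W)) :
  ncomp (ntid F) (vtens V W) (qp_mul F V W x) =
  qp_mul F V W (tmap (ncomp (ntid F) V) (ncomp (ntid F) W) x).
Proof. by rewrite tmap_id. Qed.
Definition qpmon_id (F : qpmon) : qpmon_hom F F := QpmonHom (@qpmon_id_subproof F).

Lemma qpmon_comp_subproof (F K L : qpmon) (t : qpmon_hom K L) (s : qpmon_hom F K)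
    (V W : vect G) (x : tensor (fmod F V) (fmod F W)) :
  ncomp (ntcomp t s) (vtens V W) (qp_mul F V W x) =
  qp_mul L V W (tmap (ncomp (ntcomp t s) V) (ncomp (ntcomp t s) W) x).
Proof.
transitivity (ncomp t (vtens V W) (ncomp s (vtens V W) (qp_mul F V W x))) => //.
rewrite !qphP.
by rewrite (tmap_comp (h := ncomp (ntcomp t s) V) (k := ncomp (ntcomp t s) W)).
Qed.
Definition qpmon_comp (F K L : qpmon) (t : qpmon_hom K L) (s : qpmon_hom F K) :
  qpmon_hom F L := QpmonHom (qpmon_comp_subproof t s).

Lemma qpmon_comp1m (F K : qpmon) (t : qpmon_hom F K) : qpmon_comp (qpmon_id K) t = t.
Proof. exact: qpmon_hom_ext. Qed.
Lemma qpmon_compm1 (F K : qpmon) (t : qpmon_hom F K) : qpmon_comp t (qpmon_id F) = t.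
Proof. exact: qpmon_hom_ext. Qed.
Lemma qpmon_compA (F K L N : qpmon) (u : qpmon_hom L N) (t : qpmon_hom K L)
    (s : qpmon_hom F K) :
  qpmon_comp u (qpmon_comp t s) = qpmon_comp (qpmon_comp u t) s.
Proof. exact: qpmon_hom_ext. Qed.

Definition QPMon : category :=
  @Category qpmon qpmon_hom qpmon_id qpmon_comp qpmon_comp1m qpmon_compm1 qpmon_compA.

Record qmon := Qmon {
  qm_pmon :> qpmon;
  qm_sym : forall (V W : vect G) (x : tensor (fmod qm_pmon V) (fmod qm_pmon W)),
    fmor qm_pmon (cswap V W : chom (vtens V W) (vtens W V)) (qp_mul qm_pmon V W x) =
    qp_mul qm_pmon W V (tswap _ _ x);
  qm_assoc : forall (U V W : vect G)
      (x : tensor (tensor (fmod qm_pmon U) (fmod qm_pmon V)) (fmod qm_pmon W)),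
    fmor qm_pmon (cassoc U V W : chom (vtens (vtens U V) W) (vtens U (vtens V W)))
      (qp_mul qm_pmon (vtens U V) W (tmap (qp_mul qm_pmon U V) idfun x)) =
    qp_mul qm_pmon U (vtens V W) (tmap idfun (qp_mul qm_pmon V W) (tassoc _ _ _ x));
  qm_one : {linear A^o -> fmod qm_pmon (vunit G)};
  qm_mulm1 : forall (V : vect G) (x : tensor (fmod qm_pmon V) A^o),
    fmor qm_pmon (crid V : chom (vtens V (vunit G)) V)
      (qp_mul qm_pmon V (vunit G) (tmap idfun qm_one x)) = trid _ x;
  qm_mul1m : forall (V : vect G) (x : tensor A^o (fmod qm_pmon V)),
    fmor qm_pmon (clid V : chom (vtens (vunit G) V) V)
      (qp_mul qm_pmon (vunit G) V (tmap qm_one idfun x)) = tlid _ x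
}.

Record qmon_hom (F K : qmon) := QmonHom {
  qmh :> qpmon_hom F K;
  qmhP : forall a : A^o, ncomp qmh (vunit G) (qm_one F a) = qm_one K a
}.

Lemma qmon_hom_ext (F K : qmon) (s t : qmon_hom F K) :
  (forall V, ncomp s V =1 ncomp t V) -> s = t.
Proof.
case: s t => s hs [t ht] /= e; have e' := qpmon_hom_ext e; subst t.
by congr QmonHom; exact: Prop_irrelevance.
Qed.

Lemma qmon_id_subproof (F : qmon) (a : A^o) :
  ncomp (qpmon_id F) (vunit G) (qm_one F a) = qm_one F a.
Proof. by []. Qed.
Definition qmon_id (F : qmon) : qmon_hom F F := QmonHom (@qmon_id_subproof F).

Lemma qmon_comp_subproof (F K L : qmon) (t : qmon_hom K L) (s : qmon_hom F K) (a : A^o) :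
  ncomp (qpmon_comp t s) (vunit G) (qm_one F a) = qm_one L a.
Proof.
transitivity (ncomp t (vunit G) (ncomp s (vunit G) (qm_one F a))) => //.
by rewrite !qmhP.
Qed.
Definition qmon_comp (F K L : qmon) (t : qmon_hom K L) (s : qmon_hom F K) :
  qmon_hom F L := QmonHom (qmon_comp_subproof t s).

Lemma qmon_comp1m (F K : qmon) (t : qmon_hom F K) : qmon_comp (qmon_id K) t = t.
Proof. exact: qmon_hom_ext. Qed.
Lemma qmon_compm1 (F K : qmon) (t : qmon_hom F K) : qmon_comp t (qmon_id F) = t.
Proof. exact: qmon_hom_ext. Qed.
Lemma qmon_compA (F K L N : qmon) (u : qmon_hom L N) (t : qmon_hom K L)
    (s : qmon_hom F K) :
  qmon_comp u (qmon_comp t s) = qmon_comp (qmon_comp u t) s.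
Proof. exact: qmon_hom_ext. Qed.

Definition QMon : category :=
  @Category qmon qmon_hom qmon_id qmon_comp qmon_comp1m qmon_compm1 qmon_compA.

Definition left_exact (F : functor (VectCat G) (Mod A)) : Prop :=
  forall (V' V V'' : vect G) (i : chom V' V) (p : chom V V''),
    short_exact i p ->
    injective (fmor F i) /\
    (forall y, fmor F p y = 0 <-> exists x, fmor F i x = y).

End FunctorCategories.

Section Functors.
Variables (R A : comPzRingType) (phi : {rmorphism R -> A}) (G : affgrp R).

Section GammaAdd.
Variable M : acomod phi G.

Definition gamma_ob (V : VectCat G) : Mod A := ginv V M.
Definition gamma_map (V W : VectCat G) (f : arr V W) : arr (gamma_ob V) (gamma_ob W) :=
  ginv_map f (aid M).

Lemma gamma_id V : gamma_map (idm V) = idm (gamma_ob V).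
Proof.
apply: linear_ext => x; apply: gval_inj.
by rewrite ginv_mapE tmap_id.
Qed.

Lemma gamma_comp U V W (g : arr V W) (f : arr U V) :
  gamma_map (compm g f) = compm (gamma_map g) (gamma_map f).
Proof.
apply: linear_ext => x; apply: gval_inj.
rewrite [RHS]ginv_mapE !ginv_mapE.
by rewrite (tmap_comp (h := ccomp g f) (k := restr_map phi (aid M))).
Qed.

Definition gamma_fun : functor (VectCat G) (Mod A) := Functor gamma_id gamma_comp.

Lemma gamma_lin (V W : vect G) (r : R) (f g : chom V W) (x : fmod gamma_fun V) :
  fmor gamma_fun (clin r f g) x = phi r *: fmor gamma_fun f x + fmor gamma_fun g x.
Proof.
apply: gval_inj; rewrite [LHS]ginv_mapE gvalD gvalZ !ginv_mapE.
elim/tens_ind: (gval x) => [v m|y z hy hz].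
  by rewrite !tmapE /= tensDl tensZl -restrZ tensZr.
by rewrite !linearD hy hz addrACA.
Qed.

Definition gamma_add : qadd phi G := Qadd gamma_lin.
End GammaAdd.
End Functors.

Section Functors2.
Variables (R A : comPzRingType) (phi : {rmorphism R -> A}) (G : affgrp R).

Section GammaAddMap.
Variables (M N : acomod phi G) (u : ahom M N).

Lemma gamma_add_map_subproof (V W : VectCat G) (f : arr V W) :
  compm (ginv_map (cid W) u : arr (gamma_add M W) (gamma_add N W))
       (fmap (gamma_add M) f) =
  compm (fmap (gamma_add N) f)
       (ginv_map (cid V) u : arr (gamma_add M V) (gamma_add N V)).
Proof.
apply: linear_ext => x; apply: gval_inj; rewrite [LHS]ginv_mapE [RHS]ginv_mapE.
rewrite !ginv_mapE.
rewrite (tmap_comp (h := f) (k := restr_map phi u)) //.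
by rewrite (tmap_comp (h := f) (k := restr_map phi u)).
Qed.

Definition gamma_add_map : nattrans (gamma_add M) (gamma_add N) :=
  @Nattrans (VectCat G) (Mod A) (gamma_add M) (gamma_add N)
    (fun V : vect G => ginv_map (cid V) u) gamma_add_map_subproof.
End GammaAddMap.

Lemma gamma_add_map_id (M : acomod phi G) : gamma_add_map (aid M) = ntid (gamma_add M).
Proof.
apply: nattrans_eq => V x; apply: gval_inj; rewrite [LHS]ginv_mapE.
by rewrite tmap_id.
Qed.

Lemma gamma_add_map_comp (L M N : acomod phi G) (u : ahom M N) (v : ahom L M) :
  gamma_add_map (acomp u v) = ntcomp (gamma_add_map u) (gamma_add_map v).
Proof.
apply: nattrans_eq => V x; apply: gval_inj; rewrite [LHS]ginv_mapE [RHS]ginv_mapE.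
rewrite ginv_mapE.
by rewrite (tmap_comp (h := cid V) (k := restr_map phi (acomp u v))).
Qed.

(* M |-> (- (x)_R M)^G *)
Definition GammaAdd : functor (ModG phi G) (QAdd phi G) :=
  @Functor (ModG phi G) (QAdd phi G) (@gamma_add _ _ phi G) (@gamma_add_map)
    gamma_add_map_id gamma_add_map_comp.

Section GammaMul.
Variable M : qring phi G.

Section TwoVect.
Variables V W : comod G.

Definition gprod : chom (ctens (ctens V (ares M)) (ctens W (ares M)))
                        (ctens (ctens V W) (ares M)) :=
  ccomp (ctmap (cid (ctens V W)) (ccomp (ahom_res (qr_mul M)) (tproj_hom M M)))
        (cmid V (ares M) W (ares M)).

Lemma gprodE (v : V) (m : M) (w : W) (n : M) :
  gprod ((v *t (m : ares M)) *t (w *t (n : ares M))) =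
  (v *t w) *t (qr_mul M (m *t n) : ares M).
Proof.
rewrite /gprod /= tmidE tmapE /=.
by rewrite tprojE.
Qed.

Definition gmul_fun (x : ginv V M) (y : ginv W M) : ginv (ctens V W) M :=
  inv_map gprod (mkinv (invariant_tens (gvalP x) (gvalP y))).

Lemma gmul_fun_val x y : gval (gmul_fun x y) = gprod (gval x *t gval y).
Proof. by []. Qed.

Lemma gprod_actl (a : A) (x : tensor V (ares M)) (y : tensor W (ares M)) :
  gprod (tmap idfun (restr_act phi M a) x *t y) =
  tmap idfun (restr_act phi M a) (gprod (x *t y)).
Proof.
elim/tens_ind: x => [m h|x x' ihx ihx']; last by rewrite !(linearD, tensDl) ihx ihx'.
elim/tens_ind: y => [n k|y y' ihy ihy']; last by rewrite !(linearD, tensDr) ihy ihy'.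
rewrite [tmap _ _ (m *t h)]tmapE !gprodE tmapE; congr (_ *t _).
by rewrite tensZl linearZ.
Qed.

Lemma gprod_actr (a : A) (x : tensor V (ares M)) (y : tensor W (ares M)) :
  gprod (x *t tmap idfun (restr_act phi M a) y) =
  tmap idfun (restr_act phi M a) (gprod (x *t y)).
Proof.
elim/tens_ind: x => [m h|x x' ihx ihx']; last by rewrite !(linearD, tensDl) ihx ihx'.
elim/tens_ind: y => [n k|y y' ihy ihy']; last by rewrite !(linearD, tensDr) ihy ihy'.
rewrite [tmap _ _ (n *t k)]tmapE !gprodE tmapE; congr (_ *t _).
by rewrite tensZr linearZ.
Qed.

Lemma gmul_bilin : bilin gmul_fun.
Proof.
split=> [y|x] a z t; apply: gval_inj.
  by rewrite gmul_fun_val !gvalD !gvalZ !gmul_fun_val tensDl linearD gprod_actl.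
by rewrite gmul_fun_val !gvalD !gvalZ !gmul_fun_val tensDr linearD gprod_actr.
Qed.

Definition gmul : {linear tensor (ginv V M) (ginv W M) -> ginv (ctens V W) M} :=
  tlift gmul_bilin.

Lemma gmulE x y : gval (gmul (x *t y)) = gprod (gval x *t gval y).
Proof. by rewrite /gmul tliftE. Qed.
End TwoVect.

Lemma gprod_nat (V V' W W' : comod G) (f : chom V V') (g : chom W W')
    (x : tensor V (ares M)) (y : tensor W (ares M)) :
  tmap (tmap f g) idfun (gprod V W (x *t y)) =
  gprod V' W' (tmap f idfun x *t tmap g idfun y).
Proof.
elim/tens_ind: x => [m h|x x' ihx ihx']; last by rewrite !(linearD, tensDl) ihx ihx'.
elim/tens_ind: y => [n k|y y' ihy ihy']; last by rewrite !(linearD, tensDr) ihy ihy'.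
by rewrite [tmap _ _ (m *t h)]tmapE [tmap _ _ (n *t k)]tmapE !gprodE !tmapE.
Qed.

Lemma gmul_nat (V V' W W' : vect G) (f : chom V V') (g : chom W W')
    (x : tensor (fmod (gamma_add M) V) (fmod (gamma_add M) W)) :
  fmor (gamma_add M) (ctmap f g : chom (vtens V W) (vtens V' W')) (gmul V W x) =
  gmul V' W' (tmap (fmor (gamma_add M) f) (fmor (gamma_add M) g) x).
Proof.
elim/tens_ind: x => [x y|x y hx hy]; last by rewrite !linearD hx hy.
apply: gval_inj; rewrite tmapE gmulE [LHS]ginv_mapE gmulE !ginv_mapE.
have e : restr_map phi (aid M) =1 idfun by [].
rewrite (eq_tmap (f' := tmap f g) (g' := idfun)) // gprod_nat.
by rewrite (eq_tmap (f := f) (fun=> erefl) e) (eq_tmap (f := g) (fun=> erefl) e).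
Qed.

Definition gamma_pmon : qpmon phi G := @Qpmon _ _ _ _ (gamma_add M) gmul gmul_nat.

End GammaMul.

Lemma gprod_hom (M N : qring phi G) (u : qring_hom M N) (V W : comod G)
    (x : tensor V (ares M)) (y : tensor W (ares M)) :
  tmap idfun (restr_map phi u) (gprod M V W (x *t y)) =
  gprod N V W (tmap idfun (restr_map phi u) x *t tmap idfun (restr_map phi u) y).
Proof.
elim/tens_ind: x => [m h|x x' ihx ihx']; last by rewrite !(linearD, tensDl) ihx ihx'.
elim/tens_ind: y => [n k|y y' ihy ihy']; last by rewrite !(linearD, tensDr) ihy ihy'.
rewrite [tmap _ _ (m *t h)]tmapE [tmap _ _ (n *t k)]tmapE !gprodE !tmapE.
by congr (_ *t _); rewrite [LHS](qrhP u) tmapE.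
Qed.

Lemma gamma_pmon_map_subproof (M N : qring phi G) (u : qring_hom M N) (V W : vect G)
    (x : tensor (fmod (gamma_pmon M) V) (fmod (gamma_pmon M) W)) :
  ncomp (gamma_add_map u) (vtens V W) (qp_mul (gamma_pmon M) V W x) =
  qp_mul (gamma_pmon N) V W
    (tmap (ncomp (gamma_add_map u) V) (ncomp (gamma_add_map u) W) x).
Proof.
elim/tens_ind: x => [x y|x y hx hy]; last by rewrite !linearD hx hy.
apply: gval_inj; rewrite tmapE [RHS]gmulE [LHS]ginv_mapE gmulE.
rewrite (eq_tmap (f' := idfun) (g' := restr_map phi u)) //.
exact: gprod_hom.
Qed.

Definition gamma_pmon_map (M N : qring phi G) (u : qring_hom M N) :
  qpmon_hom (gamma_pmon M) (gamma_pmon N) :=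
  @QpmonHom _ _ _ _ (gamma_pmon M) (gamma_pmon N) (gamma_add_map u)
    (gamma_pmon_map_subproof u).

Lemma gamma_pmon_map_id (M : qring phi G) :
  gamma_pmon_map (qring_id M) = qpmon_id (gamma_pmon M).
Proof.
apply: qpmon_hom_ext => V x; apply: gval_inj; rewrite [LHS]ginv_mapE.
by rewrite tmap_id.
Qed.

Lemma gamma_pmon_map_comp (L M N : qring phi G) (u : qring_hom M N) (v : qring_hom L M) :
  gamma_pmon_map (qring_comp u v) = qpmon_comp (gamma_pmon_map u) (gamma_pmon_map v).
Proof.
apply: qpmon_hom_ext => V x; apply: gval_inj; rewrite [LHS]ginv_mapE [RHS]ginv_mapE.
rewrite ginv_mapE.
by rewrite (tmap_comp (h := cid V) (k := restr_map phi (qring_comp u v))).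
Qed.

Definition GammaPMon : functor (QRings phi G) (QPMon phi G) :=
  @Functor (QRings phi G) (QPMon phi G) gamma_pmon gamma_pmon_map
    gamma_pmon_map_id gamma_pmon_map_comp.

Section GammaMon.
Variable M : qalg phi G.

Lemma gamma_sym (V W : vect G)
    (x : tensor (fmod (gamma_pmon M) V) (fmod (gamma_pmon M) W)) :
  fmor (gamma_pmon M) (cswap V W : chom (vtens V W) (vtens W V))
    (qp_mul (gamma_pmon M) V W x) =
  qp_mul (gamma_pmon M) W V (tswap _ _ x).
Proof.
elim/tens_ind: x => [x y|x y hx hy]; last by rewrite !linearD hx hy.
apply: gval_inj; rewrite tswapE [RHS]gmulE [LHS]ginv_mapE gmulE.
elim/tens_ind: (gval x) => [v m|z t hz ht]; last first.
  by rewrite !(linearD, tensDl, tensDr) hz ht.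
elim/tens_ind: (gval y) => [w n|z t hz ht]; last first.
  by rewrite !(linearD, tensDl, tensDr) hz ht.
rewrite !gprodE tmapE [cswap _ _ _]tswapE; congr (_ *t _).
by rewrite -[RHS]qg_comm tswapE.
Qed.

Lemma gprod_assoc (U V W : comod G) (x : tensor U (ares M)) (y : tensor V (ares M))
    (z : tensor W (ares M)) :
  tmap (tassoc U V W) idfun (gprod M (ctens U V) W (gprod M U V (x *t y) *t z)) =
  gprod M U (ctens V W) (x *t gprod M V W (y *t z)).
Proof.
elim/tens_ind: x => [u m|s t hs ht]; last by rewrite !(linearD, tensDl) hs ht.
elim/tens_ind: y => [v n|s t hs ht]; last by rewrite !(linearD, tensDl, tensDr) hs ht.
elim/tens_ind: z => [w p|s t hs ht]; last by rewrite !(linearD, tensDr) hs ht.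
rewrite !gprodE tmapE tassocE; congr (_ *t _).
transitivity (qr_mul M (tmap (qr_mul M) idfun ((m : M) *t (n : M) *t (p : M)))).
  by rewrite tmapE.
by rewrite qg_assoc tassocE tmapE.
Qed.

Lemma gamma_assoc (U V W : vect G)
    (x : tensor (tensor (fmod (gamma_pmon M) U) (fmod (gamma_pmon M) V))
                (fmod (gamma_pmon M) W)) :
  fmor (gamma_pmon M)
    (cassoc U V W : chom (vtens (vtens U V) W) (vtens U (vtens V W)))
    (qp_mul (gamma_pmon M) (vtens U V) W
      (tmap (qp_mul (gamma_pmon M) U V) idfun x)) =
  qp_mul (gamma_pmon M) U (vtens V W)
    (tmap idfun (qp_mul (gamma_pmon M) V W) (tassoc _ _ _ x)).
Proof.
elim/tens_ind: x => [x z|x y hx hy]; last by rewrite !linearD hx hy.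
elim/tens_ind: x => [x y|x y hx hy]; last by rewrite !(linearD, tensDl) hx hy.
apply: gval_inj; rewrite tassocE !tmapE [RHS]gmulE [LHS]ginv_mapE !gmulE.
rewrite (eq_tmap (f' := tassoc U V W) (g' := idfun)) //.
exact: gprod_assoc.
Qed.

Lemma gone_inv (a : A) :
  invariant ((1 : R^o) *t (a *: qg_one M : ares M) : ctens (cunit G) (ares M)).
Proof.
apply: (@invariant_tens _ _ (cunit G) (ares M)) => //.
rewrite /invariant [LHS](acoactZ a (qg_one M)).
by rewrite [acoact _ _](qg_one_inv M) tmapE.
Qed.

Definition gone_fun (a : A^o) : fmod (gamma_pmon M) (vunit G) := mkginv (gone_inv a).

Lemma gone_linear : linear gone_fun.
Proof.
move=> a x y; apply: gval_inj; rewrite gvalD gvalZ !gval_mk.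
rewrite tmapE -tensDr; congr (_ *t _).
rewrite -[RHS]/(a *: ((x : A) *: qg_one M) + (y : A) *: qg_one M).
by rewrite scalerA -scalerDl.
Qed.

Definition gone : {linear A^o -> fmod (gamma_pmon M) (vunit G)} := mklin gone_linear.

Lemma gamma_mulm1 (V : vect G) (x : tensor (fmod (gamma_pmon M) V) A^o) :
  fmor (gamma_pmon M) (crid V : chom (vtens V (vunit G)) V)
    (qp_mul (gamma_pmon M) V (vunit G) (tmap idfun gone x)) = trid _ x.
Proof.
elim/tens_ind: x => [x a|x y hx hy]; last by rewrite !linearD hx hy.
apply: gval_inj; rewrite tridE tmapE [LHS]ginv_mapE gmulE gvalZ.
transitivity (tmap (crid V) (restr_map phi (aid M)) (gprod M V (cunit G)
  (gval x *t ((1 : R^o) *t (a *: qg_one M : ares M))))); first by [].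
elim/tens_ind: (gval x) => [v m|y z hy hz]; last by rewrite !(linearD, tensDl) hy hz.
rewrite gprodE !tmapE [crid _ _]tridE scale1r; congr (_ *t _).
by rewrite /= tensZr linearZ qg_mulm1.
Qed.

Lemma gamma_mul1m (V : vect G) (x : tensor A^o (fmod (gamma_pmon M) V)) :
  fmor (gamma_pmon M) (clid V : chom (vtens (vunit G) V) V)
    (qp_mul (gamma_pmon M) (vunit G) V (tmap gone idfun x)) = tlid _ x.
Proof.
elim/tens_ind: x => [a x|x y hx hy]; last by rewrite !linearD hx hy.
apply: gval_inj; rewrite tlidE tmapE [LHS]ginv_mapE gmulE gvalZ.
transitivity (tmap (clid V) (restr_map phi (aid M)) (gprod M (cunit G) V
  (((1 : R^o) *t (a *: qg_one M : ares M)) *t gval x))); first by [].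
elim/tens_ind: (gval x) => [v m|y z hy hz]; last by rewrite !(linearD, tensDr) hy hz.
rewrite gprodE !tmapE [clid _ _]tlidE scale1r; congr (_ *t _).
by rewrite /= tensZl linearZ qg_mul1m.
Qed.

Definition gamma_mon : qmon phi G :=
  @Qmon _ _ _ _ (gamma_pmon M) gamma_sym gamma_assoc gone gamma_mulm1 gamma_mul1m.

End GammaMon.

Lemma gamma_mon_map_subproof (M N : qalg phi G) (u : qalg_hom M N) (a : A^o) :
  ncomp (gamma_pmon_map u) (vunit G) (qm_one (gamma_mon M) a) = qm_one (gamma_mon N) a.
Proof.
apply: gval_inj; rewrite [LHS]ginv_mapE [X in tmap _ _ X]gval_mk tmapE.
rewrite [RHS]gval_mk; congr (_ *t _).
by rewrite /= linearZ [u _](qghP u).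
Qed.

Definition gamma_mon_map (M N : qalg phi G) (u : qalg_hom M N) :
  qmon_hom (gamma_mon M) (gamma_mon N) :=
  @QmonHom _ _ _ _ (gamma_mon M) (gamma_mon N) (gamma_pmon_map u)
    (gamma_mon_map_subproof u).

Lemma gamma_mon_map_id (M : qalg phi G) :
  gamma_mon_map (qalg_id M) = qmon_id (gamma_mon M).
Proof.
apply: qmon_hom_ext => V x; apply: gval_inj; rewrite [LHS]ginv_mapE.
by rewrite tmap_id.
Qed.

Lemma gamma_mon_map_comp (L M N : qalg phi G) (u : qalg_hom M N) (v : qalg_hom L M) :
  gamma_mon_map (qalg_comp u v) = qmon_comp (gamma_mon_map u) (gamma_mon_map v).
Proof.
apply: qmon_hom_ext => V x; apply: gval_inj; rewrite [LHS]ginv_mapE [RHS]ginv_mapE.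
rewrite ginv_mapE.
by rewrite (tmap_comp (h := cid V) (k := restr_map phi (qalg_comp u v))).
Qed.

Definition GammaMon : functor (QAlg phi G) (QMon phi G) :=
  @Functor (QAlg phi G) (QMon phi G) gamma_mon gamma_mon_map
    gamma_mon_map_id gamma_mon_map_comp.

End Functors2.

(* Main.v *)
From HB Require Import structures.
From mathcomp Require Import all_boot all_order all_algebra.
From mathcomp Require Import boolp.
Require Import Defs.

(** Write V^* for the contragredient of an object V of Vect. An invariant of V (x) M is
    the same thing as a morphism V^* -> M, namely contraction with linear forms on V
    ([invariant_cont], [cont_invariant], [hom_tensor_invariant]); this duality rests on
    the identities S(S h) = h and Delta(S h) = S h_2 (x) S h_1 of the antipode. By the
    resolution property every element of M is a contraction of some invariant
    ([resolve_tensor]). The relations between such contractions are visible in Vect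
    too: flatness of R[G] makes the kernel of V^* -> M a comodule, so the kernel is in
    turn covered by objects of Vect, and transposing shows that if x contracts to zero
    along xi, then xi factors through a morphism V -> U which kills x
    ([annihilate_tensor]). In other words, M is the filtered colimit of the modules of
    invariants of V (x) M over the pairs (V, xi) of an object of Vect and a form on it.

    Full faithfulness follows: a natural transformation t can only come from the map
    sending the contraction of x along xi to the contraction of t x along xi, which is
    well defined by the description of the relations ([nattrans_ghat0]), and is
    equivariant, multiplicative or unital as the case may be.

    The functors in the image are left exact since short exact sequences of Vect split
    linearly ([gamma_left_exact]). Conversely, any additive functor F has a colimit M
    over the pairs (V, xi); its elements are the classes [germ xi x] with x in F V. That
    the pairs form a filtered category is the resolution property again
    ([annihilate_hom], [ceq_trans]), and Vect has a small skeleton ([code_repP]). The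
    coactions of the V^* make M a comodule, and x in F V defines the invariant of V (x) M
    whose contractions are the germ xi x. For F left exact this comparison map is
    bijective ([unit_inj], [unit_surj]): an identity between contractions along all the
    forms of a dual basis of V is realised in F along a monomorphism V -> U which splits
    linearly, its cokernel is again in Vect, and left exactness descends the identity
    to F V. A pseudo-monoidal structure on F gives a product on M, formed in V (x) W, and
    the axioms of a monoidal functor become those of a commutative algebra.

    If G is linearly reductive, short exact sequences of Vect split equivariantly
    ([reductive_section]), so that every additive functor is left exact. *)

Set Implicit Arguments.
Unset Strict Implicit.
Unset Printing Implicit Defensive.

Import GRing.Theory.
Local Open Scope ring_scope.
Local Open Scope quotient_scope.

(** * Linear forms and contraction of tensors *)

Lemma lidE (R : pzRingType) (V : lmodType R) (x : V) : (idfun : {linear V -> V}) x = x.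
Proof. by []. Qed.

Section LinearForms.
Variables (R : comPzRingType) (V : lmodType R).

Definition lform : Type := {linear V -> R^o}.

HB.instance Definition _ := gen_eqMixin lform.
HB.instance Definition _ := gen_choiceMixin lform.

Definition lform_fun (xi : lform) : {linear V -> R^o} := xi.

Lemma lform0_linear : linear (fun _ : V => 0 : R^o).
Proof. by move=> a x y; rewrite scaler0 addr0. Qed.
Lemma lformD_linear (xi zeta : lform) :
  linear (fun v : V => lform_fun xi v + lform_fun zeta v : R^o).
Proof. by move=> a x y; rewrite !linearP scalerDr addrACA. Qed.
Lemma lformZ_linear (r : R) (xi : lform) :
  linear (fun v : V => r *: lform_fun xi v : R^o).
Proof. by move=> a x y; rewrite linearP scalerDr !scalerA mulrC. Qed.

Definition lform0 : lform := mklin lform0_linear.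
Definition lformD (xi zeta : lform) : lform := mklin (lformD_linear xi zeta).
Definition lformZ (r : R) (xi : lform) : lform := mklin (lformZ_linear r xi).

Fact lformDA : associative lformD.
Proof. by move=> x y z; apply: linear_ext => v /=; rewrite addrA. Qed.
Fact lformDC : commutative lformD.
Proof. by move=> x y; apply: linear_ext => v /=; rewrite addrC. Qed.
Fact lform0D : left_id lform0 lformD.
Proof. by move=> x; apply: linear_ext => v /=; rewrite add0r. Qed.
Fact lformND : left_inverse lform0 (lformZ (-1)) lformD.
Proof. by move=> x; apply: linear_ext => v /=; rewrite scaleN1r addNr. Qed.
HB.instance Definition _ :=
  GRing.isZmodule.Build lform lformDA lformDC lform0D lformND.

Fact lformZA a b x : lformZ a (lformZ b x) = lformZ (a * b) x.
Proof. by apply: linear_ext => v /=; rewrite scalerA. Qed.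
Fact lformZ1 : left_id 1 lformZ.
Proof. by move=> x; apply: linear_ext => v /=; rewrite scale1r. Qed.
Fact lformZDr : right_distributive lformZ +%R.
Proof. by move=> a x y; apply: linear_ext => v /=; rewrite scalerDr. Qed.
Fact lformZDl x : {morph lformZ^~ x : a b / a + b}.
Proof. by move=> a b; apply: linear_ext => v /=; rewrite scalerDl. Qed.
HB.instance Definition _ :=
  GRing.Zmodule_isLmodule.Build R lform lformZA lformZ1 lformZDr lformZDl.

Lemma lform_ext (xi zeta : lform) : lform_fun xi =1 lform_fun zeta -> xi = zeta.
Proof. exact: linear_ext. Qed.

Lemma leval_linear (v : V) : linear (fun xi : lform => lform_fun xi v : R^o).
Proof. by []. Qed.

Definition leval (v : V) : {linear lform -> R^o} := mklin (leval_linear v).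

Lemma lform_sum (I : finType) (z : I -> lform) v :
  lform_fun (\sum_i z i) v = \sum_i lform_fun (z i) v.
Proof. exact: (linear_sum (leval v)). Qed.

End LinearForms.

Definition lpull (R : comPzRingType) (V W : lmodType R) (f : {linear V -> W})
  (xi : lform W) : lform V := lform_fun xi \o f.

Lemma lpull_linear (R : comPzRingType) (V W : lmodType R) (f : {linear V -> W}) :
  linear (lpull f).
Proof. by move=> a x y; apply: linear_ext. Qed.

Section Contraction.
Variable R : comPzRingType.

Lemma cont_subproof (V N : lmodType R) (xi : {linear V -> R^o}) :
  {f : {linear tensor V N -> N} | forall v n, f (v *t n) = (xi v : R) *: n}.
Proof. by exists (tlid N \o tmap xi idfun) => v n; rewrite /= tmapE tlidE. Qed.

Definition cont (V N : lmodType R) (xi : {linear V -> R^o}) :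
  {linear tensor V N -> N} := sval (cont_subproof N xi).

Lemma contE (V N : lmodType R) (xi : {linear V -> R^o}) (v : V) (n : N) :
  cont N xi (v *t n) = (xi v : R) *: n.
Proof. by rewrite /cont; case: cont_subproof. Qed.

Lemma cont_tmap (V W N P : lmodType R) (xi : {linear V -> R^o}) (zeta : {linear W -> R^o})
    (f : {linear V -> W}) (g : {linear N -> P}) x :
  (forall v, zeta (f v) = xi v) -> cont P zeta (tmap f g x) = g (cont N xi x).
Proof.
move=> e; elim/tens_ind: x => [v n|x y hx hy]; last by rewrite !linearD hx hy.
by rewrite tmapE !contE e linearZ.
Qed.

Lemma cont_lpull (V W N : lmodType R) (zeta : lform W) (f : {linear V -> W}) (x : tensor V N) :
  cont N (lform_fun zeta) (tmap f idfun x) = cont N (lform_fun (lpull f zeta)) x.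
Proof. by rewrite (cont_tmap (xi := lform_fun (lpull f zeta))). Qed.

Lemma cont_linear (V N : lmodType R) (x : tensor V N) :
  linear (fun xi : lform V => cont N (lform_fun xi) x).
Proof.
move=> a xi zeta; elim/tens_ind: x => [v n|x y hx hy].
  by rewrite !contE scalerA -scalerDl.
by rewrite !linearD hx hy addrACA.
Qed.

(** The map from linear forms on V to N that an element of V (x) N amounts to. *)
Definition hat (V N : lmodType R) (x : tensor V N) : {linear lform V -> N} :=
  mklin (cont_linear x).

Lemma hat_cont (V N : lmodType R) (x : tensor V N) xi : hat x xi = cont N (lform_fun xi) x.
Proof. by []. Qed.

Lemma hatD (V N : lmodType R) (x y : tensor V N) xi : hat (x + y) xi = hat x xi + hat y xi.
Proof. exact: linearD. Qed.

Lemma hatE (V N : lmodType R) (v : V) (n : N) (xi : lform V) :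
  hat (v *t n) xi = (lform_fun xi v : R) *: n.
Proof. exact: contE. Qed.

(** A finite family of vectors and forms resolving the identity of V, which exists
    exactly when V is finitely generated projective. *)
Record dual_basis (V : lmodType R) := DualBasis {
  dbI : finType;
  dbv : dbI -> V;
  dbc : dbI -> {linear V -> R^o};
  dbP : forall x, x = \sum_i (dbc i x : R) *: dbv i
}.

Arguments dbv {V} d i.
Arguments dbc {V} d i.

Lemma fgproj_dual_basis (V : lmodType R) : fgproj V -> {b : dual_basis V | True}.
Proof.
move=> /fgprojP h; apply: boolp.cid.
by have [I [v [c e]]] := h; exists (DualBasis e).
Qed.

Section DualBasisTensor.
Variables (V : lmodType R) (b : dual_basis V).

Lemma dual_basis_tensor (N : lmodType R) (x : tensor V N) :
  x = \sum_i dbv b i *t cont N (dbc b i) x.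
Proof.
elim/tens_ind: x => [v n|x y hx hy].
  rewrite {1}(dbP b v) -[LHS]/(tensl _ n _) linear_sum; apply: eq_bigr => i _.
  by rewrite linearZ /= contE tensZr.
rewrite {1}hx {1}hy -big_split; apply: eq_bigr => i _ /=.
by rewrite !linearD tensDr.
Qed.

Lemma cont_ext (N : lmodType R) (x y : tensor V N) :
  (forall i, cont N (dbc b i) x = cont N (dbc b i) y) -> x = y.
Proof.
move=> e; rewrite (dual_basis_tensor x) (dual_basis_tensor y).
by apply: eq_bigr => i _; rewrite e.
Qed.

Lemma dual_basis_form (xi : lform V) :
  xi = \sum_i (lform_fun xi (dbv b i) : R) *: (dbc b i : lform V).
Proof.
apply: lform_ext => x; rewrite lform_sum {1}(dbP b x) linear_sum.
by apply: eq_bigr => i _; rewrite linearZ /= /GRing.scale /= mulrC.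
Qed.

Definition dual_dual_basis : dual_basis (lform V) :=
  @DualBasis (lform V) (dbI b) (fun i => dbc b i : lform V)
    (fun i => leval (dbv b i)) dual_basis_form.

End DualBasisTensor.

Lemma fgproj_lform (V : lmodType R) : fgproj V -> fgproj (lform V).
Proof.
move=> /fgproj_dual_basis[b _]; apply/fgprojP.
by have := dual_dual_basis b; case=> I v c e; exists I, v, c.
Qed.

Lemma hat_inj (V N : lmodType R) (x y : tensor V N) :
  fgproj V -> (forall xi, hat x xi = hat y xi) -> x = y.
Proof.
by move=> /fgproj_dual_basis[b _] e; apply: (cont_ext (b := b)) => i; exact: e.
Qed.

Lemma leval_ext (V N : lmodType R) (x y : tensor (lform V) N) :
  fgproj V -> (forall v, cont N (leval v) x = cont N (leval v) y) -> x = y.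
Proof.
move=> /fgproj_dual_basis[b _] e.
by apply: (cont_ext (b := dual_dual_basis b)) => i; exact: e.
Qed.

End Contraction.
Arguments dbv {R V} d i.
Arguments dbc {R V} d i.

(** * Convolution and the antipode *)

Section Antipode.
Variables (R : comPzRingType) (G : affgrp R).
Local Notation H := (gfun G).
Local Notation one := (alg1 (gstr G) : H).
Local Notation hmul := (algmul (gstr G)).

Lemma gstrE (r : R) : gstr G r = r *: one :> H.
Proof. by rewrite [RHS]restrZ; rewrite /alg1 /GRing.scale /= mulr1. Qed.

Lemma hmulA (x y z : H) : hmul (hmul (x *t y) *t z) = hmul (x *t hmul (y *t z)).
Proof. by rewrite !algmulE mulrA. Qed.
Lemma hmul1r (x : H) : hmul (one *t x) = x.
Proof. by rewrite algmulE mul1r. Qed.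
Lemma hmulr1 (x : H) : hmul (x *t one) = x.
Proof. by rewrite algmulE mulr1. Qed.

(** Inverses for the convolution product of linear maps from R[G] to an algebra are
    unique; the identities satisfied by the antipode follow by exhibiting both
    sides as convolution inverses of the same map. *)
Lemma conv_uniq (B : lmodType R) (m : {linear tensor B B -> B}) (e : B)
    (mA : forall x y z, m (m (x *t y) *t z) = m (x *t m (y *t z)))
    (m1r : forall x, m (e *t x) = x) (mr1 : forall x, m (x *t e) = x)
    (f g k : {linear H -> B}) :
  (forall h, m (tmap f g (comul G h)) = (counit G h : R) *: e) ->
  (forall h, m (tmap g k (comul G h)) = (counit G h : R) *: e) -> f =1 k.
Proof.
move=> fg gk h.
pose gk' : {linear H -> B} := (m \o tmap g k) \o comul G.
pose fg' : {linear H -> B} := (m \o tmap f g) \o comul G.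
transitivity (m (tmap f gk' (comul G h))).
  rewrite -[in LHS](counitr h).
  elim/tens_ind: (comul G h) => [x y|x y hx hy]; last by rewrite !linearD hx hy.
  by rewrite !tmapE tridE /gk' /= gk tensZr linearZ /=; rewrite !linearZ /= mr1.
transitivity (m (tmap fg' k (comul G h))); last first.
  rewrite -[in RHS](counitl h).
  elim/tens_ind: (comul G h) => [x y|x y hx hy]; last by rewrite !linearD hx hy.
  by rewrite !tmapE tlidE /fg' /= fg tensZl !linearZ /= m1r.
transitivity (m (tmap f (m \o tmap g k) (tmap idfun (comul G) (comul G h)))).
  by rewrite (tmap_comp (h := f) (k := gk')).
rewrite -comulA.
transitivity (m (tmap (m \o tmap f g) k (tmap (comul G) idfun (comul G h)))); last first.
  by rewrite (tmap_comp (h := fg') (k := k)).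
elim/tens_ind: (tmap (comul G) idfun (comul G h)) => [x z|x y hx hy]; last by rewrite !linearD hx hy.
elim/tens_ind: x => [x y|x y hx hy]; last by rewrite !(linearD, tensDl) hx hy.
by rewrite tassocE !tmapE /= !tmapE mA.
Qed.

Lemma counit_antipode h : counit G (antipode G h) = counit G h.
Proof.
have e : counit G ((counit G h : R) *: one) = counit G h.
  by rewrite linearZ counit1; exact: mulr1.
rewrite -[RHS]e -gstrE -antipodel -[in LHS](counitr h).
elim/tens_ind: (comul G h) => [x y|x y hx hy]; last by rewrite !linearD hx hy.
rewrite !tmapE tridE algmulE counitM /= !linearZ /=; exact: mulrC.
Qed.

(** S o S is a convolution inverse of S because S is multiplicative; so is the
    identity. *)
Lemma antipodeK h : antipode G (antipode G h) = h.
Proof.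
apply: (conv_uniq (m := hmul) (f := antipode G \o antipode G) (g := antipode G)
  (k := idfun) hmulA hmul1r hmulr1) => {}h; last by rewrite antipodel gstrE.
rewrite -gstrE.
transitivity (antipode G (hmul (tmap (antipode G) idfun (comul G h)))).
  elim/tens_ind: (comul G h) => [x y|x y hx hy]; last by rewrite !linearD hx hy.
  by rewrite !tmapE !algmulE antipodeM.
by rewrite antipodel gstrE linearZ antipode1.
Qed.

Local Notation hmul2 := (tensor_mul (gstr G)).

Lemma hmul2E (x y z t : H) :
  hmul2 ((x *t y) *t (z *t t)) = hmul (x *t z) *t hmul (y *t t).
Proof. by rewrite /tensor_mul /= tmidE tmapE. Qed.

Lemma hmul2A x y z : hmul2 (hmul2 (x *t y) *t z) = hmul2 (x *t hmul2 (y *t z)).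
Proof.
elim/tens_ind: x => [x x'|x x' hx hy]; last by rewrite !(linearD, tensDl) hx hy.
elim/tens_ind: y => [y y'|y y' hx hy]; last by rewrite !(linearD, tensDl, tensDr) hx hy.
elim/tens_ind: z => [z z'|z z' hx hy]; last by rewrite !(linearD, tensDr) hx hy.
by rewrite !hmul2E !hmulA.
Qed.

Lemma hmul2_1r x : hmul2 ((one *t one) *t x) = x.
Proof.
elim/tens_ind: x => [x x'|x x' hx hy]; last by rewrite !(linearD, tensDr) hx hy.
by rewrite hmul2E !hmul1r.
Qed.

Lemma hmul2_r1 x : hmul2 (x *t (one *t one)) = x.
Proof.
elim/tens_ind: x => [x x'|x x' hx hy]; last by rewrite !(linearD, tensDl) hx hy.
by rewrite hmul2E !hmulr1.
Qed.

(** h (x) k |-> S(k) (x) S(h) *)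
Definition twist : {linear tensor H H -> tensor H H} :=
  tmap (antipode G) (antipode G) \o tswap H H.

Lemma twistE x y : twist (x *t y) = antipode G y *t antipode G x.
Proof. by rewrite /twist /= tswapE tmapE. Qed.

(** The inner half of that computation: a S(y_3) (x) y_1 S(y_2) = a S(y) (x) 1. *)
Lemma comul_twist_inner (a y : H) :
  hmul2 (tmap (tensr H a) (twist \o comul G) (comul G y)) =
  hmul (a *t antipode G y) *t one.
Proof.
transitivity (hmul2 (tmap (tensr H a) twist (tmap idfun (comul G) (comul G y)))).
  by rewrite (tmap_comp (h := tensr H a) (k := twist \o comul G)).
rewrite -comulA -[in RHS](counitl y).
elim/tens_ind: (comul G y) => [b z|x x' hx hy]; last first.
  by rewrite !(linearD, tensDl, tensDr) hx hy.
rewrite !tmapE tlidE.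
transitivity (hmul (a *t antipode G z) *t hmul (tmap idfun (antipode G) (comul G b))).
  elim/tens_ind: (comul G b) => [b1 b2|x x' hx hy]; last first.
    by rewrite !(linearD, tensDl, tensDr) hx hy.
  by rewrite tassocE !tmapE twistE [tensr _ _ _]/(a *t b1) hmul2E.
by rewrite antipoder gstrE tensZr linearZ /= tensZr linearZ tensZl.
Qed.

(** Both sides are convolution inverses of the comultiplication: the left one because
    the comultiplication is multiplicative, the right one by collapsing
    h_1 S(h_4) (x) h_2 S(h_3). *)
Lemma comul_antipode h : comul G (antipode G h) = twist (comul G h).
Proof.
apply: (conv_uniq (m := hmul2) (f := comul G \o antipode G) (g := comul G)
  (k := twist \o comul G) hmul2A hmul2_1r hmul2_r1) => {}h.
  transitivity (comul G (hmul (tmap (antipode G) idfun (comul G h)))).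
    elim/tens_ind: (comul G h) => [x y|x y hx hy]; last by rewrite !linearD hx hy.
    by rewrite !tmapE algmulE comulM.
  by rewrite antipodel gstrE linearZ comul1.
transitivity (hmul (tmap idfun (antipode G) (comul G h)) *t one); last first.
  by rewrite antipoder gstrE tensZl.
pose k : {linear H -> tensor H H} := twist \o comul G.
transitivity (hmul2 (tmap idfun k (tmap (comul G) idfun (comul G h)))).
  by rewrite (tmap_comp (h := comul G) (k := k)).
have -> : tmap (comul G) idfun (comul G h) =
    tassocI H H H (tmap idfun (comul G) (comul G h)).
  exact: esym (etrans (congr1 (tassocI H H H) (esym (comulA h))) (tassocK _)).
elim/tens_ind: (comul G h) => [x y|x y hx hy]; last by rewrite !(linearD, tensDl) hx hy.
rewrite !tmapE -[RHS]comul_twist_inner.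
elim/tens_ind: (comul G y) => [b1 b2|s t hx hy]; last by rewrite !(linearD, tensDr) hx hy.
by rewrite tassocIE !tmapE.
Qed.

End Antipode.

(** * Contragredient comodules *)

Section Dual.
Variables (R : comPzRingType) (G : affgrp R).
Local Notation H := (gfun G).
Local Notation one := (alg1 (gstr G) : H).

Section MatrixCoefficients.
Variable V : comod G.

Lemma mcoef_subproof (xi : lform V) :
  {f : {linear V -> H} | forall v, f v = cont H (lform_fun xi) (coact V v)}.
Proof. by exists (cont H (lform_fun xi) \o coact V). Qed.

(** v |-> xi(v_0) v_1, the matrix coefficient of xi. *)
Definition mcoef (xi : lform V) : {linear V -> H} := sval (mcoef_subproof xi).

Lemma mcoefE xi v : mcoef xi v = cont H (lform_fun xi) (coact V v).
Proof. by rewrite /mcoef; case: mcoef_subproof. Qed.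

Lemma mcoef_lin v : linear (fun xi => mcoef xi v : H).
Proof.
move=> a x y; apply: etrans (mcoefE _ _) (etrans (cont_linear (coact V v) a x y) _).
by congr (_ *: _ + _); rewrite mcoefE.
Qed.

Lemma counit_mcoef xi v : counit G (mcoef xi v) = lform_fun xi v.
Proof.
rewrite -[in RHS]((coactP V).1 v) mcoefE.
elim/tens_ind: (coact V v) => [w h|x y hx hy]; last by rewrite !linearD hx hy.
rewrite contE tmapE tridE !linearZ; exact: mulrC.
Qed.

Lemma cont_coact2 xi (x : tensor V H) :
  cont (tensor H H) (lform_fun xi) (tassoc V H H (tmap (coact V) idfun x)) =
  tmap (mcoef xi) idfun x.
Proof.
elim/tens_ind: x => [w h|x y hx hy]; last by rewrite !linearD hx hy.
rewrite !tmapE mcoefE.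
elim/tens_ind: (coact V w) => [w' h'|x y hx hy].
  by rewrite tassocE !contE tensZl.
by rewrite !(linearD, tensDl) hx hy.
Qed.

Lemma comul_mcoef xi v : comul G (mcoef xi v) = tmap (mcoef xi) idfun (coact V v).
Proof.
rewrite -cont_coact2 (coactP V).2 mcoefE; symmetry.
exact: cont_tmap.
Qed.

End MatrixCoefficients.

Section DualComodule.
Variable V : vect G.

Definition vbasis : dual_basis V := sval (fgproj_dual_basis (vectP V)).

Lemma dual_coact_linear :
  linear (fun xi : lform V =>
    \sum_i (dbc vbasis i : lform V) *t (antipode G (mcoef xi (dbv vbasis i)) : H)).
Proof.
move=> a x y; rewrite scaler_sumr -big_split; apply: eq_bigr => i _ /=.
by rewrite (mcoef_lin _ a x y) (linearP (antipode G)) tensDr tensZr.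
Qed.

Definition dual_coact : {linear lform V -> tensor (lform V) H} :=
  mklin dual_coact_linear.

(** The dual basis only serves to write the coaction down; this is its description
    independent of the basis, the usual formula g xi = xi o g^-1. *)
Lemma leval_dual_coact xi v :
  cont H (leval v) (dual_coact xi) = antipode G (mcoef xi v).
Proof.
rewrite linear_sum [in RHS](dbP vbasis v) !linear_sum; apply: eq_bigr => i _.
by rewrite contE !linearZ.
Qed.

(** Coassociativity comes down to Delta(S h) = S h_2 (x) S h_1. *)
Lemma dual_coactP : is_coaction dual_coact.
Proof.
split=> xi.
  apply: lform_ext => v; rewrite -[RHS]counit_mcoef -counit_antipode -leval_dual_coact.
  elim/tens_ind: (dual_coact xi) => [z h|x y hx hy].
    rewrite tmapE tridE contE linearZ; exact: mulrC.
  by rewrite !linearD -hx -hy.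
apply: (leval_ext (vectP V)) => v.
(* Both sides are compared through evaluation of V^* at v. *)
transitivity (comul G (antipode G (mcoef xi v))); last first.
  rewrite -leval_dual_coact; symmetry; exact: cont_tmap.
rewrite comul_antipode comul_mcoef.
rewrite [dual_coact xi]/= !linear_sum (dual_basis_tensor vbasis (coact V v)) !linear_sum.
apply: eq_bigr => i _; rewrite !tmapE twistE.
rewrite -[cont H (dbc vbasis i) _](mcoefE (dbc vbasis i : lform V) v).
rewrite !lidE -!leval_dual_coact.
elim/tens_ind: (dual_coact (dbc vbasis i)) => [z h|x y hx hy].
  by rewrite tassocE !contE tensZl.
by rewrite !(linearD, tensDl) hx hy.
Qed.

Definition vdual : vect G := @Vect _ _ (Comod dual_coactP) (fgproj_lform (vectP V)).

Lemma mcoef_leval v (xi : vdual) : mcoef (leval v : lform vdual) xi = antipode G (mcoef xi v).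
Proof. by rewrite mcoefE; exact: leval_dual_coact. Qed.

End DualComodule.

Lemma lpull_hom_subproof (V W : vect G) (f : chom V W) (zeta : vdual W) :
  coact (vdual V) (lpull f zeta) = tmap (mklin (lpull_linear f)) idfun (coact (vdual W) zeta).
Proof.
apply: (leval_ext (vectP V)) => v; rewrite leval_dual_coact.
rewrite (cont_tmap (xi := leval (f v))) // lidE [RHS]leval_dual_coact.
have -> : mcoef (lpull f zeta) v = mcoef zeta (f v) by
  rewrite !mcoefE chomP; symmetry; apply: cont_tmap.
by [].
Qed.

Definition lpull_hom (V W : vect G) (f : chom V W) : chom (vdual W) (vdual V) :=
  @Chom _ _ (vdual W) (vdual V) (mklin (lpull_linear f)) (lpull_hom_subproof f).

Section Transpose.
Variables (U V : vect G) (h : chom U (vdual V)).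

Lemma transpose_form_linear (v : V) : linear (fun u : U => lform_fun (h u) v : R^o).
Proof. by move=> a x y; rewrite linearP. Qed.

Definition transpose_fun (v : V) : vdual U := mklin (transpose_form_linear v) : lform U.

Lemma transpose_linear : linear transpose_fun.
Proof. by move=> a x y; apply: lform_ext => u /=; rewrite linearP. Qed.

Lemma transpose_subproof v :
  coact (vdual U) (mklin transpose_linear v) = tmap (mklin transpose_linear) idfun (coact V v).
Proof.
apply: (leval_ext (vectP U)) => u; rewrite leval_dual_coact.
rewrite (cont_tmap (xi := lform_fun (h u))) // -mcoefE.
rewrite -[RHS]antipodeK -[X in _ = antipode G X]leval_dual_coact.
rewrite -[dual_coact V (h u)]/(coact (vdual V) (h u)) chomP.
have -> : mcoef (transpose_fun v) u = cont H (leval v) (tmap h idfun (coact U u)) by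
  rewrite mcoefE; symmetry; apply: cont_tmap.
by [].
Qed.

(** Equivariance of the transpose amounts to the invariance of one and the same
    pairing of U with V; passing from one variable to the other uses that the
    antipode is an involution. *)
Definition transpose : chom V (vdual U) := Chom transpose_subproof.

Lemma transposeE v u : lform_fun (transpose v) u = lform_fun (h u) v.
Proof. by []. Qed.

End Transpose.

End Dual.

(** * Invariants of a tensor product *)

Section Invariance.
Variables (R : comPzRingType) (G : affgrp R).
Local Notation H := (gfun G).
Local Notation one := (alg1 (gstr G) : H).
Local Notation hmul := (algmul (gstr G)).

Section Twist.
Variables (V : comod G) (N : lmodType R).

Lemma twc_subproof (f : {linear H -> H}) :
  {t : {linear tensor V (tensor N H) -> tensor (tensor V N) H} |
   forall v x, t (v *t x) = mix G V N (tmap idfun f (coact V v) *t x)}.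
Proof.
by exists (mix G V N \o tmap (tmap idfun f \o coact V) idfun) => v x; rewrite /= tmapE.
Qed.

(** v (x) n (x) h |-> v_0 (x) n (x) f(v_1) h. For f the identity this is the
    automorphism by which the universal point of G acts on V; for f the antipode it
    is the inverse automorphism. *)
Definition twc (f : {linear H -> H}) := sval (twc_subproof f).

Lemma twcE f v x : twc f (v *t x) = mix G V N (tmap idfun f (coact V v) *t x).
Proof. by rewrite /twc; case: twc_subproof. Qed.

Lemma twcK (f g : {linear H -> H}) :
  (forall h, hmul (tmap f g (comul G h)) = (counit G h : R) *: one) ->
  forall x, twc f (tassoc _ _ _ (twc g x)) = tassocI V N H x.
Proof.
move=> fg x; elim/tens_ind: x => [v x|x y hx hy]; last by rewrite !linearD hx hy.
elim/tens_ind: x => [n h|x y hx hy]; last by rewrite !(linearD, tensDr) hx hy.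
rewrite twcE tassocIE.
pose fg' : {linear tensor H H -> H} := hmul \o tmap f g.
have fgE a b : fg' (a *t b) = hmul (f a *t g b) by rewrite /fg' /= tmapE.
pose fgc : {linear H -> H} := fg' \o comul G.
have fgcE a : fgc a = (counit G a : R) *: one by rewrite -fg.
transitivity (mix G V N
    (tmap idfun fg' (tassoc V H H (tmap (coact V) idfun (coact V v))) *t (n *t h))).
  elim/tens_ind: (coact V v) => [w k|x y hx hy]; last by rewrite !(linearD, tensDl) hx hy.
  rewrite !tmapE !lidE mixE tassocE twcE.
  elim/tens_ind: (coact V w) => [u l|x y hx hy]; last by rewrite !(linearD, tensDl) hx hy.
  by rewrite tassocE !tmapE !lidE !mixE fgE algmulE mulrA.
rewrite (coactP V).2.
transitivity (mix G V N (tmap idfun fgc (coact V v) *t (n *t h))).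
  by congr (mix G V N (_ *t _)); apply: tmap_comp.
rewrite -[in RHS]((coactP V).1 v).
elim/tens_ind: (coact V v) => [w k|x y hx hy]; last by rewrite !(linearD, tensDl) hx hy.
rewrite !tmapE tridE lidE fgcE tensZr !tensZl.
by rewrite linearZ mixE mul1r.
Qed.
End Twist.

Variables (V N : comod G).

Lemma coact_twc y : coact (ctens V N) y = twc V N idfun (tmap idfun (coact N) y).
Proof.
elim/tens_ind: y => [v n|x y hx hy]; last by rewrite !linearD hx hy.
by rewrite [LHS]ctens_coactE tmapE twcE tmap_id.
Qed.

(** The coaction of V (x) N is that of N followed by the automorphism [twc idfun], so
    applying the inverse automorphism solves the equation of invariance for the
    coaction of N. *)
Lemma invariant_twc (y : tensor V N) :
  invariant (y : ctens V N) <->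
  tmap idfun (coact N) y = tassoc _ _ _ (twc V N (antipode G) (tassoc _ _ _ (y *t one))).
Proof.
have hSi h : hmul (tmap (antipode G) idfun (comul G h)) = (counit G h : R) *: one.
  by rewrite antipodel gstrE.
have hiS h : hmul (tmap idfun (antipode G) (comul G h)) = (counit G h : R) *: one.
  by rewrite antipoder gstrE.
rewrite /invariant coact_twc; split=> [<-|->].
  exact: esym (etrans (congr1 (tassoc V N H) (twcK hSi _)) (tassocIK _)).
exact: etrans (twcK hiS _) (tassocK _).
Qed.

Lemma twcont_subproof (xi : lform V) :
  {t : {linear tensor V N -> tensor N H} |
   forall v n, t (v *t n) = n *t antipode G (mcoef xi v)}.
Proof.
exists (tmap idfun (antipode G \o mcoef xi) \o tswap V N) => v n.
by rewrite /= tswapE tmapE.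
Qed.

(** v (x) n |-> n (x) S(xi(v_0) v_1), the coaction that invariance of a tensor imposes
    on its contraction with xi. *)
Definition twcont (xi : lform V) : {linear tensor V N -> tensor N H} :=
  sval (twcont_subproof xi).

Lemma twcontE xi v n : twcont xi (v *t n) = n *t antipode G (mcoef xi v).
Proof. by rewrite /twcont; case: twcont_subproof. Qed.

Lemma cont_twc (xi : lform V) (y : tensor V N) :
  cont (tensor N H) (lform_fun xi)
    (tassoc _ _ _ (twc V N (antipode G) (tassoc _ _ _ (y *t one)))) =
  twcont xi y.
Proof.
elim/tens_ind: y => [v n|x y hx hy]; last by rewrite !(linearD, tensDl) hx hy.
rewrite tassocE twcE twcontE mcoefE.
elim/tens_ind: (coact V v) => [w k|x y hx hy]; last first.
  by rewrite !(linearD, tensDl, tensDr) hx hy.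
by rewrite tmapE mixE mulr1 tassocE !contE linearZ /= tensZr.
Qed.

(** This and its converse [cont_invariant] say that invariants of V (x) N are morphisms
    V^* -> N. *)
Lemma invariant_cont (y : tensor V N) (xi : lform V) :
  invariant (y : ctens V N) -> coact N (cont N (lform_fun xi) y) = twcont xi y.
Proof.
by move=> /invariant_twc e; rewrite -cont_twc -e; symmetry; apply: cont_tmap.
Qed.

Lemma cont_invariant (b : dual_basis V) (y : tensor V N) :
  (forall i, coact N (cont N (dbc b i) y) = twcont (dbc b i : lform V) y) ->
  invariant (y : ctens V N).
Proof.
move=> e; apply/invariant_twc; apply: (cont_ext (b := b)) => i.
by rewrite (cont_tmap (xi := dbc b i)) // e (cont_twc (dbc b i : lform V)).
Qed.

End Invariance.

Arguments twcont {R G V N} xi.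

Section InvariantsAndHoms.
Variables (R : comPzRingType) (G : affgrp R).
Local Notation H := (gfun G).

Lemma twcont_dual (V : vect G) (N : comod G) (y : tensor V N) (xi : lform V) :
  twcont xi y = tmap (hat y) idfun (dual_coact V xi).
Proof.
elim/tens_ind: y => [v n|x y hx hy].
  rewrite twcontE -leval_dual_coact.
  elim/tens_ind: (dual_coact V xi) => [z h|x y hx hy]; last first.
    by rewrite !(linearD, tensDr) hx hy.
  by rewrite contE tmapE hatE tensZr tensZl.
rewrite linearD hx hy.
elim/tens_ind: (dual_coact V xi) => [z h|s t hs ht].
  by rewrite !tmapE hatD tensDl.
by rewrite !linearD -hs -ht addrACA.
Qed.

Section HatHom.
Variables (V : vect G) (N : comod G) (y : tensor V N).
Hypothesis hy : invariant (y : ctens V N).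

Lemma hat_hom_subproof (xi : vdual V) :
  coact N (hat y xi) = tmap (hat y) idfun (coact (vdual V) xi).
Proof. by rewrite -twcont_dual; apply: invariant_cont. Qed.

Definition hat_hom : chom (vdual V) N := @Chom _ _ (vdual V) N (hat y) hat_hom_subproof.
End HatHom.

Lemma hat_hom_invariant (V : vect G) (N : comod G) (y : tensor V N) :
  (forall xi : lform V, coact N (hat y xi) = tmap (hat y) idfun (dual_coact V xi)) ->
  invariant (y : ctens V N).
Proof.
move=> e; apply: (cont_invariant (b := vbasis V)) => i.
by rewrite twcont_dual -e.
Qed.

(** The invariant of V^* (x) N given by a morphism V -> N. *)
Definition hom_tensor (V : vect G) (N : comod G) (h : chom V N) : tensor (vdual V) N :=
  \sum_i (dbc (vbasis V) i : lform V) *t h (dbv (vbasis V) i).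

Lemma leval_hom_tensor (V : vect G) (N : comod G) (h : chom V N) v :
  cont N (leval v) (hom_tensor h) = h v.
Proof.
rewrite /hom_tensor linear_sum [in RHS](dbP (vbasis V) v) linear_sum.
by apply: eq_bigr => i _; rewrite contE linearZ.
Qed.

(** Invariance is tested by evaluation at vectors of V, that is by forms on V^*; their
    matrix coefficients involve the antipode twice, and it is an involution. *)
Lemma hom_tensor_invariant (V : vect G) (N : comod G) (h : chom V N) :
  invariant (hom_tensor h : ctens (vdual V) N).
Proof.
apply: (@cont_invariant _ _ (vdual V) N (dual_dual_basis (vbasis V))) => j /=.
set u := dbv (vbasis V) j; rewrite leval_hom_tensor chomP.
rewrite [in RHS]/hom_tensor linear_sum (dual_basis_tensor (vbasis V) (coact V u)) linear_sum.
apply: eq_bigr => i _; set c : lform V := dbc _ i.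
transitivity (h (dbv (vbasis V) i) *t antipode G (mcoef (leval u : lform (vdual V)) c)).
  by rewrite tmapE mcoef_leval antipodeK mcoefE.
symmetry; exact: (@twcontE _ _ (vdual V) N).
Qed.

End InvariantsAndHoms.

(** * Direct sums, quotients and kernels of comodules *)

Section CoactionImage.
Variables (R : comPzRingType) (G : affgrp R).
Local Notation H := (gfun G).

(** The comodule axioms need only be checked on the images of comodules. *)
Lemma coaction_image (V : comod G) (M : lmodType R) (d : {linear M -> tensor M H})
    (j : {linear V -> M}) :
  (forall v, d (j v) = tmap j idfun (coact V v)) -> forall v,
  trid M (tmap idfun (counit G) (d (j v))) = j v /\
  tassoc M H H (tmap d idfun (d (j v))) = tmap idfun (comul G) (d (j v)).
Proof.
move=> dj v; split; rewrite !dj.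
  rewrite -[in RHS]((coactP V).1 v).
  elim/tens_ind: (coact V v) => [w h|x y hx hy]; last by rewrite !linearD hx hy.
  by rewrite !tmapE !tridE linearZ.
transitivity (tmap j idfun (tmap idfun (comul G) (coact V v))).
  rewrite -(coactP V).2.
  elim/tens_ind: (coact V v) => [w h|x y hx hy]; last by rewrite !linearD hx hy.
  rewrite !tmapE dj.
  elim/tens_ind: (coact V w) => [w' h'|x y hx hy].
    by rewrite tmapE !tassocE !tmapE.
  by rewrite !(linearD, tensDl) hx hy.
elim/tens_ind: (coact V v) => [w h|x y hx hy]; last by rewrite !linearD hx hy.
by rewrite !tmapE.
Qed.

End CoactionImage.

Section DirectSum.
Variables (R : comPzRingType).

Section Modules.
Variables V W : lmodType R.

Lemma pinl_linear : linear (fun v : V => (v, 0) : V * W).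
Proof. by move=> a x y; congr pair; rewrite /= ?scaler0 ?addr0. Qed.
Lemma pinr_linear : linear (fun w : W => (0, w) : V * W).
Proof. by move=> a x y; congr pair; rewrite /= ?scaler0 ?addr0. Qed.
Lemma pfst_linear : linear (fun p : V * W => p.1). Proof. by []. Qed.
Lemma psnd_linear : linear (fun p : V * W => p.2). Proof. by []. Qed.

Definition pinl : {linear V -> (V * W)%type} := mklin pinl_linear.
Definition pinr : {linear W -> (V * W)%type} := mklin pinr_linear.
Definition pfst : {linear (V * W)%type -> V} := mklin pfst_linear.
Definition psnd : {linear (V * W)%type -> W} := mklin psnd_linear.

Lemma pairE (p : V * W) : p = pinl p.1 + pinr p.2.
Proof.
by case: p => v w; congr pair; rewrite /= ?addr0 ?add0r.
Qed.

Lemma fgproj_prod : fgproj V -> fgproj W -> fgproj (V * W)%type.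
Proof.
move=> /fgprojP[I [v [c ev]]] /fgprojP[J [w [d ew]]]; apply/fgprojP.
exists (I + J)%type, (fun k => match k with inl i => pinl (v i) | inr j => pinr (w j) end),
  (fun k => match k return {linear (V * W)%type -> R^o} with
            | inl i => c i \o pfst
            | inr j => d j \o psnd
            end) => x.
rewrite big_sumType /= {1}[x]pairE {1}(ev x.1) {1}(ew x.2) !linear_sum.
by congr (_ + _); apply: eq_bigr => i _; rewrite linearZ.
Qed.

End Modules.

Variable G : affgrp R.
Local Notation H := (gfun G).

Section Comodules.
Variables V W : comod G.

Lemma csum_coact_linear :
  linear (fun p : V * W =>
    tmap (pinl V W) idfun (coact V p.1) + tmap (pinr V W) idfun (coact W p.2)
    : tensor (V * W)%type H).
Proof. by move=> a x y; rewrite !linearP scalerDr addrACA. Qed.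

Lemma csum_coact_subproof : {d : {linear (V * W)%type -> tensor (V * W)%type H} |
  forall p, d p = tmap (pinl V W) idfun (coact V p.1) +
                  tmap (pinr V W) idfun (coact W p.2)}.
Proof. by exists (mklin csum_coact_linear). Qed.

Definition csum_coact : {linear (V * W)%type -> tensor (V * W)%type H} :=
  sval csum_coact_subproof.

Lemma csum_coactE p : csum_coact p =
  tmap (pinl V W) idfun (coact V p.1) + tmap (pinr V W) idfun (coact W p.2).
Proof. by rewrite /csum_coact; case: csum_coact_subproof. Qed.

Lemma csum_coact_inl v : csum_coact (pinl V W v) = tmap (pinl V W) idfun (coact V v).
Proof. by rewrite csum_coactE /= !linear0 addr0. Qed.
Lemma csum_coact_inr w : csum_coact (pinr V W w) = tmap (pinr V W) idfun (coact W w).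
Proof. by rewrite csum_coactE /= !linear0 add0r. Qed.

Lemma csum_coactP : is_coaction csum_coact.
Proof.
split=> -[v w]; rewrite (pairE (v, w)) !linearD.
  by rewrite (coaction_image csum_coact_inl v).1 (coaction_image csum_coact_inr w).1.
by rewrite (coaction_image csum_coact_inl v).2 (coaction_image csum_coact_inr w).2.
Qed.

Definition csum : comod G := Comod csum_coactP.

Definition cinl : chom V csum := @Chom _ _ V csum (pinl V W) csum_coact_inl.
Definition cinr : chom W csum := @Chom _ _ W csum (pinr V W) csum_coact_inr.

Lemma cfst_subproof (p : csum) : coact V (pfst V W p) = tmap (pfst V W) idfun (coact csum p).
Proof.
rewrite [coact csum p]csum_coactE linearD (tmap_comp (h := idfun) (k := idfun)) // tmap_id //.
have e (x : tensor W H) : tmap (pfst V W) idfun (tmap (pinr V W) idfun x) = 0.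
  elim/tens_ind: x => [w h|x y hx hy]; last by rewrite !linearD hx hy addr0.
  by rewrite !tmapE -(linear0 (tensl V h)).
by rewrite e addr0.
Qed.
Lemma csnd_subproof (p : csum) : coact W (psnd V W p) = tmap (psnd V W) idfun (coact csum p).
Proof.
rewrite [coact csum p]csum_coactE linearD [X in _ + X](tmap_comp (h := idfun) (k := idfun)) // tmap_id //.
have e (x : tensor V H) : tmap (psnd V W) idfun (tmap (pinl V W) idfun x) = 0.
  elim/tens_ind: x => [w h|x y hx hy]; last by rewrite !linearD hx hy addr0.
  by rewrite !tmapE -(linear0 (tensl W h)).
by rewrite e add0r.
Qed.

Definition cfst : chom csum V := @Chom _ _ csum V (pfst V W) cfst_subproof.
Definition csnd : chom csum W := @Chom _ _ csum W (psnd V W) csnd_subproof.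

End Comodules.

Definition vsum (V W : vect G) : vect G :=
  @Vect _ _ (csum V W) (fgproj_prod (vectP V) (vectP W)).

Definition cadd (V W : comod G) (f g : chom V W) : chom V W := clin 1 f g.

Lemma caddE (V W : comod G) (f g : chom V W) v : cadd f g v = f v + g v.
Proof. by rewrite /= scale1r. Qed.

Lemma null_coact (V W : comod G) (v : V) :
  coact W ((\0 : {linear V -> W}) v) = tmap (\0 : {linear V -> W}) idfun (coact V v).
Proof.
rewrite linear0; elim/tens_ind: (coact V v) => [w h|x y hx hy].
  by rewrite tmapE -(linear0 (tensl W h)).
by rewrite linearD -hx -hy addr0.
Qed.

Definition cnull (V W : comod G) : chom V W := Chom (@null_coact V W).

Definition ccopair (V W U : comod G) (f : chom V U) (g : chom W U) : chom (csum V W) U :=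
  cadd (ccomp f (cfst V W)) (ccomp g (csnd V W)).
Definition cpair (V W U : comod G) (f : chom U V) (g : chom U W) : chom U (csum V W) :=
  cadd (ccomp (cinl V W) f) (ccomp (cinr V W) g).

Lemma ccopairE (V W U : comod G) (f : chom V U) (g : chom W U) p :
  ccopair f g p = f p.1 + g p.2.
Proof. exact: caddE. Qed.
Lemma cpairE (V W U : comod G) (f : chom U V) (g : chom U W) u :
  cpair f g u = (f u, g u).
Proof. by rewrite [LHS]caddE [RHS]pairE. Qed.

End DirectSum.

Section QuotientModule.
Variables (R : comPzRingType) (K U : lmodType R) (i : {linear K -> U}).

Definition lq_rel (x y : U) : bool := `[< exists k, i k = x - y >].

Lemma lq_rel_refl : reflexive lq_rel.
Proof. by move=> x; apply/asboolP; exists 0; rewrite linear0 subrr. Qed.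
Lemma lq_rel_sym : symmetric lq_rel.
Proof.
by move=> x y; apply/asboolP/asboolP => -[k e]; exists (- k); rewrite linearN e opprB.
Qed.
Lemma lq_rel_trans : transitive lq_rel.
Proof.
move=> y x z /asboolP[k e] /asboolP[l f]; apply/asboolP; exists (k + l).
by rewrite linearD e f addrA subrK.
Qed.

Canonical lq_equiv := EquivRel lq_rel lq_rel_refl lq_rel_sym lq_rel_trans.

(** The cokernel of i. *)
Definition lquot : Type := {eq_quot lq_rel}.
HB.instance Definition _ := Choice.on lquot.
HB.instance Definition _ := Quotient.on lquot.

Definition lqpi (x : U) : lquot := \pi_lquot x.

Lemma lqpiP x y : lqpi x = lqpi y <-> exists k, i k = x - y.
Proof.
split; first by move=> /eqmodP /asboolP.
by move=> h; apply/eqmodP/asboolP.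
Qed.

Lemma lqpi_repr (q : lquot) : lqpi (repr q) = q.
Proof. exact: reprK. Qed.

Lemma repr_lqpi x : exists k, i k = repr (lqpi x) - x.
Proof. by apply/lqpiP; rewrite lqpi_repr. Qed.

Definition lq_add (p q : lquot) : lquot := lqpi (repr p + repr q).
Definition lq_scale (a : R) (p : lquot) : lquot := lqpi (a *: repr p).

Lemma lq_addE x y : lq_add (lqpi x) (lqpi y) = lqpi (x + y).
Proof.
apply/lqpiP; have [[k e] [l f]] := (repr_lqpi x, repr_lqpi y).
by exists (k + l); rewrite linearD e f opprD addrACA.
Qed.
Lemma lq_scaleE a x : lq_scale a (lqpi x) = lqpi (a *: x).
Proof.
apply/lqpiP; have [k e] := repr_lqpi x.
by exists (a *: k); rewrite linearZ /= e scalerBr.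
Qed.

Lemma lq_ind (Q : lquot -> Prop) : (forall x, Q (lqpi x)) -> forall q, Q q.
Proof. by move=> h q; rewrite -[q]lqpi_repr. Qed.

Fact lq_addA : associative lq_add.
Proof.
move=> p q r; elim/lq_ind: p => x; elim/lq_ind: q => y; elim/lq_ind: r => z.
by rewrite !lq_addE addrA.
Qed.
Fact lq_addC : commutative lq_add.
Proof.
by move=> p q; elim/lq_ind: p => x; elim/lq_ind: q => y; rewrite !lq_addE addrC.
Qed.
Fact lq_add0 : left_id (lqpi 0) lq_add.
Proof. by move=> p; elim/lq_ind: p => x; rewrite lq_addE add0r. Qed.
Fact lq_addN : left_inverse (lqpi 0) (lq_scale (-1)) lq_add.
Proof.
by move=> p; elim/lq_ind: p => x; rewrite lq_scaleE lq_addE scaleN1r addNr.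
Qed.
HB.instance Definition _ := GRing.isZmodule.Build lquot lq_addA lq_addC lq_add0 lq_addN.

Fact lq_scaleA a b p : lq_scale a (lq_scale b p) = lq_scale (a * b) p.
Proof. by elim/lq_ind: p => x; rewrite !lq_scaleE scalerA. Qed.
Fact lq_scale1 : left_id 1 lq_scale.
Proof. by move=> p; elim/lq_ind: p => x; rewrite lq_scaleE scale1r. Qed.
Fact lq_scaleDr : right_distributive lq_scale +%R.
Proof.
move=> a p q; elim/lq_ind: p => x; elim/lq_ind: q => y.
by rewrite [_ + _]lq_addE !lq_scaleE [RHS]lq_addE scalerDr.
Qed.
Fact lq_scaleDl p : {morph lq_scale^~ p : a b / a + b}.
Proof.
by move=> a b; elim/lq_ind: p => x; rewrite !lq_scaleE [RHS]lq_addE scalerDl.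
Qed.
HB.instance Definition _ :=
  GRing.Zmodule_isLmodule.Build R lquot lq_scaleA lq_scale1 lq_scaleDr lq_scaleDl.

Lemma lqproj_linear : linear lqpi.
Proof. by move=> a x y; rewrite -[RHS]/(lq_add (lq_scale a _) _) lq_scaleE lq_addE. Qed.

Definition lqproj : {linear U -> lquot} := mklin lqproj_linear.

Lemma lqproj_surj : surj lqproj.
Proof. by move=> q; exists (repr q); rewrite [LHS]lqpi_repr. Qed.

Lemma lqproj_eq0 x : lqproj x = 0 <-> exists k, i k = x.
Proof. by have := lqpiP x 0; rewrite subr0. Qed.

Section Lift.
Variables (P : lmodType R) (f : {linear U -> P}) (fi : forall k, f (i k) = 0).

Lemma lqlift_pi x : f (repr (lqpi x)) = f x.
Proof.
have [k e] := repr_lqpi x.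
by apply/eqP; rewrite -subr_eq0 -linearB -e fi.
Qed.

Lemma lqlift_linear : linear (fun q : lquot => f (repr q)).
Proof.
move=> a p q; have [x <-] := lqproj_surj p; have [y <-] := lqproj_surj q.
by rewrite -linearP /= !lqlift_pi linearP.
Qed.

Lemma lqlift_subproof : {g : {linear lquot -> P} | forall x, g (lqproj x) = f x}.
Proof. by exists (mklin lqlift_linear) => x; rewrite /= lqlift_pi. Qed.

Definition lqlift : {linear lquot -> P} := sval lqlift_subproof.

Lemma lqliftE x : lqlift (lqproj x) = f x.
Proof. by rewrite /lqlift; case: lqlift_subproof. Qed.
End Lift.

End QuotientModule.

Section Kernel.
Variables (R : comPzRingType) (V W : lmodType R) (g : {linear V -> W}).

Definition lker_pred : {pred V} := fun v => `[< g v = 0 >].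

Lemma lker_submod_closed : submod_closed lker_pred.
Proof.
split=> [|a x y /asboolP hx /asboolP hy]; apply/asboolP; first exact: linear0.
by rewrite linearP hx hy scaler0 addr0.
Qed.

HB.instance Definition _ := GRing.isSubmodClosed.Build R V lker_pred lker_submod_closed.

Record lker : Type := LKer { lker_val : V; lker_valP : lker_val \in lker_pred }.

HB.instance Definition _ := [isSub for lker_val].
HB.instance Definition _ := [Choice of lker by <:].
HB.instance Definition _ := [SubChoice_isSubLmodule of lker by <:].

Lemma lker_incl_linear : linear (fun k : lker => val k). Proof. by []. Qed.
Definition lker_incl : {linear lker -> V} := mklin lker_incl_linear.

Lemma lker_incl_inj : injective lker_incl. Proof. exact: val_inj. Qed.
Lemma lker_inclP k : g (lker_incl k) = 0. Proof. exact/asboolP/lker_valP. Qed.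
Lemma lker_incl_onto v : g v = 0 -> exists k, lker_incl k = v.
Proof. by move=> h; exists (LKer (asboolT h)). Qed.

(** Flatness of N gives exactness of K (x) N -> V (x) N -> W (x) N, K the kernel of g:
    V/K embeds into W, hence V/K (x) N into W (x) N, and the tensor product is right
    exact. *)
Lemma flat_kernel (N : lmodType R) (x : tensor V N) :
  flat N -> tmap g idfun x = 0 -> exists z, tmap lker_incl idfun z = x.
Proof.
move=> flN gx.
pose Q : lmodType R := lquot lker_incl.
pose q : {linear Q -> W} := lqlift lker_inclP.
have q_inj : injective q.
  move=> s t; have [v <-] := lqproj_surj s; have [w <-] := lqproj_surj t.
  rewrite !lqliftE => e; apply/eqP; rewrite -subr_eq0 -linearB; apply/eqP/lqproj_eq0.
  by apply: lker_incl_onto; rewrite linearB e subrr.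
pose T : lmodType R := lquot (tmap lker_incl (idfun : {linear N -> N})).
have kill (n : N) k : (lqproj _ \o tensl V n : {linear V -> T}) (lker_incl k) = 0.
  by apply/lqproj_eq0; exists (k *t n); rewrite tmapE.
have bil : bilin (fun (s : Q) (n : N) => lqlift (kill n) s : T).
  split=> [n|s] a u v; first exact: linearP.
  by have [w <-] := lqproj_surj s; rewrite !lqliftE -[LHS]/(lqproj _ (w *t (a *: u + v))) tensDr tensZr linearP.
have piT y : tlift bil (tmap (lqproj _) idfun y) = lqproj _ y.
  elim/tens_ind: y => [v n|y z hy hz]; last by rewrite !linearD hy hz.
  by rewrite tmapE tliftE lqliftE.
have x0 : tmap (lqproj lker_incl) (idfun : {linear N -> N}) x = 0.
  apply: (flN _ _ q q_inj); rewrite linear0 -gx.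
  by rewrite (tmap_comp (h := g) (k := idfun)) // => v; apply: lqliftE.
by apply/lqproj_eq0; rewrite -piT x0 linear0.
Qed.

End Kernel.

Section KernelComodule.
Variables (R : comPzRingType) (G : affgrp R) (Gflat : flat (gfun G)).
Variables (V W : comod G) (g : chom V W).
Local Notation H := (gfun G).
Local Notation K := (lker g).
Local Notation incl := (lker_incl g).

(** The coaction of V maps K into the kernel of V (x) R[G] -> W (x) R[G], which is
    K (x) R[G] by flatness. *)
Lemma ker_coact_subproof :
  {d : {linear K -> tensor K H} | forall k, tmap incl idfun (d k) = coact V (incl k)}.
Proof.
have inj : injective (tmap incl (idfun : {linear H -> H})).
  by apply: Gflat; apply: lker_incl_inj.
have ex k : exists z, tmap incl idfun z = coact V (incl k).
  by apply: flat_kernel => //; rewrite -chomP lker_inclP linear0.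
apply: boolp.cid; have [d hd] := choice ex.
have dlin : linear d by move=> a x y; apply: inj; rewrite linearP !hd !linearP.
by exists (mklin dlin).
Qed.

Definition ker_coact : {linear K -> tensor K H} := sval ker_coact_subproof.

Lemma ker_coactE k : tmap incl idfun (ker_coact k) = coact V (incl k).
Proof. by rewrite /ker_coact; case: ker_coact_subproof. Qed.

Lemma tassoc_incl (x : tensor (tensor K H) H) :
  tmap incl idfun (tassoc K H H x) = tassoc V H H (tmap (tmap incl idfun) idfun x).
Proof.
elim/tens_ind: x => [x h|x y hx hy]; last by rewrite !linearD hx hy.
elim/tens_ind: x => [x k|x y hx hy]; last by rewrite !(linearD, tensDl) hx hy.
by rewrite !tassocE !tmapE tassocE.
Qed.

Lemma ker_coactP : is_coaction ker_coact.
Proof.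
split=> k.
  apply: lker_incl_inj; rewrite -[RHS]((coactP V).1) -ker_coactE.
  elim/tens_ind: (ker_coact k) => [w h|x y hx hy]; last by rewrite !linearD hx hy.
  by rewrite !tmapE !tridE linearZ.
have inj2 : injective (tmap incl (idfun : {linear tensor H H -> tensor H H})).
  move=> x y; rewrite -(tassocIK x) -(tassocIK y) !tassoc_incl => e; congr (tassoc _ _ _ _).
  apply: (Gflat (Gflat (@lker_incl_inj _ _ _ g))).
  exact: (can_inj (@tassocK _ V H H)).
apply: inj2; rewrite tassoc_incl.
pose id2 : {linear H -> H} := idfun.
transitivity (tassoc V H H (tmap (coact V) id2 (tmap incl id2 (ker_coact k)))).
  congr (tassoc V H H _).
  elim/tens_ind: (ker_coact k) => [w h|x y hx hy]; last by rewrite !linearD hx hy.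
  by rewrite !tmapE ker_coactE.
rewrite ker_coactE (coactP V).2 -ker_coactE.
elim/tens_ind: (ker_coact k) => [w h|x y hx hy]; last by rewrite !linearD hx hy.
by rewrite !tmapE.
Qed.

Definition cker : comod G := Comod ker_coactP.

Lemma ker_incl_subproof (k : cker) : coact V (incl k) = tmap incl idfun (coact cker k).
Proof. by rewrite ker_coactE. Qed.

Definition cker_incl : chom cker V := @Chom _ _ cker V incl ker_incl_subproof.

End KernelComodule.

Section CokernelComodule.
Variables (R : comPzRingType) (G : affgrp R) (K U : comod G) (i : chom K U).
Local Notation H := (gfun G).
Local Notation proj := (lqproj i).

Lemma coker_coact_kill k : (tmap proj idfun \o coact U) (i k) = 0.
Proof.
rewrite /= chomP; elim/tens_ind: (coact K k) => [x h|x y hx hy].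
  rewrite !tmapE; have -> : proj (i x) = 0 by apply/lqproj_eq0; exists x.
  exact: (linear0 (tensl _ h)).
by rewrite !linearD hx hy addr0.
Qed.

Definition coker_coact : {linear lquot i -> tensor (lquot i) H} :=
  lqlift coker_coact_kill.

Lemma coker_coactE u : coker_coact (proj u) = tmap proj idfun (coact U u).
Proof. exact: lqliftE. Qed.

Lemma coker_coactP : is_coaction coker_coact.
Proof.
by split=> q; have [u <-] := lqproj_surj q;
  have [] := coaction_image coker_coactE u.
Qed.

Definition ccoker : comod G := Comod coker_coactP.
Definition ccoker_proj : chom U ccoker := @Chom _ _ U ccoker proj coker_coactE.

End CokernelComodule.

(** * Consequences of the resolution property *)

Section Resolution.
Variables (R : comPzRingType) (G : affgrp R) (Gflat : flat (gfun G)).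
Variable Gres : resolution_property G.
Local Notation H := (gfun G).

(** An element of a direct sum of objects of Vect covering N comes from finitely many of
    the summands, whose own direct sum is in Vect. *)
Lemma resolve (N : comod G) (n : N) : exists (U : vect G) (f : chom U N) (u : U), f u = n.
Proof.
have [I [V [p psurj]]] := Gres N; have [x <-] := psurj n.
suff [U [f [u <-]]] : exists (U : vect G) (f : chom U (cdsum (fun i => vcomod (V i)))) (u : U),
    f u = x by exists U, (ccomp p f), u.
elim/dsum_ind: x => [|i v|x y [U [f [u <-]]] [W [g [w <-]]]].
- by exists (vunit G), (cnull _ _), 0.
- have hj (w : V i) : coact (cdsum (fun i => vcomod (V i))) (dinj (fun i => V i) i w) =
      tmap (dinj (fun i => V i) i) idfun (coact (V i) w).
    exact: cdsum_coactE.
  by exists (V i), (@Chom _ _ (V i) (cdsum (fun i => vcomod (V i))) _ hj), v.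
- by exists (vsum U W), (ccopair f g), (u, w); rewrite ccopairE.
Qed.

Lemma resolve_kernel (V N : comod G) (g : chom V N) (v : V) :
  g v = 0 -> exists (U : vect G) (p : chom U V) (u : U), p u = v /\ forall t, g (p t) = 0.
Proof.
move=> /lker_incl_onto[k hk].
have [U [q [u qu]]] := resolve (N := cker Gflat g) k.
exists U, (ccomp (cker_incl Gflat g) q), u; split=> [|t]; last exact: lker_inclP.
by rewrite -hk -qu.
Qed.

End Resolution.

Section CoResolution.
Variables (R : comPzRingType) (G : affgrp R) (Gflat : flat (gfun G)).
Variable Gres : resolution_property G.
Local Notation H := (gfun G).

(** This is [resolve], since a morphism V^* -> N amounts to an invariant of V (x) N. *)
Lemma resolve_tensor (N : comod G) (n : N) : exists (V : vect G) (x : tensor V N) (xi : lform V),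
  invariant (x : ctens V N) /\ hat x xi = n.
Proof.
have [U [f [u <-]]] := resolve Gres n.
exists (vdual U), (hom_tensor f), (leval u : lform (vdual U)); split.
  exact: hom_tensor_invariant.
exact: leval_hom_tensor.
Qed.

(** Lift xi to an object of Vect mapping to the kernel of the morphism V^* -> N given by
    x, and transpose. *)
Lemma annihilate_tensor (V : vect G) (N : comod G) (x : tensor V N) (xi : lform V) :
  invariant (x : ctens V N) -> hat x xi = 0 ->
  exists (U : vect G) (f : chom V U) (zeta : lform U),
    (forall v, lform_fun zeta (f v) = lform_fun xi v) /\ tmap f (idfun : {linear N -> N}) x = 0.
Proof.
move=> hx x0.
have [U [p [u [pu gp]]]] := resolve_kernel Gflat Gres (g := hat_hom hx) x0.
exists (vdual U), (transpose p), (leval u : lform (vdual U)); split=> [v|].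
  by rewrite [LHS]transposeE pu.
apply: (leval_ext (vectP U)) => t; rewrite linear0.
rewrite (cont_tmap (xi := lform_fun (p t))) //; exact: gp.
Qed.

(** The same argument for a form that vanishes on the image of a morphism of Vect. *)
Lemma annihilate_hom (K V : vect G) (h : chom K V) (xi : lform V) :
  (forall k, lform_fun xi (h k) = 0) ->
  exists (U : vect G) (f : chom V U) (zeta : lform U),
    (forall v, lform_fun zeta (f v) = lform_fun xi v) /\ (forall k, f (h k) = 0).
Proof.
move=> x0; have x0' : lpull_hom h xi = 0 by apply: lform_ext => k; exact: x0.
have [U [p [u [pu gp]]]] := resolve_kernel Gflat Gres x0'.
exists (vdual U), (transpose p), (leval u : lform (vdual U)); split=> [v|k].
  by rewrite [LHS]transposeE pu.
apply: lform_ext => t; rewrite transposeE.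
by have := congr1 (fun eta : lform K => lform_fun eta k) (gp t).
Qed.

(** The morphisms given for the several forms are paired into a direct sum. K stands for
    what else is wanted of them, and need only be stable under pairing. *)
Lemma gather (V : vect G) (K : forall U : vect G, chom V U -> Prop) (s : seq (lform V)) :
  K (vunit G) (cnull V (vunit G)) ->
  (forall (U W : vect G) (f : chom V U) (g : chom V W),
    K U f -> K W g -> K (vsum U W) (cpair f g)) ->
  (forall xi, xi \in s -> exists (U : vect G) (f : chom V U) (zeta : lform U),
    (forall v, lform_fun zeta (f v) = lform_fun xi v) /\ K U f) ->
  exists (U : vect G) (f : chom V U), K U f /\
    forall xi, xi \in s -> exists zeta : lform U, forall v, lform_fun zeta (f v) = lform_fun xi v.
Proof.
move=> K0 K2; elim: s => [|xi s ih] h; first by exists (vunit G), (cnull V (vunit G)).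
have [U [f [Kf hf]]] := ih (fun eta he => h eta (@mem_behead _ (xi :: s) eta he)).
have [W [g [zeta [hz Kg]]]] := h xi (mem_head _ _).
exists (vsum U W), (cpair f g); split=> [|eta]; first exact: K2.
rewrite inE => /orP[/eqP->|/hf[eta' he]].
  exists (zeta \o psnd U W : lform (vsum U W)) => v.
  by rewrite cpairE; exact: hz.
exists (eta' \o pfst U W : lform (vsum U W)) => v.
by rewrite cpairE; exact: he.
Qed.

End CoResolution.

(** * Split exact sequences *)

Section Splitting.
Variables (R : comPzRingType) (G : affgrp R).
Local Notation H := (gfun G).

Lemma fgproj_retract (U Q : lmodType R) (p : {linear U -> Q}) (s : {linear Q -> U}) :
  (forall q, p (s q) = q) -> fgproj U -> fgproj Q.
Proof.
move=> ps /fgprojP[I [v [c e]]]; apply/fgprojP.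
exists I, (fun i => p (v i)), (fun i => c i \o s) => q.
rewrite -{1}[q]ps {1}[s q]e linear_sum; apply: eq_bigr => i _.
by rewrite linearZ.
Qed.

(** With v_i the basis vectors and zeta_i the factored forms, the retraction is
    u |-> sum_i zeta_i(u) v_i. *)
Lemma retraction_of_forms (V U : vect G) (f : chom V U) (b : dual_basis V) :
  (forall i, exists zeta : lform U, forall v, lform_fun zeta (f v) = dbc b i v) ->
  exists r : {linear U -> V}, forall v, r (f v) = v.
Proof.
move=> /choice[z hz].
have lin : linear (fun u : U => \sum_i (lform_fun (z i) u : R) *: dbv b i).
  move=> a x y; rewrite scaler_sumr -big_split; apply: eq_bigr => i _ /=.
  by rewrite linearP scalerDl scalerA.
exists (mklin lin) => v /=; rewrite [RHS](dbP b v).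
by apply: eq_bigr => i _; rewrite hz.
Qed.

(** The retraction makes the cokernel a linear direct summand of U, so that it is again
    finitely generated projective. *)
Lemma split_mono_exact (V U : vect G) (f : chom V U) (r : {linear U -> V}) :
  (forall v, r (f v) = v) -> exists (Q : vect G) (k : chom U Q), short_exact f k.
Proof.
move=> rf.
have slin : linear (fun u : U => u - f (r u)).
  by move=> a x y; rewrite (linearP r) (linearP f) opprD addrACA scalerBr.
have kill v : mklin slin (f v) = 0 by rewrite /= rf subrr.
have ps q : lqproj f (lqlift kill q) = q.
  have [u <-] := lqproj_surj q; rewrite lqliftE; apply/lqpiP; exists (- r u).
  by rewrite linearN addrAC subrr sub0r.
exists (@Vect _ _ (ccoker f) (fgproj_retract ps (vectP U))), (ccoker_proj f).
split; [exact: (can_inj rf) | exact: lqproj_eq0 | exact: lqproj_surj].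
Qed.

Lemma short_exact_split (V' V V'' : lmodType R) (i : {linear V' -> V}) (p : {linear V -> V''}) :
  projective V'' -> short_exact i p ->
  exists (r : {linear V -> V'}) (s : {linear V'' -> V}),
    [/\ forall v, r (i v) = v, forall v, p (s v) = v & forall v, i (r v) + s (p v) = v].
Proof.
move=> pr [inj ker sur]; have [s ps] := pr _ _ p idfun sur.
have ex v : exists w, i w = v - s (p v) by apply/ker; rewrite linearB ps subrr.
have [r hr] := choice ex.
have rlin : linear r.
  by move=> a x y; apply: inj; rewrite (linearP i) !hr (linearP p) (linearP s) scalerBr opprD addrACA.
exists (mklin rlin), s; split=> // v /=; last by rewrite hr subrK.
apply: inj; rewrite hr; have -> : p (i v) = 0 by apply/ker; exists v.
by rewrite linear0 subr0.
Qed.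

Lemma tensor_short_exact (N V' V V'' : lmodType R) (i : {linear V' -> V})
    (p : {linear V -> V''}) : projective V'' -> short_exact i p ->
  short_exact (tmap i (idfun : {linear N -> N})) (tmap p (idfun : {linear N -> N})).
Proof.
move=> pr ex; have [r [s [ri ps irsp]]] := short_exact_split pr ex.
have [_ ker _] := ex.
have ri' x : tmap r idfun (tmap i (idfun : {linear N -> N}) x) = x.
  by rewrite (tmap_comp (h := idfun) (k := idfun)) // tmap_id.
have ps' x : tmap p idfun (tmap s (idfun : {linear N -> N}) x) = x.
  by rewrite (tmap_comp (h := idfun) (k := idfun)) // tmap_id.
split; first exact: (can_inj ri'); last by move=> y; exists (tmap s idfun y).
move=> y; split=> [py|[x <-]].
  exists (tmap r idfun y).
  transitivity (tmap i idfun (tmap r idfun y) +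
      tmap s (idfun : {linear N -> N}) (tmap p idfun y)); first by rewrite py linear0 addr0.
  elim/tens_ind: y {py} => [v n|y z hy hz]; first by rewrite !tmapE /= -tensDl irsp.
  by rewrite !linearD addrACA hy hz.
elim/tens_ind: x => [v n|s1 s2 hy hz]; last by rewrite !linearD hy hz addr0.
rewrite !tmapE; have -> : p (i v) = 0 by apply/ker; exists v.
exact: (linear0 (tensl _ _)).
Qed.

End Splitting.

(** * The functors of invariants: left exactness, full faithfulness *)

Section GammaLeftExact.
Variables (R A : comPzRingType) (phi : {rmorphism R -> A}) (G : affgrp R).
Local Notation H := (gfun G).

Lemma gamma_morE (M : acomod phi G) (V W : vect G) (f : chom V W) (x : fmod (gamma_add M) V) :
  gval (fmor (gamma_add M) f x) = tmap f idfun (gval x).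
Proof. by rewrite [LHS]ginv_mapE; apply: eq_tmap. Qed.

(** Short exact sequences of Vect split linearly, so stay exact after tensoring with M,
    and invariants are a kernel. *)
Lemma gamma_left_exact (M : acomod phi G) : left_exact (gamma_add M).
Proof.
move=> V' V V'' i p ex; have pr := (vectP V'').2.
have [inj ker _] := tensor_short_exact (restr phi M) pr ex.
have [r [_ [ri _ _]]] := short_exact_split pr ex.
split=> [x y e|y]; first by apply/gval_inj/inj; rewrite -!gamma_morE e.
split=> [py|[x <-]]; last first.
  apply: gval_inj; rewrite !gamma_morE; apply/ker; by exists (gval x).
have /ker[z ez] : tmap p (idfun : {linear restr phi M -> _}) (gval y) = 0.
  by rewrite -gamma_morE py.
suff hz : invariant (z : ctens V' (ares M)).
  by exists (mkginv hz); apply: gval_inj; rewrite gamma_morE gval_mk.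
pose ix : chom (ctens V' (ares M)) (ctens V (ares M)) := ctmap i (cid (ares M)).
have rix : cancel (tmap ix (idfun : {linear H -> H}))
    (tmap (tmap r (idfun : {linear restr phi M -> restr phi M})) idfun).
  move=> t; rewrite (tmap_comp (h := idfun) (k := idfun)) ?tmap_id // => u /=.
  by rewrite (tmap_comp (h := idfun) (k := idfun)) // tmap_id.
apply: (can_inj rix); rewrite -chomP tmapE.
by have := gvalP y; rewrite -ez.
Qed.

End GammaLeftExact.

Section GammaFullyFaithful.
Variables (R A : comPzRingType) (phi : {rmorphism R -> A}) (G : affgrp R).
Variables (Gflat : flat (gfun G)) (Gres : resolution_property G).
Local Notation H := (gfun G).

(** Contraction of invariants of V (x) M with forms on V, with values in the A-module M. *)
Definition ghat (V : vect G) (M : acomod phi G) (x : fmod (gamma_add M) V) (xi : lform V) : M :=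
  hat (gval x) xi.

Lemma ghatP (V : vect G) (M : acomod phi G) (a : A) (x y : fmod (gamma_add M) V) xi :
  ghat (a *: x + y) xi = a *: ghat x xi + ghat y xi.
Proof.
rewrite /ghat gvalD hatD gvalZ; congr (_ + _).
by apply: (cont_tmap (zeta := lform_fun xi) (f := idfun) (restr_act phi M a)).
Qed.

Lemma ghat0 (V : vect G) (M : acomod phi G) xi : ghat (0 : fmod (gamma_add M) V) xi = 0.
Proof.
have := ghatP (-1) (0 : fmod (gamma_add M) V) 0 xi.
by rewrite scaler0 addr0 scaleN1r addNr.
Qed.

Lemma ghat_mor (M : acomod phi G) (V W : vect G) (f : chom V W) (x : fmod (gamma_add M) V)
    (zeta : lform W) : ghat (fmor (gamma_add M) f x) zeta = ghat x (lpull f zeta).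
Proof.
rewrite /ghat gamma_morE !hat_cont; exact: (cont_lpull (N := restr phi M)).
Qed.

Lemma ghat_ext (M : acomod phi G) (V : vect G) (x y : fmod (gamma_add M) V) :
  ghat x =1 ghat y -> x = y.
Proof. by move=> e; apply/gval_inj/(hat_inj (vectP V)). Qed.

Lemma ghat_map (M N : acomod phi G) (u : ahom M N) (V : vect G) (x : fmod (gamma_add M) V) xi :
  ghat (ncomp (gamma_add_map u) V x : fmod (gamma_add N) V) xi = u (ghat x xi).
Proof. by rewrite /ghat [gval _]ginv_mapE !hat_cont; apply: (cont_tmap (restr_map phi u)). Qed.

Lemma ghat_onto (M : acomod phi G) (m : M) :
  exists (V : vect G) (x : fmod (gamma_add M) V) (xi : lform V), ghat x xi = m.
Proof.
have [V [x [xi [hx e]]]] := resolve_tensor Gres (N := ares M) m.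
by exists V, (mkginv hx), xi.
Qed.

(** Pass to the direct sum of the two objects of Vect and add the forms. *)
Lemma ghat_onto2 (M : acomod phi G) (m n : M) :
  exists (V : vect G) (x y : fmod (gamma_add M) V) (xi : lform V), ghat x xi = m /\ ghat y xi = n.
Proof.
have [V [x [xi <-]]] := ghat_onto m; have [W [y [zeta <-]]] := ghat_onto n.
pose omega : lform (vsum V W) := (xi \o pfst V W : lform _) + (zeta \o psnd V W : lform _).
exists (vsum V W), (fmor (gamma_add M) (cinl V W : chom V (vsum V W)) x),
  (fmor (gamma_add M) (cinr V W : chom W (vsum V W)) y), omega.
rewrite !ghat_mor; split; congr (ghat _ _); apply: lform_ext => v /=.
  by rewrite [X in _ + X]linear0 addr0.
by rewrite [X in X + _]linear0 add0r.
Qed.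

Lemma nattrans_fmor (F K : functor (VectCat G) (Mod A)) (t : nattrans F K) (V W : vect G)
    (f : chom V W) (x : fmod F V) : ncomp t W (fmor F f x) = fmor K f (ncomp t V x).
Proof.
exact: (congr1 (fun g : {linear fmod F V -> fmod K W} => g x) (ntcP t (f : @arr (VectCat G) V W))).
Qed.

Section Full.
Variables (M N : acomod phi G) (t : nattrans (gamma_add M) (gamma_add N)).

(** What makes the map induced on M well defined: a contraction vanishes for a reason
    that naturality transports. *)
Lemma nattrans_ghat0 (V : vect G) (x : fmod (gamma_add M) V) xi :
  ghat x xi = 0 -> ghat (ncomp t V x : fmod (gamma_add N) V) xi = 0.
Proof.
move=> x0.
have [U [f [zeta [hz fx]]]] := annihilate_tensor Gflat Gres (gvalP x) x0.
have -> : xi = lpull f zeta by apply: lform_ext => v; rewrite -hz.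
rewrite -ghat_mor -nattrans_fmor.
have -> : fmor (gamma_add M) f x = 0 by apply: gval_inj; rewrite gamma_morE fx.
by rewrite linear0 ghat0.
Qed.

(** A natural transformation acts on the contractions of invariants, and these exhaust
    M by the resolution property. *)
Lemma nattrans_hom_subproof : {u : ahom M N |
  forall (V : vect G) (x : fmod (gamma_add M) V) xi,
    ghat (ncomp t V x : fmod (gamma_add N) V) xi = u (ghat x xi)}.
Proof.
apply: boolp.cid.
have ex (m : M) : exists n : N, forall (V : vect G) (x : fmod (gamma_add M) V) xi,
    ghat x xi = m -> ghat (ncomp t V x : fmod (gamma_add N) V) xi = n.
  have [V [x [xi e]]] := ghat_onto m; exists (ghat (ncomp t V x : fmod (gamma_add N) V) xi).
  move=> W y zeta e'.
  (* Two presentations of m differ, in the direct sum, by an invariant with zero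
     contraction. *)
  pose omega : lform (vsum V W) := (xi \o pfst V W : lform _) + (zeta \o psnd V W : lform _).
  pose x1 := fmor (gamma_add M) (cinl V W : chom V (vsum V W)) x.
  pose y1 := fmor (gamma_add M) (cinr V W : chom W (vsum V W)) y.
  have ox : lpull (cinl V W) omega = xi.
    by apply: lform_ext => v; rewrite /= [X in _ + X]linear0 addr0.
  have oy : lpull (cinr V W) omega = zeta.
    by apply: lform_ext => v; rewrite /= [X in X + _]linear0 add0r.
  have : ghat (-1 *: x1 + y1) omega = 0.
    by rewrite ghatP !ghat_mor ox oy e e' scaleN1r addNr.
  move/nattrans_ghat0; rewrite linearP ghatP !nattrans_fmor !ghat_mor ox oy scaleN1r addrC.
  by move/eqP; rewrite subr_eq0 => /eqP.
have [u hu] := choice ex.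
have ulin : linear u.
  move=> a m n; have [V [x [y [xi [<- <-]]]]] := ghat_onto2 m n.
  by rewrite -ghatP -!(hu _ V _ xi erefl) linearP ghatP.
have uhom (m : M) :
    acoact N (mklin ulin m) = tmap (restr_map phi (mklin ulin)) idfun (acoact M m).
  have [V [x [xi <-]]] := ghat_onto m.
  rewrite /= -(hu _ V x xi erefl).
  rewrite [LHS](hat_hom_subproof (gvalP (ncomp t V x : fmod (gamma_add N) V)) xi).
  rewrite [acoact M _](hat_hom_subproof (gvalP x) xi).
  rewrite (tmap_comp (h := hat (gval (ncomp t V x : fmod (gamma_add N) V))) (k := idfun)) //.
  by move=> eta; symmetry; exact: (hu _ V x eta erefl).
by exists (Ahom uhom) => V x xi /=; exact: hu.
Qed.

Definition nattrans_hom : ahom M N := sval nattrans_hom_subproof.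

Lemma nattrans_homE (V : vect G) (x : fmod (gamma_add M) V) xi :
  ghat (ncomp t V x : fmod (gamma_add N) V) xi = nattrans_hom (ghat x xi).
Proof. exact: (svalP nattrans_hom_subproof). Qed.

Lemma nattrans_homK : gamma_add_map nattrans_hom = t.
Proof.
apply: nattrans_eq => V x; apply: ghat_ext => xi.
by rewrite ghat_map nattrans_homE.
Qed.

End Full.

Lemma gamma_add_map_inj (M N : acomod phi G) (u v : ahom M N) :
  gamma_add_map u = gamma_add_map v -> u =1 v.
Proof.
move=> e m; have [V [x [xi <-]]] := ghat_onto m.
by rewrite -!ghat_map e.
Qed.

Theorem GammaAdd_fully_faithful : fully_faithful (GammaAdd phi G).
Proof.
move=> M N; exists (@nattrans_hom M N) => [u|t]; last exact: nattrans_homK.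
by apply/ahom_ext/gamma_add_map_inj; rewrite nattrans_homK.
Qed.

End GammaFullyFaithful.

(** * The comodule attached to a functor *)

Section AdditiveFunctors.
Variables (R A : comPzRingType) (phi : {rmorphism R -> A}) (G : affgrp R) (F : qadd phi G).

Lemma fmor_comp (U V W : vect G) (g : chom V W) (f : chom U V) (x : fmod F U) :
  fmor F (ccomp g f) x = fmor F g (fmor F f x).
Proof.
exact: (congr1 (fun h : {linear fmod F U -> fmod F W} => h x)
  (@fmap_comp _ _ F U V W (g : @arr (VectCat G) V W) (f : @arr (VectCat G) U V))).
Qed.

Lemma fmor_id (V : vect G) (x : fmod F V) : fmor F (cid V) x = x.
Proof.
exact: (congr1 (fun h : {linear fmod F V -> fmod F V} => h x) (@fmap_id _ _ F V)).
Qed.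

Lemma eq_fmor (V W : vect G) (f g : chom V W) (x : fmod F V) :
  f =1 g -> fmor F f x = fmor F g x.
Proof. by move=> /chom_ext->. Qed.

Lemma fmor_lin (V W : vect G) (r : R) (f g : chom V W) (x : fmod F V) :
  fmor F (clin r f g) x = phi r *: fmor F f x + fmor F g x.
Proof. exact: qa_lin. Qed.

Lemma fmor_add (V W : vect G) (f g : chom V W) (x : fmod F V) :
  fmor F (cadd f g) x = fmor F f x + fmor F g x.
Proof. by rewrite fmor_lin rmorph1 scale1r. Qed.

Lemma fmor_null (V W : vect G) (f : chom V W) (x : fmod F V) :
  (forall v, f v = 0) -> fmor F f x = 0.
Proof.
move=> f0; have -> : fmor F f x = fmor F (clin (-1) f f) x.
  by apply: eq_fmor => v; rewrite f0 /= f0 scaler0 addr0.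
by rewrite fmor_lin rmorphN1 scaleN1r addNr.
Qed.

End AdditiveFunctors.

(** Vect has a small skeleton: an object is determined up to isomorphism by the matrix
    of its coaction in the generators of a dual basis (the counit recovers from it the
    idempotent matrix of the module). This is what allows a colimit over all of Vect
    to be formed among the modules. *)
Section Codes.
Variables (R : comPzRingType) (G : affgrp R).

Definition code : Type := {n : nat & 'M[gring G]_n}.

Definition has_code (c : code) (V : vect G) : Prop :=
  exists (v : 'I_(tag c) -> V) (xi : 'I_(tag c) -> lform V),
    (forall x, x = \sum_i (lform_fun (xi i) x : R) *: v i) /\
    (forall i j, mcoef (xi j) (v i) = tagged c i j).

Lemma code_exists (V : vect G) : exists c, has_code c V.
Proof.
have [I v xi e] := vbasis V.
exists (existT (fun n => 'M[gring G]_n) #|I|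
  (\matrix_(i, j) (mcoef (xi (enum_val j) : lform V) (v (enum_val i)) : gring G))).
exists (fun i => v (enum_val i)), (fun i => xi (enum_val i)); split=> [x|i j] /=.
  by rewrite [LHS]e (reindex _ (onW_bij _ (enum_val_bij I))).
by rewrite mxE.
Qed.

Lemma same_code (c : code) (V W : vect G) : has_code c V -> has_code c W ->
  exists (f : chom V W) (g : chom W V), forall v, g (f v) = v.
Proof.
have key (P Q : vect G) (p : 'I_(tag c) -> P) (xi : 'I_(tag c) -> lform P)
    (q : 'I_(tag c) -> Q) (zeta : 'I_(tag c) -> lform Q) :
  (forall x, x = \sum_i (lform_fun (xi i) x : R) *: p i) ->
  (forall i j, mcoef (xi j) (p i) = tagged c i j) ->
  (forall x, x = \sum_i (lform_fun (zeta i) x : R) *: q i) ->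
  (forall i j, mcoef (zeta j) (q i) = tagged c i j) ->
  exists f : chom P Q, forall i, f (p i) = q i.
  move=> ep hp eq hq.
  have lin : linear (fun x : P => \sum_i (lform_fun (xi i) x : R) *: q i).
    move=> a x y; rewrite scaler_sumr -big_split; apply: eq_bigr => i _ /=.
    by rewrite linearP scalerDl scalerA.
  have [f fE] : {f : {linear P -> Q} | forall x, f x = \sum_i (lform_fun (xi i) x : R) *: q i}.
    by exists (mklin lin).
  have fp i : f (p i) = q i.
    rewrite [RHS]eq fE; apply: eq_bigr => j _; congr (_ *: _).
    by rewrite -!counit_mcoef hp hq.
  have hom x : coact Q (f x) = tmap f idfun (coact P x).
    rewrite (ep x) !linear_sum; apply: eq_bigr => i _.
    rewrite !linearZ fp; congr (_ *: _).
    rewrite (dual_basis_tensor (DualBasis ep) (coact P (p i))) linear_sum.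
    rewrite (dual_basis_tensor (DualBasis eq) (coact Q (q i))).
    apply: eq_bigr => j _; rewrite tmapE fp.
    by rewrite -[cont _ (dbc (DualBasis eq) j) _](mcoefE (zeta j)) hq
      -[cont _ (dbc (DualBasis ep) j) _](mcoefE (xi j)) hp.
  by exists (Chom hom).
move=> [v [xi [ev hv]]] [w [zeta [ew hw]]].
have [f fv] := key _ _ _ _ _ _ ev hv ew hw; have [g gw] := key _ _ _ _ _ _ ew hw ev hv.
exists f, g => x; rewrite (ev x) !linear_sum; apply: eq_bigr => i _.
by rewrite !linearZ fv /= gw.
Qed.

Lemma code_rep_subproof (c : code) :
  {V : vect G | forall W, has_code c W -> has_code c V}.
Proof.
apply: boolp.cid; have [[V hV]|no] := pselect (exists V, has_code c V).
  by exists V.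
by exists (vunit G) => W hW; case: no; exists W.
Qed.

Definition code_rep (c : code) : vect G := sval (code_rep_subproof c).

Lemma code_repP (V : vect G) :
  exists (c : code) (f : chom V (code_rep c)) (g : chom (code_rep c) V), forall v, g (f v) = v.
Proof.
have [c hc] := code_exists V; exists c; apply: (same_code hc).
exact: (svalP (code_rep_subproof c) V).
Qed.

End Codes.

Section Colimit.
Variables (R A : comPzRingType) (phi : {rmorphism R -> A}) (G : affgrp R).
Variables (Gflat : flat (gfun G)) (Gres : resolution_property G) (F : qadd phi G).
Local Notation H := (gfun G).

Definition sform (V W : vect G) (xi : lform V) (zeta : lform W) : lform (vsum V W) :=
  (xi \o pfst V W : lform _) + (zeta \o psnd V W : lform _).

Lemma sformE (V W : vect G) (xi : lform V) (zeta : lform W) p :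
  lform_fun (sform xi zeta) p = lform_fun xi p.1 + lform_fun zeta p.2.
Proof. by []. Qed.

Lemma sform_inl (V W : vect G) (xi : lform V) (zeta : lform W) :
  lpull (cinl V W) (sform xi zeta) = xi.
Proof. by apply: lform_ext => v; rewrite /= [X in _ + X]linear0 addr0. Qed.

Lemma sform_inr (V W : vect G) (xi : lform V) (zeta : lform W) :
  lpull (cinr V W) (sform xi zeta) = zeta.
Proof. by apply: lform_ext => v; rewrite /= [X in X + _]linear0 add0r. Qed.

(** (V, xi, x) stands for the contraction along xi of the invariant of V (x) M that x in
    F V is meant to be; two triples are identified when they agree in a third one. *)
Definition ceq (V : vect G) (xi : lform V) (x : fmod F V)
    (W : vect G) (zeta : lform W) (y : fmod F W) : Prop :=
  exists (U : vect G) (f : chom V U) (g : chom W U) (eta : lform U),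
    [/\ lpull f eta = xi, lpull g eta = zeta & fmor F f x = fmor F g y].

Lemma ceq_sym (V : vect G) (xi : lform V) (x : fmod F V)
  (W : vect G) (zeta : lform W) (y : fmod F W) : ceq xi x zeta y -> ceq zeta y xi x.
Proof. by move=> [U [f [g [eta [e1 e2 e]]]]]; exists U, g, f, eta. Qed.

Lemma ceq_mor (V W : vect G) (f : chom V W) (zeta : lform W) (x : fmod F V) :
  ceq (lpull f zeta) x zeta (fmor F f x).
Proof.
by exists W, f, (cid W), zeta; split=> //; [exact: lform_ext | rewrite fmor_id].
Qed.

(** Two morphisms out of W in Vect along which a form on W extends can be completed to
    a commutative square along which it extends: this is where the resolution
    property enters the construction. *)
Lemma ceq_trans (V : vect G) (xi : lform V) (x : fmod F V)
  (W : vect G) (zeta : lform W) (y : fmod F W) (Z : vect G) (om : lform Z) (z : fmod F Z) :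
  ceq xi x zeta y -> ceq zeta y om z -> ceq xi x om z.
Proof.
move=> [U [f [g [eta [ef eg e]]]]] [U' [f' [g' [eta' [ef' eg' e']]]]].
(* The form (eta, eta') vanishes on the antidiagonal image of W in U + U'. *)
pose h : chom W (vsum U U') := cpair g (clin (-1) f' (cnull W U')).
have h0 w : lform_fun (sform eta eta') (h w) = 0.
  rewrite /h cpairE sformE /= addr0 scaleN1r linearN.
  have -> : lform_fun eta (g w) = lform_fun zeta w by rewrite -eg.
  have -> : lform_fun eta' (f' w) = lform_fun zeta w by rewrite -ef'.
  by rewrite subrr.
have [Q [k [th [ek kh]]]] := annihilate_hom Gflat Gres h0.
exists Q, (ccomp k (ccomp (cinl U U') f)), (ccomp k (ccomp (cinr U U') g')), th; split.
- rewrite -ef; apply: lform_ext => v.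
  by rewrite -[LHS]/(lform_fun th (k (cinl U U' (f v)))) ek -[in RHS](sform_inl eta eta').
- rewrite -eg'; apply: lform_ext => v.
  by rewrite -[LHS]/(lform_fun th (k (cinr U U' (g' v)))) ek -[in RHS](sform_inr eta eta').
- rewrite (@fmor_comp _ _ _ _ F V (vsum U U') Q) (@fmor_comp _ _ _ _ F V U (vsum U U')) e.
  rewrite (@fmor_comp _ _ _ _ F Z (vsum U U') Q) (@fmor_comp _ _ _ _ F Z U' (vsum U U')) -e'.
  rewrite -!fmor_comp; apply: eq_fmor => w /=.
  apply/eqP; rewrite -subr_eq0 -linearB; apply/eqP; rewrite -[RHS](kh w).
  congr (k _); rewrite /h cpairE; congr pair; rewrite /= ?subr0 // sub0r.
  by rewrite addr0 scaleN1r.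
Qed.

Definition cpoint : Type := {c : code G & (lform (code_rep c) * fmod F (code_rep c))%type}.

Definition cclass (V : vect G) (xi : lform V) (x : fmod F V) (p : cpoint) : Prop :=
  ceq xi x (tagged p).1 (tagged p).2.

Record germ_class : Type := GermClass {
  germ_set : cpoint -> Prop;
  germ_setP : exists (V : vect G) (xi : lform V) (x : fmod F V), germ_set = cclass xi x
}.

(** The two hypotheses are arguments of the type because its module structure rests on
    the transitivity of [ceq], hence on them. *)
Definition colim_of (_ : flat (gfun G)) (_ : resolution_property G) : Type := germ_class.
Local Notation colim := (colim_of Gflat Gres).

HB.instance Definition _ := gen_eqMixin colim.
HB.instance Definition _ := gen_choiceMixin colim.

Lemma germ_subproof (V : vect G) (xi : lform V) (x : fmod F V) :
  exists (W : vect G) (zeta : lform W) (y : fmod F W), cclass xi x = cclass zeta y.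
Proof. by exists V, xi, x. Qed.

Definition germ (V : vect G) (xi : lform V) (x : fmod F V) : colim :=
  GermClass (germ_subproof xi x).

Lemma germ_eq (V : vect G) (xi : lform V) (x : fmod F V)
    (W : vect G) (zeta : lform W) (y : fmod F W) :
  germ xi x = germ zeta y <-> ceq xi x zeta y.
Proof.
split=> [/(congr1 germ_set) /= e|e]; last first.
  have e' : cclass xi x = cclass zeta y.
    apply: funext => p; apply: propext; split; first exact/ceq_trans/ceq_sym.
    exact: ceq_trans.
  rewrite /germ; move: (germ_subproof xi x) (germ_subproof zeta y).
  by rewrite e' => p q; congr GermClass; exact: Prop_irrelevance.
(* Evaluate the predicates at a point isomorphic to (W, zeta, y). *)
have [c [f [g gf]]] := code_repP W.
have h : ceq zeta y (lpull g zeta) (fmor F f y).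
  have {1}-> : zeta = lpull f (lpull g zeta) by apply: lform_ext => v; rewrite /= gf.
  exact: ceq_mor.
apply: ceq_trans (ceq_sym h).
pose p : cpoint := existT (fun c => (lform (code_rep c) * fmod F (code_rep c))%type) c
  (lpull g zeta, fmor F f y).
by rewrite -[ceq _ _ _ _]/(cclass xi x p) e.
Qed.

Lemma germ_mor (V W : vect G) (f : chom V W) (zeta : lform W) (x : fmod F V) :
  germ (lpull f zeta) x = germ zeta (fmor F f x).
Proof. by apply/germ_eq/ceq_mor. Qed.

Lemma germ_onto (m : colim) : exists (V : vect G) (xi : lform V) (x : fmod F V), m = germ xi x.
Proof.
have [V [xi [x e]]] := germ_setP m; exists V, xi, x.
case: m e => s hs /= e; subst s; congr GermClass; exact: Prop_irrelevance.
Qed.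

Lemma germ_onto2 (m n : colim) : exists (V : vect G) (xi : lform V) (x y : fmod F V),
  m = germ xi x /\ n = germ xi y.
Proof.
have [V [xi [x ->]]] := germ_onto m; have [W [zeta [y ->]]] := germ_onto n.
exists (vsum V W), (sform xi zeta), (fmor F (cinl V W : chom V (vsum V W)) x),
  (fmor F (cinr V W : chom W (vsum V W)) y).
by rewrite -!germ_mor sform_inl sform_inr.
Qed.

Lemma germ_onto3 (m n p : colim) : exists (V : vect G) (xi : lform V) (x y z : fmod F V),
  [/\ m = germ xi x, n = germ xi y & p = germ xi z].
Proof.
have [V [xi [x [y [-> ->]]]]] := germ_onto2 m n; have [W [zeta [z ->]]] := germ_onto p.
exists (vsum V W), (sform xi zeta), (fmor F (cinl V W : chom V (vsum V W)) x),
  (fmor F (cinl V W : chom V (vsum V W)) y), (fmor F (cinr V W : chom W (vsum V W)) z).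
by rewrite -!germ_mor sform_inl sform_inr.
Qed.

(** Independence of the representatives: the identifications of the two summands add up
    to one between the direct sums. *)
Lemma colim_add_subproof (m n : colim) : {s : colim |
  forall (V W : vect G) (xi : lform V) (zeta : lform W) (x : fmod F V) (y : fmod F W),
  m = germ xi x -> n = germ zeta y ->
  s = germ (sform xi zeta) (fmor F (cinl V W : chom V (vsum V W)) x +
                            fmor F (cinr V W : chom W (vsum V W)) y)}.
Proof.
apply: boolp.cid.
have [V [xi [x em]]] := germ_onto m; have [W [zeta [y en]]] := germ_onto n.
exists (germ (sform xi zeta) (fmor F (cinl V W : chom V (vsum V W)) x +
                              fmor F (cinr V W : chom W (vsum V W)) y)).
move=> V' W' xi' zeta' x' y'; rewrite em en => /germ_eq[U [f [f' [eta [ef ef' e]]]]].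
move=> /germ_eq[T [g [g' [th [eg eg' d]]]]].
have key (P Q : vect G) (p : chom P U) (q : chom Q T) (a : fmod F P) (b : fmod F Q) :
    germ (sform (lpull p eta) (lpull q th))
      (fmor F (cinl P Q : chom P (vsum P Q)) a + fmor F (cinr P Q : chom Q (vsum P Q)) b) =
    germ (sform eta th) (fmor F (cinl U T : chom U (vsum U T)) (fmor F p a) +
                         fmor F (cinr U T : chom T (vsum U T)) (fmor F q b)).
  pose pq : chom (vsum P Q) (vsum U T) :=
    ccopair (ccomp (cinl U T) p : chom P (vsum U T)) (ccomp (cinr U T) q : chom Q (vsum U T)).
  have pqE z : pq z = (p z.1, q z.2).
    by rewrite [LHS]ccopairE; congr pair; rewrite /= ?addr0 ?add0r.
  have -> : sform (lpull p eta) (lpull q th) = lpull pq (sform eta th).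
    by apply: lform_ext => z; rewrite -[RHS]/(lform_fun _ (pq z)) pqE.
  rewrite germ_mor linearD -!fmor_comp; congr (germ _ (_ + _)); apply: eq_fmor => z;
    by rewrite -[LHS]/(pq _) pqE /= linear0.
by rewrite -ef -eg -ef' -eg' !key e d.
Qed.

Definition colim_add (m n : colim) : colim := sval (colim_add_subproof m n).

Lemma colim_addE (V W : vect G) (xi : lform V) (zeta : lform W) (x : fmod F V) (y : fmod F W) :
  colim_add (germ xi x) (germ zeta y) =
  germ (sform xi zeta) (fmor F (cinl V W : chom V (vsum V W)) x +
                        fmor F (cinr V W : chom W (vsum V W)) y).
Proof. exact: (svalP (colim_add_subproof _ _)). Qed.

Lemma colim_addD (V : vect G) (xi : lform V) (x y : fmod F V) :
  colim_add (germ xi x) (germ xi y) = germ xi (x + y).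
Proof.
pose nab : chom (vsum V V) V := ccopair (cid V) (cid V).
rewrite colim_addE.
have -> : sform xi xi = lpull nab xi.
  by apply: lform_ext => p; rewrite sformE /= scale1r linearD.
rewrite germ_mor linearD -!fmor_comp; congr (germ _ (_ + _)).
  by rewrite -[RHS]fmor_id; apply: eq_fmor => v /=; rewrite scale1r addr0.
by rewrite -[RHS]fmor_id; apply: eq_fmor => v /=; rewrite scale1r add0r.
Qed.

Lemma colim_scale_subproof (a : A) (m : colim) : {s : colim |
  forall (V : vect G) (xi : lform V) (x : fmod F V), m = germ xi x -> s = germ xi (a *: x)}.
Proof.
apply: boolp.cid; have [V [xi [x em]]] := germ_onto m; exists (germ xi (a *: x)).
move=> W zeta y; rewrite em => /germ_eq[U [f [g [eta [ef eg e]]]]].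
by rewrite -ef -eg !germ_mor !linearZ /= e.
Qed.

Definition colim_scale (a : A) (m : colim) : colim := sval (colim_scale_subproof a m).

Lemma colim_scaleE a (V : vect G) (xi : lform V) (x : fmod F V) :
  colim_scale a (germ xi x) = germ xi (a *: x).
Proof. exact: (svalP (colim_scale_subproof _ _)). Qed.

Definition colim_zero : colim := germ (0 : lform (vunit G)) 0.

Lemma germ_zero (V : vect G) (xi : lform V) : germ xi 0 = colim_zero.
Proof.
have -> : colim_zero = germ (lpull (cnull (vunit G) V) xi) 0.
  by congr germ; apply: lform_ext => v; rewrite /= linear0.
by rewrite germ_mor linear0.
Qed.

Fact colim_addA : associative colim_add.
Proof.
move=> m n p; have [V [xi [x [y [z [-> -> ->]]]]]] := germ_onto3 m n p.
by rewrite !colim_addD addrA.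
Qed.
Fact colim_addC : commutative colim_add.
Proof.
move=> m n; have [V [xi [x [y [-> ->]]]]] := germ_onto2 m n.
by rewrite !colim_addD addrC.
Qed.
Fact colim_add0 : left_id colim_zero colim_add.
Proof.
move=> m; have [V [xi [x ->]]] := germ_onto m.
by rewrite -(germ_zero xi) colim_addD add0r.
Qed.
Fact colim_addN : left_inverse colim_zero (colim_scale (-1)) colim_add.
Proof.
move=> m; have [V [xi [x ->]]] := germ_onto m.
by rewrite -(germ_zero xi) colim_scaleE colim_addD scaleN1r addNr.
Qed.
HB.instance Definition _ :=
  GRing.isZmodule.Build colim colim_addA colim_addC colim_add0 colim_addN.

Fact colim_scaleA a b m : colim_scale a (colim_scale b m) = colim_scale (a * b) m.
Proof. by have [V [xi [x ->]]] := germ_onto m; rewrite !colim_scaleE scalerA. Qed.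
Fact colim_scale1 : left_id 1 colim_scale.
Proof. by move=> m; have [V [xi [x ->]]] := germ_onto m; rewrite colim_scaleE scale1r. Qed.
Fact colim_scaleDr : right_distributive colim_scale +%R.
Proof.
move=> a m n; have [V [xi [x [y [-> ->]]]]] := germ_onto2 m n.
by rewrite [_ + _]colim_addD !colim_scaleE [RHS]colim_addD scalerDr.
Qed.
Fact colim_scaleDl m : {morph colim_scale^~ m : a b / a + b}.
Proof.
move=> a b; have [V [xi [x ->]]] := germ_onto m.
by rewrite !colim_scaleE [RHS]colim_addD scalerDl.
Qed.
HB.instance Definition _ := GRing.Zmodule_isLmodule.Build A colim
  colim_scaleA colim_scale1 colim_scaleDr colim_scaleDl.

Lemma germP (V : vect G) (xi : lform V) (a : A) (x y : fmod F V) :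
  germ xi (a *: x + y) = a *: germ xi x + germ xi y.
Proof. by rewrite -colim_addD -colim_scaleE. Qed.

Lemma germ0 (V : vect G) (xi : lform V) : germ xi 0 = 0.
Proof. exact: germ_zero. Qed.

Lemma germ_sum (V W : vect G) (xi : lform V) (zeta : lform W) (x : fmod F V) (y : fmod F W) :
  germ (sform xi zeta) (fmor F (cinl V W : chom V (vsum V W)) x +
                        fmor F (cinr V W : chom W (vsum V W)) y) =
  germ xi x + germ zeta y.
Proof. by rewrite -colim_addE. Qed.

Lemma germ_form_linear (V : vect G) (x : fmod F V) :
  linear (fun xi : lform V => germ xi x : restr phi colim).
Proof.
move=> a xi zeta; rewrite restrZ.
rewrite -[RHS]/(colim_add (colim_scale (phi a) (germ xi x)) (germ zeta x)).
rewrite colim_scaleE colim_addE linearZ -fmor_lin -germ_mor.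
congr (germ _ _); apply: lform_ext => v.
rewrite -[RHS]/(lform_fun (sform xi zeta) (clin a (cinl V V) (cinr V V) v)) sformE.
by rewrite /= scaler0 addr0 add0r linearZ.
Qed.

(** The morphism V^* -> M which corresponds to x in F V. *)
Definition germ_form (V : vect G) (x : fmod F V) : {linear lform V -> restr phi colim} :=
  mklin (germ_form_linear x).

End Colimit.

Section ColimitComodule.
Variables (R A : comPzRingType) (phi : {rmorphism R -> A}) (G : affgrp R).
Variables (Gflat : flat (gfun G)) (Gres : resolution_property G) (F : qadd phi G).
Local Notation H := (gfun G).
Local Notation colim := (colim_of F Gflat Gres).
Local Notation germ := (germ Gflat Gres).
Local Notation germ_form := (germ_form Gflat Gres).

Lemma germ_formE (V : vect G) (x : fmod F V) xi : germ_form x xi = germ xi x.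
Proof. by []. Qed.

(** The coaction is the one for which all the maps V^* -> M, xi |-> germ xi x, are
    morphisms. *)
Lemma colim_coact_subproof : {d : {linear restr phi colim -> tensor (restr phi colim) H} |
  forall (V : vect G) (xi : lform V) (x : fmod F V),
    d (germ xi x) = tmap (germ_form x) idfun (dual_coact V xi)}.
Proof.
apply: boolp.cid.
have ex (m : colim) : exists t : tensor (restr phi colim) H,
    forall (V : vect G) (xi : lform V) (x : fmod F V),
    m = germ xi x -> t = tmap (germ_form x) idfun (dual_coact V xi).
  have [V [xi [x em]]] := germ_onto m.
  exists (tmap (germ_form x) idfun (dual_coact V xi)) => W zeta y.
  rewrite em => /germ_eq[U [f [g [eta [ef eg e]]]]].
  have key (P : vect G) (p : chom P U) (a : fmod F P) :
      tmap (germ_form a) idfun (dual_coact P (lpull p eta)) =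
      tmap (germ_form (fmor F p a)) idfun (dual_coact U eta).
    rewrite [dual_coact P _](lpull_hom_subproof p eta).
    by apply: tmap_comp => // th /=; apply: germ_mor.
  by rewrite -ef -eg !key e.
have [d hd] := choice ex.
have dlin : linear (d : restr phi colim -> tensor (restr phi colim) H).
  move=> a m n; have [V [xi [x [y [-> ->]]]]] := germ_onto2 m n.
  rewrite restrZ -germP !(hd _ V xi _ erefl).
  elim/tens_ind: (dual_coact V xi) => [th h|s t hs ht].
    rewrite !tmapE -tensZl -tensDl; congr (_ *t _).
    by rewrite !germ_formE germP.
  by rewrite !linearD hs ht addrACA.
by exists (mklin dlin) => V xi x /=; exact: (hd _ V xi x erefl).
Qed.

Definition colim_coact : {linear restr phi colim -> tensor (restr phi colim) H} :=
  sval colim_coact_subproof.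

Lemma colim_coactE (V : vect G) (xi : lform V) (x : fmod F V) :
  colim_coact (germ xi x) = tmap (germ_form x) idfun (dual_coact V xi).
Proof. exact: (svalP colim_coact_subproof). Qed.

Lemma colim_coactP : is_coaction colim_coact.
Proof.
have key (V : vect G) (x : fmod F V) (xi : vdual V) :
    colim_coact (germ_form x xi) = tmap (germ_form x) idfun (coact (vdual V) xi).
  exact: colim_coactE.
by split=> m; have [V [xi [x ->]]] := germ_onto m;
  have [] := coaction_image (key V x) xi.
Qed.

Lemma colim_coactZ (a : A) (m : colim) :
  colim_coact (a *: m) = tmap (restr_act phi colim a) idfun (colim_coact m).
Proof.
have [V [xi [x ->]]] := germ_onto m.
have e (zeta : lform V) : germ zeta (a *: x) = a *: germ zeta x.
  by have := germP Gflat Gres zeta a x 0; rewrite germ0 !addr0.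
rewrite -e !colim_coactE; symmetry; apply: tmap_comp => // zeta.
by rewrite !germ_formE e.
Qed.

Definition colim_comod : acomod phi G := Acomod colim_coactP colim_coactZ.

(** * The comparison map *)

(** The element of V (x) M whose contraction along any xi is germ xi x. *)
Definition unit_tensor (V : vect G) (x : fmod F V) : tensor V (restr phi colim) :=
  \sum_i dbv (vbasis V) i *t germ_form x (dbc (vbasis V) i : lform V).

Lemma hat_unit_tensor (V : vect G) (x : fmod F V) xi : hat (unit_tensor x) xi = germ xi x.
Proof.
rewrite hat_cont linear_sum -[RHS]germ_formE {2}(dual_basis_form (vbasis V) xi) linear_sum.
by apply: eq_bigr => i _; rewrite contE linearZ.
Qed.

Lemma unit_invariant (V : vect G) (x : fmod F V) :
  invariant (unit_tensor x : ctens V (ares colim_comod)).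
Proof.
apply: hat_hom_invariant => xi.
rewrite hat_unit_tensor [LHS]colim_coactE.
by apply: eq_tmap => // zeta; rewrite hat_unit_tensor.
Qed.

Lemma unit_linear (V : vect G) :
  linear (fun x : fmod F V => mkginv (unit_invariant x) : fmod (gamma_add colim_comod) V).
Proof.
move=> a x y; apply: ghat_ext => xi; rewrite ghatP /ghat !gval_mk !hat_unit_tensor.
exact: germP.
Qed.

Definition unit_map (V : vect G) : {linear fmod F V -> fmod (gamma_add colim_comod) V} :=
  mklin (@unit_linear V).

Lemma ghat_unit (V : vect G) (x : fmod F V) xi : ghat (unit_map V x) xi = germ xi x.
Proof. exact: hat_unit_tensor. Qed.

Lemma unit_natural (V W : vect G) (f : chom V W) (x : fmod F V) :
  unit_map W (fmor F f x) = fmor (gamma_add colim_comod) f (unit_map V x).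
Proof. by apply: ghat_ext => xi; rewrite ghat_mor !ghat_unit germ_mor. Qed.

Lemma unit_nat_subproof (V W : VectCat G) (f : arr V W) :
  compm (unit_map W : arr (F W) (gamma_add colim_comod W)) (fmap F f) =
  compm (fmap (gamma_add colim_comod) f) (unit_map V : arr (F V) (gamma_add colim_comod V)).
Proof. by apply: linear_ext => x; exact: unit_natural. Qed.

Definition unit_nat : nattrans F (gamma_add colim_comod) :=
  @Nattrans (VectCat G) (Mod A) F (gamma_add colim_comod) (fun V : vect G => unit_map V)
    unit_nat_subproof.

Hypothesis Fex : left_exact F.

(** If x contracts to zero along a dual basis, it is killed by a linearly split
    monomorphism of Vect, on which F is injective. *)
Lemma unit_inj (V : vect G) : injective (unit_map V).
Proof.
move=> x y e; apply/eqP; rewrite -subr_eq0; apply/eqP.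
have {e} z0 xi : germ xi (x - y) = 0 by rewrite -ghat_unit linearB e subrr ghat0.
move: (x - y) z0 => {x y} x x0; pose b := vbasis V.
have [|U W f g fx gx|xi _|U [f [fx hf]]] := @gather _ G V
    (fun U f => fmor F (f : chom V U) x = 0) [seq dbc b i : lform V | i <- enum (dbI b)].
- by apply: fmor_null.
- rewrite fmor_add (@fmor_comp _ _ _ _ F V U (vsum U W)) (@fmor_comp _ _ _ _ F V W (vsum U W)).
  by rewrite fx gx !linear0 addr0.
- have /germ_eq[U [f [g [zeta [ef _ e]]]]] := etrans (x0 xi) (esym (germ0 Gflat Gres F (0 : lform (vunit G)))).
  exists U, f, zeta; split=> [v|]; first by rewrite -ef.
  by rewrite e linear0.
have [i|r hr] := retraction_of_forms (f := f) (b := b).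
  by apply: hf; apply: map_f; rewrite mem_enum.
have [Q [k ex]] := split_mono_exact hr.
by have [inj _] := Fex ex; apply: inj; rewrite fx linear0.
Qed.

(** An invariant of V (x) M is, along a dual basis, given by a single y in some F W. One
    annihilates the difference of the two in V + W, and descends y along the split
    monomorphism p of V thus obtained, by exactness in the middle. *)
Lemma unit_surj (V : vect G) : surj (unit_map V).
Proof.
move=> t; pose b := vbasis V; pose M := colim_comod.
have germ_l0 (W : vect G) (y : fmod F W) : germ 0 y = 0.
  exact: (linear0 (germ_form y)).
have [W [y hy]] : exists (W : vect G) (y : fmod F W),
    forall xi, xi \in [seq dbc b i : lform V | i <- enum (dbI b)] ->
    exists zeta : lform W, ghat t xi = germ zeta y.
  elim: [seq _ | _ <- _] => [|xi s [W [y ih]]]; first by exists (vunit G), 0.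
  have [U [zeta [x e]]] := germ_onto (ghat t xi : colim).
  exists (vsum U W), (fmor F (cinl U W : chom U (vsum U W)) x +
                      fmor F (cinr U W : chom W (vsum U W)) y) => eta.
  rewrite inE => /orP[/eqP->|/ih[om ->]].
    by exists (sform zeta 0); rewrite germ_sum germ_l0 addr0 e.
  by exists (sform 0 om); rewrite germ_sum germ_l0 add0r.
have hy' i : exists zeta : lform W, ghat t (dbc b i : lform V) = germ zeta y.
  by apply: hy; apply: map_f; rewrite mem_enum.
have [zeta hz] := choice hy'.
(* The difference of t and the invariant given by y contracts to zero along the forms
   (c_i, zeta_i). *)
pose z : fmod (gamma_add M) (vsum V W) :=
  -1 *: fmor (gamma_add M) (cinr V W : chom W (vsum V W)) (unit_map W y) +
  fmor (gamma_add M) (cinl V W : chom V (vsum V W)) t.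
have [|U Z f g fx gx|om|U [f [fz hf]]] := @gather _ G (vsum V W)
    (fun U f => fmor (gamma_add M) (f : chom (vsum V W) U) z = 0)
    [seq sform (dbc b i : lform V) (zeta i) | i <- enum (dbI b)].
- by apply: fmor_null.
- rewrite fmor_add (@fmor_comp _ _ _ _ _ (vsum V W) U (vsum U Z)).
  by rewrite (@fmor_comp _ _ _ _ _ (vsum V W) Z (vsum U Z)) fx gx !linear0 addr0.
- move=> /mapP[i _ ->].
  have z0 : ghat z (sform (dbc b i : lform V) (zeta i)) = 0.
    by rewrite ghatP !ghat_mor sform_inl sform_inr ghat_unit hz scaleN1r addNr.
  have [U [f [th [hth fz]]]] := annihilate_tensor Gflat Gres (gvalP z) z0.
  by exists U, f, th; split=> //; apply: gval_inj; rewrite gamma_morE.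
(* p carries t to the invariant given by q y. *)
pose p : chom V U := ccomp f (cinl V W : chom V (vsum V W)).
pose q : chom W U := ccomp f (cinr V W : chom W (vsum V W)).
have [i|r hr] := retraction_of_forms (f := p) (b := b).
  have [|th hth] := hf (sform (dbc b i : lform V) (zeta i)).
    by apply: map_f; rewrite mem_enum.
  exists th => v; rewrite -[LHS]/(lform_fun th (f (cinl V W v))) hth.
  by rewrite sformE /= linear0 addr0.
have [Q [k ex]] := split_mono_exact hr; have [_ ker _] := ex.
have pq : fmor (gamma_add M) p t = unit_map U (fmor F q y).
  apply/eqP; rewrite -subr_eq0 unit_natural addrC -scaleN1r; apply/eqP.
  rewrite -fz /z [RHS]linearP; congr (_ *: _ + _).
    exact: (@fmor_comp _ _ _ _ _ W (vsum V W) U).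
  exact: (@fmor_comp _ _ _ _ _ V (vsum V W) U).
have kqy : fmor F k (fmor F q y) = 0.
  apply: unit_inj; rewrite unit_natural -pq -fmor_comp linear0.
  by apply: fmor_null => v; apply/ker; exists v.
have [x hx] := ((Fex ex).2 _).1 kqy.
exists x; have [inj _] := gamma_left_exact M ex; apply: inj.
by rewrite -unit_natural hx pq.
Qed.

End ColimitComodule.

(** * Isomorphisms and equivalences *)

Section Equivalence.
Variables (C D : category) (F : functor C D).

Lemma equivalence_of_ff_es : fully_faithful F -> (forall Y, ess_image F Y) -> is_equivalence F.
Proof.
move=> ff es.
have [pre preP] : exists pre : forall X Y, arr (F X) (F Y) -> arr X Y,
    forall X Y, cancel (@fmap _ _ F X Y) (pre X Y) /\ cancel (pre X Y) (@fmap _ _ F X Y).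
  have inv X Y : {g : arr (F X) (F Y) -> arr X Y |
      cancel (@fmap _ _ F X Y) g /\ cancel g (@fmap _ _ F X Y)}.
    by apply: boolp.cid; case: (ff X Y) => g fK gK; exists g.
  by exists (fun X Y => sval (inv X Y)) => X Y; exact: (svalP (inv X Y)).
have fpre X Y (h : arr (F X) (F Y)) : fmap F (pre _ _ h) = h by have [_] := preP X Y; apply.
have prefmap X Y (h : arr X Y) : pre _ _ (fmap F h) = h by have [+ _] := preP X Y; apply.
have inj X Y (h k : arr X Y) : fmap F h = fmap F k -> h = k.
  by move=> e; rewrite -(prefmap _ _ h) e prefmap.
have iso Y : {X : C & {f : arr (F X) Y & {g : arr Y (F X) |
    compm g f = idm (F X) /\ compm f g = idm Y}}}.
  have /boolp.cid[X /boolp.cid[f /boolp.cid[g h]]] := es Y.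
  by exists X, f, g.
pose K0 Y := projT1 (iso Y).
pose e Y : arr (F (K0 Y)) Y := projT1 (projT2 (iso Y)).
pose e' Y : arr Y (F (K0 Y)) := sval (projT2 (projT2 (iso Y))).
have e'e Y : compm (e' Y) (e Y) = idm (F (K0 Y)) := (svalP (projT2 (projT2 (iso Y)))).1.
have ee' Y : compm (e Y) (e' Y) = idm Y := (svalP (projT2 (projT2 (iso Y)))).2.
have eK X Y (h : arr X Y) : compm (e Y) (compm (e' Y) h) = h.
  exact: etrans (compmA _ _ _) (etrans (congr1 (fun z => compm z _) (ee' _)) (comp1m _)).
pose K1 Y Z (h : arr Y Z) : arr (K0 Y) (K0 Z) := pre _ _ (compm (e' Z) (compm h (e Y))).
have K1id Y : K1 Y Y (idm Y) = idm (K0 Y).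
  by apply: inj; rewrite fpre comp1m e'e fmap_id.
have K1comp Y Z T (g : arr Z T) (f : arr Y Z) : K1 _ _ (compm g f) = compm (K1 _ _ g) (K1 _ _ f).
  apply: inj; rewrite fmap_comp !fpre -!compmA; congr (compm _ _).
  by rewrite (compmA (e Z)) ee' comp1m.
pose K : functor D C := @Functor D C K0 K1 K1id K1comp.
exists K; split.
  have nat X Y (f : arr X Y) : compm (pre _ _ (e (F Y))) (fmap (compfunctor K F) f) =
      compm (fmap (idfunctor C) f) (pre _ _ (e (F X))).
    rewrite -[fmap (compfunctor K F) f]/(pre _ _ (compm (e' (F Y)) (compm (fmap F f) (e (F X))))).
    apply: inj; rewrite !fmap_comp !fpre; exact: eK.
  exists (@Nattrans C C (compfunctor K F) (idfunctor C) (fun X => pre _ _ (e (F X))) nat) => X.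
  exists (pre _ _ (e' (F X))); split; apply: inj;
    by rewrite fmap_comp !fpre fmap_id ?e'e ?ee'.
have nat X Y (f : arr X Y) : compm (e Y) (fmap (compfunctor F K) f) =
    compm (fmap (idfunctor D) f) (e X).
  rewrite -[fmap (compfunctor F K) f]/(fmap F (pre _ _ (compm (e' Y) (compm f (e X))))).
  by rewrite fpre; exact: eK.
exists (@Nattrans D D (compfunctor F K) (idfunctor D) e nat) => Y.
by exists (e' Y); split; [exact: e'e | exact: ee'].
Qed.

End Equivalence.

Section InverseTransformations.
Variables (R A : comPzRingType) (phi : {rmorphism R -> A}) (G : affgrp R).

Lemma linear_inv (M N : lmodType A) (f : {linear M -> N}) : injective f -> surj f ->
  {g : {linear N -> M} | cancel f g /\ cancel g f}.
Proof.
move=> inj sur; apply: boolp.cid; have [g gK] := choice sur.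
have glin : linear g by move=> a x y; apply: inj; rewrite linearP !gK.
by exists (mklin glin); split=> // x; apply: inj; rewrite /= gK.
Qed.

Lemma nattrans_inv (F K : functor (VectCat G) (Mod A)) (s : nattrans F K) :
  (forall V, injective (ncomp s V)) -> (forall V, surj (ncomp s V)) ->
  {t : nattrans K F |
    (forall V, cancel (ncomp s V) (ncomp t V)) /\ (forall V, cancel (ncomp t V) (ncomp s V))}.
Proof.
move=> inj sur; pose t V := sval (linear_inv (inj V) (sur V)).
have st V : cancel (ncomp s V) (t V) := (svalP (linear_inv (inj V) (sur V))).1.
have ts V : cancel (t V) (ncomp s V) := (svalP (linear_inv (inj V) (sur V))).2.
have nat (V W : VectCat G) (f : arr V W) :
    compm (t W : arr (K W) (F W)) (fmap K f) = compm (fmap F f) (t V : arr (K V) (F V)).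
  apply: linear_ext => x; apply: (inj W).
  transitivity (fmor K f x); first exact: ts.
  transitivity (fmor K f (ncomp s V (t V x))); first by rewrite ts.
  by rewrite -nattrans_fmor.
by exists (@Nattrans (VectCat G) (Mod A) K F t nat).
Qed.

Lemma left_exact_transport (F K : functor (VectCat G) (Mod A)) (s : nattrans F K)
    (t : nattrans K F) :
  (forall V, cancel (ncomp s V) (ncomp t V)) -> (forall V, cancel (ncomp t V) (ncomp s V)) ->
  left_exact F -> left_exact K.
Proof.
move=> st ts Fex V' V V'' i p ex; have [inj ker] := Fex _ _ _ _ _ ex; split.
  move=> x y e; apply: (can_inj (ts V')); apply: inj.
  by rewrite -!nattrans_fmor e.
move=> y; split=> [py|[x <-]].
  have /ker[x ex'] : fmor F p (ncomp t V y) = 0 by rewrite -nattrans_fmor py linear0.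
  by exists (ncomp s V' x); rewrite -nattrans_fmor ex' ts.
apply: (can_inj (ts V'')); rewrite !nattrans_fmor linear0; apply/ker.
by exists (ncomp t V' x).
Qed.

Lemma qadd_iso_left_exact (F K : qadd phi G) :
  @isomorphic (QAdd phi G) F K -> left_exact F -> left_exact K.
Proof.
move=> [s [t [e1 e2]]]; apply: (@left_exact_transport F K s t) => V x.
  exact: (congr1 (fun r : nattrans F F => ncomp r V x) e1).
exact: (congr1 (fun r : nattrans K K => ncomp r V x) e2).
Qed.

Lemma qpmon_iso_qadd (F K : qpmon phi G) :
  @isomorphic (QPMon phi G) F K -> @isomorphic (QAdd phi G) F K.
Proof.
move=> [s [t [e1 e2]]]; exists (qph s), (qph t); split.
  exact: (congr1 (@qph _ _ _ _ _ _) e1).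
exact: (congr1 (@qph _ _ _ _ _ _) e2).
Qed.

Lemma qmon_iso_qpmon (F K : qmon phi G) :
  @isomorphic (QMon phi G) F K -> @isomorphic (QPMon phi G) F K.
Proof.
move=> [s [t [e1 e2]]]; exists (qmh s), (qmh t); split.
  exact: (congr1 (@qmh _ _ _ _ _ _) e1).
exact: (congr1 (@qmh _ _ _ _ _ _) e2).
Qed.

Lemma qadd_iso_of_bij (F K : qadd phi G) (s : nattrans F K) :
  (forall V, injective (ncomp s V)) -> (forall V, surj (ncomp s V)) ->
  @isomorphic (QAdd phi G) K F.
Proof.
move=> inj sur; have [t [st ts]] := nattrans_inv inj sur.
by exists t, s; split; apply: nattrans_eq => V x; [exact: ts | exact: st].
Qed.

Lemma qpmon_inv (F K : qpmon phi G) (s : qpmon_hom F K) (t : nattrans K F) :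
  (forall V, cancel (ncomp s V) (ncomp t V)) -> (forall V, cancel (ncomp t V) (ncomp s V)) ->
  forall (V W : vect G) (x : tensor (fmod K V) (fmod K W)),
    ncomp t (vtens V W) (qp_mul K V W x) = qp_mul F V W (tmap (ncomp t V) (ncomp t W) x).
Proof.
move=> st ts V W x; apply: (can_inj (st _)); rewrite ts qphP; congr (qp_mul _ _ _ _).
elim/tens_ind: x => [x y|x y hx hy]; last by rewrite !linearD -hx -hy.
by rewrite !tmapE !ts.
Qed.

Lemma qpmon_iso_of_bij (F K : qpmon phi G) (s : qpmon_hom F K) :
  (forall V, injective (ncomp s V)) -> (forall V, surj (ncomp s V)) ->
  @isomorphic (QPMon phi G) K F.
Proof.
move=> inj sur; have [t [st ts]] := nattrans_inv inj sur.
exists (QpmonHom (qpmon_inv st ts)), s.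
by split; apply: qpmon_hom_ext => V x; [exact: ts | exact: st].
Qed.

Lemma qmon_iso_of_bij (F K : qmon phi G) (s : qmon_hom F K) :
  (forall V, injective (ncomp s V)) -> (forall V, surj (ncomp s V)) ->
  @isomorphic (QMon phi G) K F.
Proof.
move=> inj sur; have [t [st ts]] := nattrans_inv inj sur.
have one a : ncomp t (vunit G) (qm_one K a) = qm_one F a by rewrite -(qmhP s) st.
pose t' : qpmon_hom K F := QpmonHom (qpmon_inv st ts).
exists (@QmonHom _ _ _ _ K F t' one), s.
by split; apply: qmon_hom_ext => V x; [exact: ts | exact: st].
Qed.

End InverseTransformations.

(** * Linearly reductive groups *)

Section LinearlyReductive.
Variables (R A : comPzRingType) (phi : {rmorphism R -> A}) (G : affgrp R).
Hypothesis Gred : linearly_reductive G.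
Local Notation H := (gfun G).

Definition coev (V : vect G) : tensor V (vdual V) :=
  \sum_i dbv (vbasis V) i *t (dbc (vbasis V) i : lform V).

Lemma hat_coev (V : vect G) xi : hat (coev V) xi = xi.
Proof.
rewrite hat_cont linear_sum [RHS](dual_basis_form (vbasis V)); apply: eq_bigr => i _.
by rewrite contE.
Qed.

Lemma coev_invariant (V : vect G) : invariant (coev V : ctens V (vdual V)).
Proof.
apply: hat_hom_invariant => xi; rewrite hat_coev.
by rewrite (eq_tmap (f' := idfun) (g' := idfun)) ?tmap_id // => th; rewrite hat_coev.
Qed.

(** The identity of V'', seen as an invariant of V'' (x) V''^*, lifts to an invariant of
    V (x) V''^*, which is an equivariant section. *)
Lemma reductive_section (V' V V'' : vect G) (i : chom V' V) (p : chom V V'') :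
  short_exact i p -> exists s : chom V'' V, forall v, p (s v) = v.
Proof.
move=> ex; pose N := vdual V''; pose b := vbasis V''.
have ex2 := tensor_short_exact N (vectP V'').2 ex.
have [_ _ sur] := Gred (i := ctmap i (cid N)) (p := ctmap p (cid N)) ex2.
have [y hy] := sur (mkinv (coev_invariant V'')).
have {}hy : tmap p (idfun : {linear N -> N}) (val y) = coev V''.
  exact: (congr1 (fun z : inv (ctens V'' N) => val z) hy).
have yinv := invE y.
have zinv : invariant (tswap V N (val y) : ctens N V).
  by rewrite /invariant (cswap_subproof (val y)) yinv tmapE.
exists (ccomp (hat_hom zinv) (transpose (cid N))) => v.
transitivity (cont V'' (leval v) (tswap V'' N (tmap p (idfun : {linear N -> N}) (val y)))).
  transitivity (p (cont V (leval v) (tswap V N (val y)))).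
    have e : transpose (cid N) v = leval v :> lform N by exact: lform_ext.
    by rewrite -[LHS]/(p (hat (tswap V N (val y)) (transpose (cid N) v))) e.
  elim/tens_ind: (val y) => [w th|s t hs ht]; last by rewrite !linearD hs ht.
  by rewrite tmapE !tswapE !contE linearZ.
rewrite hy /coev !linear_sum [RHS](dbP b v); apply: eq_bigr => j _.
by rewrite tswapE contE.
Qed.

(** Short exact sequences of Vect split equivariantly, and any additive functor
    preserves split exact sequences. *)
Lemma reductive_left_exact (F : qadd phi G) : left_exact F.
Proof.
move=> V' V V'' i p ex; have [s ps] := reductive_section ex.
have [inj ker _] := ex; have [r0 [_ [ri _ _]]] := short_exact_split (vectP V'').2 ex.
have pi0 v : p (i v) = 0 by apply/ker; exists v.
have irE v : i (r0 (v - s (p v))) = v - s (p v).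
  have /ker[w <-] : p (v - s (p v)) = 0 by rewrite linearB ps subrr.
  by rewrite ri.
(* The linear retraction r0 becomes equivariant after the projection 1 - s p. *)
pose r1 : chom V V := clin (-1) (ccomp s p) (cid V).
have r1E v : r1 v = v - s (p v) by rewrite /= scaleN1r addrC.
have hom v : coact V' ((r0 \o r1) v) = tmap (r0 \o r1) idfun (coact V v).
  have inj2 : injective (tmap i (idfun : {linear H -> H})).
    apply: (can_inj (g := tmap r0 idfun)) => x.
    by rewrite (tmap_comp (h := idfun) (k := idfun)) // tmap_id.
  apply: inj2; rewrite -chomP (tmap_comp (h := r1) (k := idfun)) // -?chomP /=.
    by congr (coact V _); rewrite -[-1 *: _ + _]/(r1 v) r1E irE.
  by move=> w; rewrite -[-1 *: _ + _]/(r1 w) r1E irE.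
pose r : chom V V' := Chom hom.
have irsp v : cadd (ccomp i r) (ccomp s p) v = v.
  by rewrite caddE -[ccomp i r v]/(i (r0 (r1 v))) r1E irE subrK.
split=> [x y e|y].
  have Fri z : fmor F r (fmor F i z) = z.
    rewrite -fmor_comp -[RHS]fmor_id; apply: eq_fmor => v.
    by rewrite -[LHS]/(r0 (r1 (i v))) r1E pi0 linear0 subr0 ri.
  by rewrite -[x]Fri e Fri.
split=> [py|[x <-]]; last by rewrite -fmor_comp; apply: fmor_null => v; exact: pi0.
exists (fmor F r y).
transitivity (fmor F (cadd (ccomp i r) (ccomp s p)) y).
  by rewrite fmor_add !fmor_comp py linear0 addr0.
by rewrite -[RHS]fmor_id; apply: eq_fmor.
Qed.

End LinearlyReductive.

(** * Multiplicative structures *)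

Section TensorForms.
Variables (R : comPzRingType) (G : affgrp R).
Local Notation H := (gfun G).

Lemma tform_subproof (V W : lmodType R) (xi : lform V) (zeta : lform W) :
  {om : lform (tensor V W) |
   forall v w, lform_fun om (v *t w) = (lform_fun xi v : R) * (lform_fun zeta w : R)}.
Proof.
exists (trid R^o \o tmap (lform_fun xi) (lform_fun zeta) : lform _) => v w.
rewrite /= tmapE tridE; exact: mulrC.
Qed.

Definition tform (V W : lmodType R) (xi : lform V) (zeta : lform W) : lform (tensor V W) :=
  sval (tform_subproof xi zeta).

Lemma tformE (V W : lmodType R) (xi : lform V) (zeta : lform W) v w :
  lform_fun (tform xi zeta) (v *t w) = (lform_fun xi v : R) * (lform_fun zeta w : R).
Proof. by rewrite /tform; case: tform_subproof. Qed.

Lemma tensor_form_ext (V W : lmodType R) (om th : lform (tensor V W)) :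
  (forall v w, lform_fun om (v *t w) = lform_fun th (v *t w)) -> om = th.
Proof.
move=> e; apply: lform_ext => x; elim/tens_ind: x => [v w|x y hx hy]; first exact: e.
by rewrite !linearD hx hy.
Qed.

Lemma tform_bilin (V W : lmodType R) : bilin (@tform V W).
Proof.
split=> [zeta|xi] a x y; apply: tensor_form_ext => v w.
  rewrite -[RHS]/(a *: lform_fun (tform x zeta) (v *t w) + lform_fun (tform y zeta) (v *t w)).
  by rewrite !tformE mulrDl /GRing.scale /= mulrA.
rewrite -[RHS]/(a *: lform_fun (tform xi x) (v *t w) + lform_fun (tform xi y) (v *t w)).
by rewrite !tformE mulrDr /GRing.scale /= mulrCA.
Qed.

Definition tform_map (V W : lmodType R) :
    {linear tensor (lform V) (lform W) -> lform (tensor V W)} :=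
  tlift (@tform_bilin V W).

Lemma tform_mapE (V W : lmodType R) (xi : lform V) (zeta : lform W) :
  tform_map V W (xi *t zeta) = tform xi zeta.
Proof. exact: tliftE. Qed.

Lemma lpull_tform (V V' W W' : lmodType R) (f : {linear V -> V'}) (g : {linear W -> W'})
    (xi : lform V') (zeta : lform W') :
  lpull (tmap f g) (tform xi zeta) = tform (lpull f xi) (lpull g zeta).
Proof.
apply: tensor_form_ext => v w; rewrite tformE.
by rewrite -[LHS]/(lform_fun (tform xi zeta) (tmap f g (v *t w))) tmapE tformE.
Qed.

(** Contracting a product of tensors with xi (x) zeta multiplies the contractions, for
    any product m whose first component is the tensor product. *)
Lemma cont_tform (V W N P Q : lmodType R) (xi : lform V) (zeta : lform W)
    (m : {linear tensor (tensor V N) (tensor W P) -> tensor (tensor V W) Q})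
    (m' : {linear tensor N P -> Q}) :
  (forall v n w p, m ((v *t n) *t (w *t p)) = (v *t w) *t m' (n *t p)) ->
  forall x y, cont Q (lform_fun (tform xi zeta)) (m (x *t y)) =
              m' (cont N (lform_fun xi) x *t cont P (lform_fun zeta) y).
Proof.
move=> e x y.
elim/tens_ind: x => [v n|x x' hx hy]; last by rewrite !(linearD, tensDl) hx hy.
elim/tens_ind: y => [w p|y y' hx hy]; last by rewrite !(linearD, tensDr) hx hy.
by rewrite e !contE tformE tensZl tensZr !linearZ /= scalerA.
Qed.

Lemma tform_span (V W : lmodType R) (b : dual_basis V) (d : dual_basis W)
    (om : lform (tensor V W)) :
  om = \sum_i \sum_j (lform_fun om (dbv b i *t dbv d j) : R) *:
    tform (dbc b i : lform V) (dbc d j : lform W).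
Proof.
apply: tensor_form_ext => v w.
have e : v *t w = \sum_i \sum_j ((dbc b i v : R) * (dbc d j w : R)) *: (dbv b i *t dbv d j).
  rewrite {1}(dbP b v) -[LHS]/(tensl _ w _) linear_sum; apply: eq_bigr => i _.
  rewrite linearZ /= {1}(dbP d w) -[dbv b i *t _]/(tensr _ (dbv b i) _) linear_sum scaler_sumr.
  by apply: eq_bigr => j _; rewrite linearZ /= scalerA.
rewrite {1}e lform_sum linear_sum; apply: eq_bigr => i _.
rewrite lform_sum linear_sum; apply: eq_bigr => j _; rewrite linearZ.
rewrite -[RHS]/(_ *: lform_fun (tform _ _) (v *t w)) tformE.
exact: mulrC.
Qed.

Lemma hat_tform_inj (V W : vect G) (N : lmodType R) (x y : tensor (tensor V W) N) :
  (forall xi zeta, hat x (tform xi zeta) = hat y (tform xi zeta)) -> x = y.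
Proof.
move=> e; apply: (hat_inj (fgproj_tensor (vectP V) (vectP W))) => om.
rewrite (tform_span (vbasis V) (vbasis W) om) !linear_sum; apply: eq_bigr => i _.
rewrite !linear_sum; apply: eq_bigr => j _.
by rewrite !linearZ e.
Qed.

Lemma cont_leval_linear (V N : lmodType R) (y : tensor (lform V) N) :
  linear (fun v : V => cont N (leval v) y).
Proof.
move=> a v w; elim/tens_ind: y => [xi n|s t hs ht].
  by rewrite !contE /= linearP scalerDl scalerA.
by rewrite !linearD hs ht addrACA.
Qed.

(** V^* (x) W^* -> (V (x) W)^* is equivariant, the antipode being multiplicative. *)
Lemma dual_coact_tform (V W : vect G) (xi : lform V) (zeta : lform W) :
  dual_coact (vtens V W) (tform xi zeta) =
  tmap (tform_map V W) idfun (mix G _ _ (dual_coact V xi *t dual_coact W zeta)).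
Proof.
apply: (leval_ext (vectP (vtens V W))) => z.
rewrite leval_dual_coact.
pose rhs := mklin (cont_leval_linear
  (tmap (tform_map V W) (idfun : {linear H -> H}) (mix G _ _ (dual_coact V xi *t dual_coact W zeta)))).
rewrite -[RHS]/(rhs z).
elim/tens_ind: z => [v w|s t hs ht]; last by rewrite !linearD hs ht.
transitivity (algmul (gstr G) (cont H (leval v) (dual_coact V xi) *t
  cont H (leval w) (dual_coact W zeta))).
  rewrite !leval_dual_coact algmulE -antipodeM.
  have -> : mcoef (tform xi zeta : lform (vtens V W)) (v *t w) =
      ((mcoef xi v : gring G) * (mcoef zeta w : gring G) : H).
    rewrite !mcoefE [coact _ _]ctens_coactE -algmulE.
    by apply: cont_tform => *; rewrite mixE algmulE.
  by [].
rewrite -[RHS]/(cont H (leval (v *t w)) (tmap (tform_map V W) (idfun : {linear H -> H})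
  (mix G _ _ (dual_coact V xi *t dual_coact W zeta)))).
elim/tens_ind: (dual_coact V xi) => [th h|s t hs ht]; last by rewrite !(linearD, tensDl) hs ht.
elim/tens_ind: (dual_coact W zeta) => [om k|s t hs ht]; last by rewrite !(linearD, tensDr) hs ht.
rewrite mixE -algmulE tmapE !contE tform_mapE.
rewrite -[leval (v *t w) _]/(lform_fun (tform th om) (v *t w)) tformE.
by rewrite tensZl tensZr !linearZ /= scalerA.
Qed.

End TensorForms.

Section GammaMultiplicative.
Variables (R A : comPzRingType) (phi : {rmorphism R -> A}) (G : affgrp R).
Variables (Gflat : flat (gfun G)) (Gres : resolution_property G).

Lemma ghat_mul (M : qring phi G) (V W : vect G) (x : fmod (gamma_add M) V)
    (y : fmod (gamma_add M) W) xi zeta :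
  ghat (qp_mul (gamma_pmon M) V W (x *t y) : fmod (gamma_add M) (vtens V W)) (tform xi zeta) =
  qr_mul M (ghat x xi *t ghat y zeta).
Proof.
rewrite /ghat [gval _]gmulE !hat_cont.
pose m' : {linear tensor (restr phi M) (restr phi M) -> restr phi M} :=
  restr_map phi (qr_mul M) \o tproj M M.
have e v n w p : gprod M V W ((v *t n) *t (w *t p)) = (v *t w) *t m' (n *t p).
  by rewrite [LHS]gprodE /m' /= tprojE.
by rewrite (cont_tform xi zeta e) /m' /= tprojE.
Qed.

Lemma ghat_one (M : qalg phi G) (a : A^o) (xi : lform R^o) :
  ghat (qm_one (gamma_mon M) a : fmod (gamma_add M) (vunit G)) xi =
  phi (lform_fun xi 1) *: ((a : A) *: qg_one M).
Proof. by rewrite /ghat [gval _]gval_mk hat_cont contE. Qed.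

(** The map on M induced by a pseudo-monoidal transformation is multiplicative because
    products of elements are contractions of products of invariants. *)
Theorem GammaPMon_fully_faithful : fully_faithful (GammaPMon phi G).
Proof.
move=> M N.
have ring_hom (t : qpmon_hom (gamma_pmon M) (gamma_pmon N)) (z : tensor M M) :
    let u := nattrans_hom Gflat Gres t in u (qr_mul M z) = qr_mul N (tmap u u z).
  set u := nattrans_hom _ _ _ => /=.
  elim/tens_ind: z => [m n|z z' hz hz']; last by rewrite !linearD hz hz'.
  have [V [x [xi <-]]] := ghat_onto Gres m; have [W [y [zeta <-]]] := ghat_onto Gres n.
  have e : ncomp t (vtens V W) (qp_mul (gamma_pmon M) V W (x *t y)) =
      qp_mul (gamma_pmon N) V W (ncomp t V x *t ncomp t W y).
    by rewrite [LHS](qphP t) tmapE.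
  rewrite -ghat_mul -[LHS](nattrans_homE Gflat Gres t (V := vtens V W)) [ncomp _ _ _]e.
  by rewrite [LHS]ghat_mul tmapE !(nattrans_homE Gflat Gres).
exists (fun t => QringHom (ring_hom t)) => [u|t].
  apply: qring_hom_ext; apply: (gamma_add_map_inj Gres).
  by rewrite (nattrans_homK Gflat Gres).
apply: qpmon_hom_ext => V x.
by have := congr1 (fun s : nattrans _ _ => ncomp s V x) (nattrans_homK Gflat Gres t).
Qed.

(** Likewise the unit element is the contraction of the unity along the identity form. *)
Theorem GammaMon_fully_faithful : fully_faithful (GammaMon phi G).
Proof.
move=> M N; have [pre preK Kpre] := GammaPMon_fully_faithful M N.
pose id1 : lform R^o := (idfun : {linear R^o -> R^o}).
have one_hom (t : qmon_hom (gamma_mon M) (gamma_mon N)) : pre t (qg_one M) = qg_one N.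
  have one_ghat (P : qalg phi G) :
      qg_one P = ghat (qm_one (gamma_mon P) (1 : A) : fmod (gamma_add P) (vunit G)) id1.
    by rewrite ghat_one /= rmorph1 !scale1r.
  rewrite (one_ghat M) (one_ghat N) -(qmhP t) -(ghat_map (pre t)).
  by have -> : gamma_add_map (pre t) = t by exact: (congr1 (@qph _ _ _ _ _ _) (Kpre t)).
exists (fun t => QalgHom (one_hom t)) => [u|t].
  apply: qalg_hom_ext => m.
  by have := congr1 (fun v : qring_hom M N => v m) (preK u).
apply: qmon_hom_ext => V x.
by have := congr1 (fun s : qpmon_hom _ _ => ncomp s V x) (Kpre t).
Qed.

End GammaMultiplicative.

Section ColimitRing.
Variables (R A : comPzRingType) (phi : {rmorphism R -> A}) (G : affgrp R).
Variables (Gflat : flat (gfun G)) (Gres : resolution_property G) (F : qpmon phi G).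
Local Notation H := (gfun G).
Local Notation M := (colim_comod Gflat Gres F).
Local Notation colim := (colim_of F Gflat Gres).
Local Notation germ := (germ Gflat Gres).
Local Notation germ_form := (germ_form Gflat Gres).

Definition fmul (V W : vect G) (x : fmod F V) (y : fmod F W) : fmod F (vtens V W) :=
  qp_mul F V W (x *t y).

(** Independence of the representatives is the naturality of the multiplication of F. *)
Lemma colim_mul_subproof (m n : colim) : {p : colim |
  forall (V W : vect G) (xi : lform V) (zeta : lform W) (x : fmod F V) (y : fmod F W),
  m = germ xi x -> n = germ zeta y ->
  p = germ (tform xi zeta : lform (vtens V W)) (fmul x y)}.
Proof.
apply: boolp.cid.
have [V [xi [x em]]] := germ_onto m; have [W [zeta [y en]]] := germ_onto n.
exists (germ (tform xi zeta : lform (vtens V W)) (fmul x y)).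
move=> V' W' xi' zeta' x' y'; rewrite em en => /germ_eq[U [f [f' [eta [ef ef' e]]]]].
move=> /germ_eq[T [g [g' [th [eg eg' d]]]]].
have key (P Q : vect G) (p : chom P U) (q : chom Q T) (a : fmod F P) (b : fmod F Q) :
    germ (tform (lpull p eta) (lpull q th) : lform (vtens P Q)) (fmul a b) =
    germ (tform eta th : lform (vtens U T)) (fmul (fmor F p a) (fmor F q b)).
  rewrite -lpull_tform /fmul -tmapE -qp_nat.
  exact: (germ_mor Gflat Gres (ctmap p q : chom (vtens P Q) (vtens U T))).
by rewrite -ef -eg -ef' -eg' !key e d.
Qed.

Definition colim_mul (m n : colim) : colim := sval (colim_mul_subproof m n).

Lemma colim_mulE (V W : vect G) (xi : lform V) (zeta : lform W) (x : fmod F V) (y : fmod F W) :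
  colim_mul (germ xi x) (germ zeta y) = germ (tform xi zeta : lform (vtens V W)) (fmul x y).
Proof. exact: (svalP (colim_mul_subproof _ _)). Qed.

Lemma colim_mul_bilin : bilin colim_mul.
Proof.
split=> [p|p] a m n; have [V [xi [x [y [-> ->]]]]] := germ_onto2 m n;
  have [W [zeta [z ->]]] := germ_onto p; rewrite -germP !colim_mulE -germP; congr (germ _ _).
  by rewrite /fmul tensDl tensZl linearP.
by rewrite /fmul tensDr tensZr linearP.
Qed.

Definition colim_mul_lin : {linear tensor colim colim -> colim} := tlift colim_mul_bilin.

Lemma colim_mul_linE (V W : vect G) (xi : lform V) (zeta : lform W) (x : fmod F V) (y : fmod F W) :
  colim_mul_lin (germ xi x *t germ zeta y) = germ (tform xi zeta : lform (vtens V W)) (fmul x y).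
Proof. by rewrite -colim_mulE; exact: tliftE. Qed.

Lemma colim_mul_hom_subproof (z : atens M M) :
  acoact M (colim_mul_lin z : M) =
  tmap (restr_map phi (colim_mul_lin : {linear atens M M -> M})) idfun (acoact (atens M M) z).
Proof.
elim/tens_ind: z => [m n|z z' hz hz'].
  have [V [xi [x ->]]] := germ_onto m; have [W [zeta [y ->]]] := germ_onto n.
  have -> : acoact (atens M M) (germ xi x *t germ zeta y : tensor M M) =
      tmap (tproj M M) idfun (tmap (tmap (germ_form x) (germ_form y)) idfun
        (mix G _ _ (dual_coact V xi *t dual_coact W zeta))).
    rewrite -mix_tmap -!colim_coactE.
    rewrite -[RHS]/(tmap (tproj M M) idfun
      (mix G _ _ (coact (ares M) _ *t coact (ares M) _))).
    rewrite -ctens_coactE -[RHS]atens_coact_proj; congr (atens_coact _ _ _).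
    by rewrite tprojE.
  rewrite colim_mul_linE [LHS]colim_coactE dual_coact_tform.
  elim/tens_ind: (mix _ _ _ _) => [t h|s t hs ht]; last by rewrite !linearD hs ht.
  rewrite !tmapE; congr (_ *t _).
  elim/tens_ind: t => [th om|s t hs ht]; last by rewrite !linearD hs ht.
  by rewrite tform_mapE tmapE tprojE !germ_formE -[RHS]/(colim_mul_lin _) colim_mul_linE.
by rewrite [X in acoact M X]linearD !linearD hz hz'.
Qed.

Definition colim_ring : qring phi G :=
  @Qring _ _ _ _ M (Ahom colim_mul_hom_subproof).

Lemma unit_mul (V W : vect G) (x : tensor (fmod F V) (fmod F W)) :
  ncomp (unit_nat Gflat Gres F) (vtens V W) (qp_mul F V W x) =
  qp_mul (gamma_pmon colim_ring) V W
    (tmap (ncomp (unit_nat Gflat Gres F) V) (ncomp (unit_nat Gflat Gres F) W) x).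
Proof.
elim/tens_ind: x => [x y|x y hx hy]; last by rewrite !linearD hx hy.
apply: gval_inj; apply: hat_tform_inj => xi zeta; rewrite tmapE.
rewrite -[RHS]/(ghat (qp_mul (gamma_pmon colim_ring) V W
  (unit_map Gflat Gres F V x *t unit_map Gflat Gres F W y)
  : fmod (gamma_add colim_ring) (vtens V W)) (tform xi zeta)).
rewrite ghat_mul -[LHS]/(ghat (unit_map Gflat Gres F (vtens V W) (fmul x y)) (tform xi zeta)).
by rewrite !ghat_unit -colim_mul_linE.
Qed.

Definition unit_pmon : qpmon_hom F (gamma_pmon colim_ring) :=
  @QpmonHom _ _ _ _ F (gamma_pmon colim_ring) (unit_nat Gflat Gres F) unit_mul.

End ColimitRing.

Section ColimitAlgebra.
Variables (R A : comPzRingType) (phi : {rmorphism R -> A}) (G : affgrp R).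
Variables (Gflat : flat (gfun G)) (Gres : resolution_property G) (F : qmon phi G).
Local Notation H := (gfun G).
Local Notation M := (colim_ring Gflat Gres F).
Local Notation germ := (germ Gflat Gres).
Local Notation germ_form := (germ_form Gflat Gres).

Lemma colim_ring_mulE (V W : vect G) (xi : lform V) (zeta : lform W) (x : fmod F V) (y : fmod F W) :
  qr_mul M ((germ xi x : M) *t (germ zeta y : M)) =
  germ (tform xi zeta : lform (vtens V W)) (fmul x y).
Proof. exact: colim_mul_linE. Qed.

Lemma colim_comm (z : tensor M M) : qr_mul M (tswap _ _ z) = qr_mul M z.
Proof.
elim/tens_ind: z => [m n|z z' hz hz']; last by rewrite !linearD hz hz'.
have [V [xi [x ->]]] := germ_onto m; have [W [zeta [y ->]]] := germ_onto n.
rewrite tswapE !colim_ring_mulE.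
have <- : fmor F (cswap V W : chom (vtens V W) (vtens W V)) (fmul x y) = fmul y x.
  by rewrite [LHS]qm_sym tswapE.
rewrite -germ_mor; congr (germ _ _); apply: tensor_form_ext => v w.
rewrite -[LHS]/(lform_fun (tform zeta xi) (tswap V W (v *t w))) tswapE !tformE.
exact: mulrC.
Qed.

Lemma colim_assoc (z : tensor (tensor M M) M) :
  qr_mul M (tmap (qr_mul M) idfun z) = qr_mul M (tmap idfun (qr_mul M) (tassoc _ _ _ z)).
Proof.
elim/tens_ind: z => [z p|z z' hz hz']; last by rewrite !linearD hz hz'.
elim/tens_ind: z => [m n|z z' hz hz']; last by rewrite !(linearD, tensDl) hz hz'.
have [U [xi [x ->]]] := germ_onto m; have [V [zeta [y ->]]] := germ_onto n.
have [W [om [z ->]]] := germ_onto p.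
rewrite tassocE !tmapE !lidE !colim_ring_mulE.
have <- : fmor F (cassoc U V W : chom (vtens (vtens U V) W) (vtens U (vtens V W)))
    (fmul (fmul x y) z) = fmul x (fmul y z).
  by have := @qm_assoc _ _ _ _ F U V W ((x *t y) *t z); rewrite tassocE !tmapE.
rewrite -germ_mor; congr (germ _ _); apply: tensor_form_ext => t w.
rewrite -[RHS]/(lform_fun (tform xi (tform zeta om)) (tassoc U V W (t *t w))).
elim/tens_ind: t => [u v|s t hs ht]; last by rewrite !(linearD, tensDl) hs ht.
by rewrite tassocE !tformE mulrA.
Qed.

Definition id_form : lform (vunit G) := (idfun : {linear R^o -> R^o}).

Definition colim_one : M := germ id_form (qm_one F (1 : A)).

Lemma colim_one_inv : invariant (colim_one : ares M).
Proof.
rewrite /invariant [LHS]colim_coactE.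
have -> : dual_coact (vunit G) id_form = id_form *t (alg1 (gstr G) : H).
  apply: (leval_ext (vectP (vunit G))) => r.
  rewrite leval_dual_coact contE mcoefE [coact _ _]cunit_coactE contE linearZ.
  by rewrite antipode1.
by rewrite tmapE.
Qed.

Lemma colim_mul1m (m : M) : qr_mul M (colim_one *t m) = m.
Proof.
have [V [xi [x ->]]] := germ_onto m; rewrite colim_ring_mulE.
have e : fmor F (clid V : chom (vtens (vunit G) V) V) (fmul (qm_one F (1 : A)) x) = x.
  by have := @qm_mul1m _ _ _ _ F V ((1 : A^o) *t x); rewrite tmapE tlidE scale1r.
rewrite -{2}e -germ_mor; congr (germ _ _); apply: tensor_form_ext => r v.
rewrite -[RHS]/(lform_fun xi (tlid V (r *t v))) tlidE tformE.
by rewrite linearZ.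
Qed.

Lemma colim_mulm1 (m : M) : qr_mul M (m *t colim_one) = m.
Proof. by rewrite -colim_comm tswapE colim_mul1m. Qed.

Definition colim_alg : qalg phi G :=
  @Qalg _ _ _ _ M colim_comm colim_assoc colim_one colim_one_inv colim_mul1m colim_mulm1.

Lemma unit_one (a : A^o) :
  ncomp (unit_pmon Gflat Gres F) (vunit G) (qm_one F a) = qm_one (gamma_mon colim_alg) a.
Proof.
apply: (@ghat_ext _ _ _ _ colim_alg) => xi; rewrite [LHS]ghat_unit ghat_one.
have -> : xi = (lform_fun xi (1 : R) : R) *: id_form.
  apply: lform_ext => r; rewrite -[RHS]/((lform_fun xi (1 : R) : R) *: r).
  by rewrite -{1}[r]mulr1 -[r * 1]/(r *: (1 : R^o)) linearZ; exact: mulrC.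
have e c : germ_form (qm_one F a) (c *: id_form) = c *: germ_form (qm_one F a) id_form.
  by rewrite linearZ.
rewrite [LHS]e [LHS]restrZ; congr (phi _ *: _).
  by rewrite -[RHS]/((lform_fun xi (1 : R) : R) * 1) mulr1.
have := germP Gflat Gres id_form (a : A) (qm_one F (1 : A)) 0.
rewrite !germ0 !addr0 => <-; rewrite germ_formE; congr (germ _ _).
by rewrite -linearZ; congr (qm_one F _); rewrite -[RHS]/((a : A) * 1) mulr1.
Qed.

Definition unit_mon : qmon_hom F (gamma_mon colim_alg) :=
  @QmonHom _ _ _ _ F (gamma_mon colim_alg) (unit_pmon Gflat Gres F) unit_one.

End ColimitAlgebra.

(** * The equivalences *)

Section EssentialImages.
Variables (R A : comPzRingType) (phi : {rmorphism R -> A}) (G : affgrp R).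
Variables (Gflat : flat (gfun G)) (Gres : resolution_property G).

Lemma GammaAdd_ess_image (F : qadd phi G) : ess_image (GammaAdd phi G) F <-> left_exact F.
Proof.
split=> [[M iso]|Fex].
  exact: (qadd_iso_left_exact iso) (gamma_left_exact M).
exists (colim_comod Gflat Gres F); apply: (qadd_iso_of_bij (s := unit_nat Gflat Gres F)).
- by move=> V; exact: unit_inj.
- by move=> V; exact: unit_surj.
Qed.

Lemma GammaPMon_ess_image (F : qpmon phi G) : ess_image (GammaPMon phi G) F <-> left_exact F.
Proof.
split=> [[M /qpmon_iso_qadd iso]|Fex].
  exact: (qadd_iso_left_exact iso) (gamma_left_exact M).
exists (colim_ring Gflat Gres F); apply: (qpmon_iso_of_bij (s := unit_pmon Gflat Gres F)).
- by move=> V; exact: unit_inj.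
- by move=> V; exact: unit_surj.
Qed.

Lemma GammaMon_ess_image (F : qmon phi G) : ess_image (GammaMon phi G) F <-> left_exact F.
Proof.
split=> [[M /qmon_iso_qpmon/qpmon_iso_qadd iso]|Fex].
  exact: (qadd_iso_left_exact iso) (gamma_left_exact M).
exists (colim_alg Gflat Gres F); apply: (qmon_iso_of_bij (s := unit_mon Gflat Gres F)).
- by move=> V; exact: unit_inj.
- by move=> V; exact: unit_surj.
Qed.

End EssentialImages.

Theorem theorem8p6 (R A : comPzRingType) (phi : {rmorphism R -> A}) (G : affgrp R)
  (Gflat : flat (gfun G)) (Gres : resolution_property G) :
  [/\ fully_faithful (GammaAdd phi G) /\
      (forall F : qadd phi G, ess_image (GammaAdd phi G) F <-> left_exact F),
      fully_faithful (GammaPMon phi G) /\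
      (forall F : qpmon phi G, ess_image (GammaPMon phi G) F <-> left_exact F),
      fully_faithful (GammaMon phi G) /\
      (forall F : qmon phi G, ess_image (GammaMon phi G) F <-> left_exact F) &
      linearly_reductive G ->
      [/\ is_equivalence (GammaAdd phi G), is_equivalence (GammaPMon phi G) &
          is_equivalence (GammaMon phi G)]].
Proof.
have ffA := GammaAdd_fully_faithful (phi := phi) Gflat Gres.
have ffP := GammaPMon_fully_faithful (phi := phi) Gflat Gres.
have ffM := GammaMon_fully_faithful (phi := phi) Gflat Gres.
have esA := GammaAdd_ess_image (phi := phi) Gflat Gres.
have esP := GammaPMon_ess_image (phi := phi) Gflat Gres.
have esM := GammaMon_ess_image (phi := phi) Gflat Gres.
split=> // Gred; split; apply: equivalence_of_ff_es => // F.
- by apply/esA/reductive_left_exact.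
- by apply/esP/(reductive_left_exact Gred).
- by apply/esM/(reductive_left_exact Gred).
Qed.
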